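(* (Gamma theorem for $T^*\mathcal F_\lambda$.) Let $\tilde\kappa=1$. The leading term of the asymptotics of the $q$-hypergeometric solutions $\bigl(\hat\Psi_I(z;h;\tilde q;\tilde\kappa)\bigr)_{I\in\mathcal I_\lambda}$ as $\tilde q_i/\tilde q_{i+1}\to0$, $i=1,\dots,N-1$, is the product of the equivariant gamma class of $T^*\mathcal F_\lambda$ and the exponentials of the equivariant first Chern classes of the associated vector bundles $E_1,\dots,E_N$: $$\hat\Gamma_{T^*\mathcal F_\lambda}\ \prod_{i=1}^N\bigl(e^{\pi\sqrt{-1}(\lambda_i-n)}\,\tilde q_i\bigr)^{c_1(E_i)};$$ that is, for every $I\in\mathcal I_\lambda$ the leading term of $\hat\Psi_I$ is this class multiplied by $\Delta_I$ (equivalently, the value of this class at the fixed point $x_I$, given by $\{\gamma_{i,1},\dots,\gamma_{i,\lambda_i}\}=\{z_a: a\in I_i\}$, times $\Delta_I$).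
   Context: Fix positive integers $N,n$ and $\tilde\kappa\in\mathbb C^\times$. Let $\lambda=(\lambda_1,\dots,\lambda_N)\in\mathbb Z_{\ge0}^N$, $\lambda_1+\dots+\lambda_N=n$; $\lambda^{(i)}=\lambda_1+\dots+\lambda_i$, $\lambda^{\{1\}}=\sum_{i=1}^{N-1}\lambda^{(i)}$, $\lambda_{\{2\}}=\sum_{1\le i<j\le N}\lambda_i\lambda_j$. $\mathcal I_\lambda$ is the set of ordered partitions $I=(I_1,\dots,I_N)$ of $\{1,\dots,n\}$ with $|I_j|=\lambda_j$; write $I_1\cup\dots\cup I_j=\{i^{(j)}_1<\dots<i^{(j)}_{\lambda^{(j)}}\}$. Empty products equal 1. Variables $t=(t^{(j)}_a)$, $1\le j\le N-1$, $1\le a\le\lambda^{(j)}$; $\mathrm{Sym}_t=\mathrm{Sym}_{t^{(1)}_1,\dots,t^{(1)}_{\lambda^{(1)}}}\cdots\mathrm{Sym}_{t^{(N-1)}_1,\dots,t^{(N-1)}_{\lambda^{(N-1)}}}$, where $\mathrm{Sym}_{x_1,\dots,x_k}f=\sum_{\sigma\in S_k}f(x_{\sigma(1)},\dots,x_{\sigma(k)})$. Cohomology. $\mathcal F_\lambda$ is the variety of flags $0=F_0\subset\dots\subset F_N=\mathbb C^n$ with $\dim F_i/F_{i-1}=\lambda_i$; $T=A\times\mathbb C^\times$, $A\subset GL_n(\mathbb C)$ the diagonal torus, $\mathbb C^\times$ scaling the fibers of $T^*\mathcal F_\lambda$ with weight $-h$. $E_i$ is the vector bundle with fiber $F_i/F_{i-1}$,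 with Chern roots $\gamma_{i,1},\dots,\gamma_{i,\lambda_i}$ and $c_1(E_i)=\sum_{a}\gamma_{i,a}$; $\Gamma$ denotes the collection of all $\gamma_{i,a}$, and $$H^*_T(T^*\mathcal F_\lambda)=\mathbb C[\Gamma]^{S_{\lambda_1}\times\dots\times S_{\lambda_N}}\otimes\mathbb C[z]\otimes\mathbb C[h]\Big/\Bigl\langle\prod_{i=1}^N\prod_{j=1}^{\lambda_i}(u-\gamma_{i,j})=\prod_{a=1}^n(u-z_a)\Bigr\rangle .$$ For $f$ symmetric in each group $\gamma_{i,\cdot}$, $f(z_J)$ denotes the substitution $\{\gamma_{i,1},\dots,\gamma_{i,\lambda_i}\}=\{z_a:a\in J_i\}$ (the restriction to the fixed point $x_J$). Classes are taken in $H^*_T(T^*\mathcal F_\lambda)$ extended by functions of $z,h$ holomorphic on the domain below; a holomorphic function of $\Gamma,z,h$ symmetric in each group represents the class with restrictions $f(z_J)$, $J\in\mathcal I_\lambda$. The equivariant gamma class is $$\hat\Gamma_{T^*\mathcal F_\lambda}=\prod_{1\le i<j\le N}\prod_{a=1}^{\lambda_i}\prod_{b=1}^{\lambda_j}\Gamma(1+\gamma_{j,b}-\gamma_{i,a})\,\Gamma(1+\gamma_{i,a}-\gamma_{j,b}-h).$$ $\Delta_I=\prod_{i<j}\prod_{a=1}^{\lambda_i}\prod_{b\in I_j}(\gamma_{i,a}-z_b)\Big/\prod_{i<j}\prod_{a\in I_i}\prod_{b\in I_j}(z_a-z_b)$ is the class with $\Delta_I(z_J)=\delta_{I,J}$.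 The functions $\hat\Psi_I$. Put $$\hat W(t;\Gamma)=\mathrm{Sym}_t\prod_{j=1}^{N-1}\prod_{a=1}^{\lambda^{(j)}}\Bigl(\prod_{c=1}^{a-1}(t^{(j)}_a-t^{(j+1)}_c-h)\prod_{d=a+1}^{\lambda^{(j+1)}}(t^{(j)}_a-t^{(j+1)}_d)\prod_{b=a+1}^{\lambda^{(j)}}\frac{t^{(j)}_a-t^{(j)}_b-h}{t^{(j)}_a-t^{(j)}_b}\Bigr)$$ with $(t^{(N)}_1,\dots,t^{(N)}_n)=(\gamma_{1,1},\dots,\gamma_{1,\lambda_1},\dots,\gamma_{N,1},\dots,\gamma_{N,\lambda_N})$, and $Q(\Gamma)=\prod_{i<j}\prod_{a=1}^{\lambda_i}\prod_{b=1}^{\lambda_j}(\gamma_{i,a}-\gamma_{j,b}-h)$. For a step $\kappa$, with $\phi(x)=\Gamma(x/\kappa)\Gamma((h-x)/\kappa)$ and $t^{(N)}_a=z_a$, $$\Phi_\lambda(t;z;h;q;\kappa)=(e^{\pi\sqrt{-1}(n-\lambda_N)}q_N)^{\sum_a z_a/\kappa}\prod_{i=1}^{N-1}\Bigl(e^{\pi\sqrt{-1}(\lambda_{i+1}-\lambda_i)}\frac{q_i}{q_{i+1}}\Bigr)^{\sum_j t^{(i)}_j/\kappa}\prod_{i=1}^{N-1}\prod_{a=1}^{\lambda^{(i)}}\Bigl(\prod_{b\ne a}\frac1{(t^{(i)}_a-t^{(i)}_b-h)\phi(t^{(i)}_a-t^{(i)}_b)}\prod_{c=1}^{\lambda^{(i+1)}}\phi(t^{(i)}_a-t^{(i+1)}_c)\Bigr).$$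 Powers: $(e^{\pi\sqrt{-1}m}q)^x=e^{x(\pi\sqrt{-1}m+\log q)}$, $\log(q_i/q_{i+1})=\log q_i-\log q_{i+1}$, $\log\tilde q_i^{-1}=-\log\tilde q_i$ for fixed branches of $\log\tilde q_i$. $\Sigma_I$ is the point $t^{(k)}_a=z_{i^{(k)}_a}$; $\mathrm{Res}_{t=s}$ is the iterated residue $\mathrm{Res}_{t^{(1)}_1=s^{(1)}_1}\cdots\mathrm{Res}_{t^{(N-1)}_{\lambda^{(N-1)}}=s^{(N-1)}_{\lambda^{(N-1)}}}$ (rightmost first). $\hat\Omega_\lambda(\tilde q;\tilde\kappa)=\prod_{i<j}(1-\tilde q_i/\tilde q_j)^{h\min(0,\lambda_j-\lambda_i)/\tilde\kappa}$ (principal branch). Then, with $\tilde q^{-1}=(\tilde q_1^{-1},\dots,\tilde q_N^{-1})$, $$\hat\Psi_I(z;h;\tilde q;\tilde\kappa)=\tilde\kappa^{-\lambda^{\{1\}}-2\lambda_{\{2\}}}(-1)^{\lambda^{\{1\}}+\lambda_{\{2\}}}\bigl(\Gamma(-h/\tilde\kappa)\bigr)^{-\lambda^{\{1\}}}\hat\Omega_\lambda(\tilde q;\tilde\kappa)\sum_{r\in\mathbb Z_{\ge0}^{\lambda^{\{1\}}}}\mathrm{Res}_{t=\Sigma_I+r\tilde\kappa}\bigl(\Phi_\lambda(t;z;h;\tilde q^{-1};-\tilde\kappa)\bigr)\,Q(\Gamma)\,\hat W(\Sigma_I+r\tilde\kappa;\Gamma),$$ on the domain $h\notin\tilde\kappa\mathbb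 Z_{\ge0}$, $z_a-z_b\notin\tilde\kappa\mathbb Z$, $z_a-z_b+h\notin\tilde\kappa\mathbb Z$ ($a\ne b$), $|\tilde q_i/\tilde q_{i+1}|<1$ (for $h\in\tilde\kappa\mathbb Z_{<0}$ by analytic continuation). Each $\hat\Psi_I$ equals $\prod_{i=1}^N\tilde q_i^{\,\sum_{a\in I_i}z_a/\tilde\kappa}$ times a power series in $\tilde q_1/\tilde q_2,\dots,\tilde q_{N-1}/\tilde q_N$; its leading term is this factor times the constant term of the series. *)

(* Defs.v *)
From HB Require Import structures.
From mathcomp Require Export all_boot all_order all_algebra perm.
From mathcomp Require Export all_classical all_reals all_analysis.
From mathcomp Require Export complex finmap.
From mathcomp Require summability.

Export Order.TTheory GRing.Theory Num.Theory.
Export numFieldNormedType.Exports.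

#[export] Set Implicit Arguments.
#[export] Unset Strict Implicit.
#[export] Unset Printing Implicit Defensive.

Local Open Scope classical_set_scope.
Local Open Scope ring_scope.
Local Open Scope complex_scope.

(* The topology of the modulus on the complex numbers R[i]. *)
HB.instance Definition _ (R : realType) := NormedModule.copy R[i] R[i]^o.

(** Complex analysis *)

Definition cexp (R : realType) (x : R[i]) : R[i] :=
  (expR (complex.Re x))%:C * (cos (complex.Im x) +i* sin (complex.Im x)).

(* The principal argument, with values in ]-pi, pi]. *)
Definition carg (R : realType) (w : R[i]) : R :=
  let t := acos (complex.Re w / complex.Re `|w|) in
  if 0 <= complex.Im w then t else - t.

Definition clog (R : realType) (w : R[i]) : R[i] :=
  ln (complex.Re `|w|) +i* carg w.

Definition cpow (R : realType) (w s : R[i]) : R[i] := cexp (s * clog w).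

(* Gauss' product for the Gamma function,
   m! m^x / (x (x + 1) ... (x + m)) as m -> oo;
   the value at the poles 0, -1, -2, ... is irrelevant. *)
Definition cGamma (R : realType) (x : R[i]) : R[i] :=
  lim ((fun m : nat =>
          (m`!)%:R * cexp (x * (ln (m%:R : R))%:C)
            / \prod_(k < m.+1) (x + k%:R)) @ \oo).

Definition circle_integral (R : realType) (f : R[i] -> R[i]) (s : R[i])
    (rho : R) : R[i] :=
  let g (th : R) : R[i] :=
    let e := rho%:C * cexp ('i * th%:C) in f (s + e) * ('i * e) in
  (\int[lebesgue_measure]_(th in `[0, (2 * pi)]) complex.Re (g th))
    +i* (\int[lebesgue_measure]_(th in `[0, (2 * pi)]) complex.Im (g th)).

(* At an isolated singularity s the normalized circle integral does not depend
   on the small radius rho, so that the limit below is its common value. *)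
Definition residue (R : realType) (f : R[i] -> R[i]) (s : R[i]) : R[i] :=
  lim ((fun rho : R => (2 * 'i * pi%:C)^-1 * circle_integral f s rho) @ 0^'+).

(** Combinatorics of lambda *)

(* lam = (lambda_1, ..., lambda_N) is a tuple indexed from 0, whereas levels are
   indexed as in the usual notation: psum lam j = lambda^(j) is the sum of the
   first j parts, and n = lambda_1 + ... + lambda_N is psum lam N. *)
Definition part (N : nat) (lam : N.-tuple nat) (i : nat) : nat := nth 0%N lam i.

Definition psum (N : nat) (lam : N.-tuple nat) (j : nat) : nat :=
  \sum_(i < j) part lam i.

(* lambda^{1}, the number of variables t *)
Definition nvars (N : nat) (lam : N.-tuple nat) : nat :=
  \sum_(1 <= j < N) psum lam j.

(* lambda_{2}, the dimension of the flag variety *)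
Definition fldim (N : nat) (lam : N.-tuple nat) : nat :=
  \sum_(i < N) \sum_(j < N | (i < j)%N) (part lam i * part lam j)%N.

Definition ordered_partition (N : nat) (lam : N.-tuple nat)
    (I : 'I_N -> {set 'I_(psum lam N)}) : Prop :=
  [/\ forall i j, i != j -> (I i :&: I j)%SET = finset.set0,
      (\bigcup_(i < N) I i)%SET = [set: 'I_(psum lam N)]%SET
    & forall i, #|I i| = part lam i].

(* I_1 \cup ... \cup I_j *)
Definition blocks_upto (N : nat) (lam : N.-tuple nat)
    (I : 'I_N -> {set 'I_(psum lam N)}) (j : nat) : {set 'I_(psum lam N)} :=
  (\bigcup_(i < N | (i < j)%N) I i)%SET.

(* Families (t^(j)_a); only the levels 1, ..., N are meaningful. *)
Definition tfam (R : realType) (N : nat) (lam : N.-tuple nat) : Type :=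
  forall j : nat, 'I_(psum lam j) -> R[i].

Definition set_level (R : realType) (N : nat) (lam : N.-tuple nat)
    (t : tfam R lam) (j : nat) (x : 'I_(psum lam j) -> R[i]) : tfam R lam :=
  @dfwith nat (fun k => 'I_(psum lam k) -> R[i]) t j x.

Definition set_var (R : realType) (N : nat) (lam : N.-tuple nat)
    (t : tfam R lam) (j : nat) (a : 'I_(psum lam j)) (x : R[i]) : tfam R lam :=
  set_level t (fun b => if b == a then x else t j b).

Definition Sym_level (R : realType) (N : nat) (lam : N.-tuple nat) (j : nat)
    (f : tfam R lam -> R[i]) : tfam R lam -> R[i] :=
  fun t => \sum_(s : 'S_(psum lam j)) f (set_level t (fun a => t j (s a))).

(* Sym over the levels 1, ..., N - 1 *)
Definition Sym_t (R : realType) (N : nat) (lam : N.-tuple nat)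
    (f : tfam R lam -> R[i]) : tfam R lam -> R[i] :=
  foldr (fun j f => Sym_level j f) f (iota 1 N.-1).

(* t^(1)_1, ..., t^(1)_(lambda^(1)), ..., t^(N-1)_(lambda^(N-1)) *)
Definition tvars (N : nat) (lam : N.-tuple nat) :
    seq {j : nat & 'I_(psum lam j)} :=
  [seq Tagged (fun j => 'I_(psum lam j)) a
     | j <- iota 1 N.-1, a <- enum 'I_(psum lam j)].

(* Iterated residue at t = s, over the last variable first. The result does not
   depend on the variables of the levels 1, ..., N - 1, and is evaluated at s. *)
Definition iter_residue (R : realType) (N : nat) (lam : N.-tuple nat)
    (f : tfam R lam -> R[i]) (s : tfam R lam) : R[i] :=
  foldr (fun v F t =>
           residue (fun x => F (set_var t (tagged v) x)) (s (tag v) (tagged v)))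
        f (tvars lam) s.

(** Equivariant cohomology of T^* F_lambda *)

(* Families of Chern roots gamma_(i,a). For fixed z and h, a function of the
   Chern roots stands for the class whose restriction to the fixed point x_J
   is its value under the substitution {gamma_(i,a)} = {z_a : a in J_i}. *)
Definition chern_roots (R : realType) (N : nat) (lam : N.-tuple nat) : Type :=
  forall i : 'I_N, 'I_(part lam i) -> R[i].

Definition coh_class (R : realType) (N : nat) (lam : N.-tuple nat) : Type :=
  chern_roots R lam -> R[i].

(* All orderings of {z_a : a in J_i} are allowed. *)
Definition at_fixed_point (R : realType) (N : nat) (lam : N.-tuple nat)
    (z : 'I_(psum lam N) -> R[i]) (J : 'I_N -> {set 'I_(psum lam N)})
    (g : chern_roots R lam) : Prop :=
  forall i, perm_eq [seq g i a | a <- enum 'I_(part lam i)]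
                    [seq z b | b <- enum (J i)].

Definition eq_class (R : realType) (N : nat) (lam : N.-tuple nat)
    (z : 'I_(psum lam N) -> R[i]) (f f' : coh_class R lam) : Prop :=
  forall J, ordered_partition J ->
  forall g, at_fixed_point z J g -> f g = f' g.

(* (gamma_(1,1), ..., gamma_(1,lambda_1), ..., gamma_(N,lambda_N)) *)
Definition concat_roots (R : realType) (N : nat) (lam : N.-tuple nat)
    (g : chern_roots R lam) : 'I_(psum lam N) -> R[i] :=
  fun b => let b' : 'I_(\sum_(i < N) part lam i) := b in
    g (tagnat.sig1 b') (tagnat.sig2 b').

Definition c1 (R : realType) (N : nat) (lam : N.-tuple nat) (i : 'I_N) :
    coh_class R lam :=
  fun g => \sum_(a < part lam i) g i a.

Definition gamma_class (R : realType) (N : nat) (lam : N.-tuple nat)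
    (h : R[i]) : coh_class R lam :=
  fun g => \prod_(i < N) \prod_(j < N | (i < j)%N)
    \prod_(a < part lam i) \prod_(b < part lam j)
      (cGamma (1 + g j b - g i a) * cGamma (1 + g i a - g j b - h)).

Definition Delta (R : realType) (N : nat) (lam : N.-tuple nat)
    (I : 'I_N -> {set 'I_(psum lam N)}) (z : 'I_(psum lam N) -> R[i]) :
    coh_class R lam :=
  fun g =>
    (\prod_(i < N) \prod_(j < N | (i < j)%N)
       \prod_(a < part lam i) \prod_(b in I j) (g i a - z b))
    / (\prod_(i < N) \prod_(j < N | (i < j)%N)
         \prod_(a in I i) \prod_(b in I j) (z a - z b)).

(** The q-hypergeometric solutions *)

(* The parameters q_i enter through a tuple lq of values of their logarithms,
   with q_i = cexp (log q_i); thus functions of lq are functions on the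
   universal cover, and fixing branches amounts to restricting lq. *)
Definition qpar (R : realType) (N : nat) (lq : N.-tuple R[i]) (i : nat) : R[i] :=
  cexp lq`_i.

(* (exp(pi sqrt(-1) m) q)^x, where l = log q *)
Definition twpow (R : realType) (m : int) (l x : R[i]) : R[i] :=
  cexp (x * (pi%:C * 'i * m%:~R + l)).

Definition What_term (R : realType) (N : nat) (lam : N.-tuple nat) (h : R[i])
    (t : tfam R lam) : R[i] :=
  \prod_(1 <= j < N) \prod_(a < psum lam j)
    ((\prod_(c < psum lam j.+1 | (c < a)%N) (t j a - t j.+1 c - h))
     * (\prod_(d < psum lam j.+1 | (a < d)%N) (t j a - t j.+1 d))
     * (\prod_(b < psum lam j | (a < b)%N)
          ((t j a - t j b - h) / (t j a - t j b)))).

Definition What (R : realType) (N : nat) (lam : N.-tuple nat) (h : R[i])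
    (t : tfam R lam) : coh_class R lam :=
  fun g => Sym_t (What_term h) (set_level t (concat_roots g)).

Definition Qclass (R : realType) (N : nat) (lam : N.-tuple nat) (h : R[i]) :
    coh_class R lam :=
  fun g => \prod_(i < N) \prod_(j < N | (i < j)%N)
    \prod_(a < part lam i) \prod_(b < part lam j) (g i a - g j b - h).

Definition phi (R : realType) (h kappa x : R[i]) : R[i] :=
  cGamma (x / kappa) * cGamma ((h - x) / kappa).

(* The master function, for t^(N) = z. In the second line the level j runs over
   1, ..., N - 1, and the tuples are indexed from 0. *)
Definition Phi (R : realType) (N : nat) (lam : N.-tuple nat)
    (z : 'I_(psum lam N) -> R[i]) (h : R[i]) (lq : N.-tuple R[i])
    (kappa : R[i]) (t0 : tfam R lam) : R[i] :=
  let t := set_level t0 z in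
  twpow ((psum lam N)%:Z - (part lam N.-1)%:Z) lq`_N.-1 ((\sum_a z a) / kappa)
  * (\prod_(1 <= j < N)
       twpow ((part lam j)%:Z - (part lam j.-1)%:Z) (lq`_j.-1 - lq`_j)
             ((\sum_(a < psum lam j) t j a) / kappa))
  * (\prod_(1 <= j < N) \prod_(a < psum lam j)
       ((\prod_(b < psum lam j | b != a)
           ((t j a - t j b - h) * phi h kappa (t j a - t j b))^-1)
        * (\prod_(c < psum lam j.+1) phi h kappa (t j a - t j.+1 c)))).

(* The point Sigma_I + r kappa; the coordinates r^(j)_a of r are listed in the
   order of tvars. *)
Definition Sigma_shift (R : realType) (N : nat) (lam : N.-tuple nat)
    (I : 'I_N -> {set 'I_(psum lam N)}) (z : 'I_(psum lam N) -> R[i])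
    (kappa : R[i]) (r : (nvars lam).-tuple nat) : tfam R lam :=
  fun j a => nth 0 [seq z b | b <- enum (blocks_upto I j)] a
    + (nth 0%N r (\sum_(1 <= k < j) psum lam k + a))%:R * kappa.

Definition Omega_hat (R : realType) (N : nat) (lam : N.-tuple nat) (h : R[i])
    (lq : N.-tuple R[i]) (kappa : R[i]) : R[i] :=
  \prod_(i < N) \prod_(j < N | (i < j)%N)
    cpow (1 - qpar lq i / qpar lq j)
         (h * (Num.min 0 ((part lam j)%:Z - (part lam i)%:Z))%:~R / kappa).

Definition Psi_hat_formula (R : realType) (N : nat) (lam : N.-tuple nat)
    (I : 'I_N -> {set 'I_(psum lam N)}) (z : 'I_(psum lam N) -> R[i])
    (h : R[i]) (lq : N.-tuple R[i]) (kappa : R[i]) : coh_class R lam :=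
  fun g =>
    kappa ^- (nvars lam + 2 * fldim lam)
    * (-1) ^+ (nvars lam + fldim lam)
    * cGamma (- h / kappa) ^- nvars lam
    * Omega_hat lam h lq kappa
    * summability.sum (fun r : (nvars lam).-tuple nat =>
        iter_residue (Phi z h (map_tuple -%R lq) (- kappa))
                     (Sigma_shift I z kappa r)
        * Qclass h g
        * What h (Sigma_shift I z kappa r) g).

(* For h in kappa Z_(<0) the solution is the analytic continuation in h of the
   formula, that is, its limit at the removable singularity h. *)
Definition Psi_hat (R : realType) (N : nat) (lam : N.-tuple nat)
    (I : 'I_N -> {set 'I_(psum lam N)}) (z : 'I_(psum lam N) -> R[i])
    (h : R[i]) (lq : N.-tuple R[i]) (kappa : R[i]) : coh_class R lam :=
  fun g =>
    if `[< exists m : nat, h = - (kappa * m.+1%:R) >]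
    then lim ((fun h' => Psi_hat_formula I z h' lq kappa g) @ h^')
    else Psi_hat_formula I z h lq kappa g.

Definition zh_domain (R : realType) (n : nat) (kappa : R[i])
    (z : 'I_n -> R[i]) (h : R[i]) : Prop :=
  (forall m : nat, h != kappa * m%:R)
  /\ (forall a b, a != b -> forall m : int,
        (z a - z b != kappa * m%:~R) && (z a - z b + h != kappa * m%:~R)).

Definition q_domain (R : realType) (N : nat) (lq : N.-tuple R[i]) : Prop :=
  forall i : 'I_N.-1, `|qpar lq i / qpar lq i.+1| < 1.

(* prod_i q_i ^ (sum_(a in I_i) z_a / kappa) *)
Definition leading_factor (R : realType) (N : nat) (lam : N.-tuple nat)
    (I : 'I_N -> {set 'I_(psum lam N)}) (z : 'I_(psum lam N) -> R[i])
    (kappa : R[i]) (lq : N.-tuple R[i]) : R[i] :=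
  \prod_(i < N) cexp ((\sum_(a in I i) z a) / kappa * lq`_i).

(* F is leading_factor times the sum of an (unconditionally) convergent power
   series in q_1/q_2, ..., q_(N-1)/q_N, whose coefficients c are classes, and
   L is leading_factor times the constant term of this series. *)
Definition is_leading_term (R : realType) (N : nat) (lam : N.-tuple nat)
    (I : 'I_N -> {set 'I_(psum lam N)}) (z : 'I_(psum lam N) -> R[i])
    (kappa : R[i]) (F L : N.-tuple R[i] -> coh_class R lam) : Prop :=
  exists c : {ffun 'I_N.-1 -> nat} -> coh_class R lam,
  forall lq, q_domain lq ->
    (forall J, ordered_partition J -> forall g, at_fixed_point z J g ->
       exists2 s : R[i],
         summability.partial_sum (fun m : {ffun 'I_N.-1 -> nat} =>
           c m g * \prod_(i < N.-1) (qpar lq i / qpar lq i.+1) ^+ m i)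
           @ summability.totally --> s
         & F lq g = leading_factor I z kappa lq * s)
    /\ eq_class z (L lq)
         (fun g => leading_factor I z kappa lq * c [ffun=> 0%N] g).

(* prod_i (exp(pi sqrt(-1) (lambda_i - n)) q_i) ^ c_1(E_i) *)
Definition chern_exp (R : realType) (N : nat) (lam : N.-tuple nat)
    (lq : N.-tuple R[i]) : coh_class R lam :=
  fun g => \prod_(i < N)
    twpow ((part lam i)%:Z - (psum lam N)%:Z) lq`_i (c1 i g).

(* Main.v *)
Require Import Defs.
From mathcomp Require Import ring lra zify.

Local Open Scope classical_set_scope.
Local Open Scope ring_scope.
Local Open Scope complex_scope.

(** The solution attached to I is a sum over the shifts r of iterated residues
    of the master function. At the point Sigma_I + r, the variable t^(j)_a is
    singular with respect to exactly one variable of the next level, the one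
    based at the same z (its parent), and the parents form a forest ordered by
    the levels. Hence the iterated residue factors: it is the value of the
    regular part times one simple residue per variable ([iterated_residue],
    [residue_simple]), and each of these is Gamma(-h) times a signed binomial
    coefficient in h ([pole_num_value]). This is [iter_residue_Phi]; the powers
    of Gamma(-h) cancel the normalization, so that what remains makes sense for
    all h in the domain.

    Summation by parts over the levels turns the exponential factor at
    Sigma_I + r into the leading factor, times the constant part of the
    exponential of the Chern classes, times a monomial in the ratios
    q_j / q_(j+1) which is trivial only for r = 0 ([expoE], [deg_eq0]). The
    other factors grow polynomially in r, uniformly for h in a small disc
    ([gpair_growth], [good_summand]). The sum therefore converges absolutely
    ([qseries_abs]) and can be regrouped by monomials into a power series
    ([power_series_family]), and it is continuous in h ([reduced_solution_cont]),
    which gives the continuation to the negative integers ([Psi_hatE]). The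
    factor Omega is a product of binomial series with constant term 1
    ([power_series_binomial]).

    There remains the summand r = 0. At Sigma_I and at the Chern roots of the
    fixed point x_J, a term of the symmetrization defining W vanishes unless
    every level lists the first Chern roots in order ([What_term_neq0]). This is
    impossible for J <> I, and for J = I it leaves a single product
    ([What_other], [What_same]). The factors internal to a level cancel against
    the regular part of the master function, and the factors between different
    blocks combine, by the functional equation
    -u Gamma(-u) Gamma(u-h) (u-h) = Gamma(1-u) Gamma(1+u-h) for u = z_a - z_b,
    into the gamma class ([summand_zero]). *)

(** * Modulus, exponential and limits of complex functions *)

Section ComplexBasics.
Variable R : realType.
Local Notation C := R[i].
Implicit Types x y : C.

(** The modulus with real values, to which the order of [R] applies. *)
Definition cabs x : R := complex.Re `|x|.

Lemma cabsE x : `|x| = (cabs x)%:C.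
Proof. by rewrite /cabs normc_def. Qed.

Lemma cabs_ge0 x : 0 <= cabs x.
Proof. by rewrite -ler0c -cabsE normr_ge0. Qed.

Lemma cabsM x y : cabs (x * y) = cabs x * cabs y.
Proof. by apply: complexI; rewrite -cabsE normrM !cabsE rmorphM. Qed.

Lemma ler_cabsD x y : cabs (x + y) <= cabs x + cabs y.
Proof. by rewrite -lecR -cabsE rmorphD /= -!cabsE ler_normD. Qed.

Lemma cabsN x : cabs (- x) = cabs x.
Proof. by rewrite /cabs normrN. Qed.

Lemma cabsB x y : cabs (x - y) = cabs (y - x).
Proof. by rewrite /cabs distrC. Qed.

Lemma ler_cabsB x y : cabs (x - y) <= cabs x + cabs y.
Proof. by rewrite -(cabsN y) ler_cabsD. Qed.

Lemma lerB_cabs x y : cabs x - cabs y <= cabs (x - y).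
Proof. by rewrite lerBlDr -{1}[x](subrK y) ler_cabsD. Qed.

Lemma cabs0 : cabs 0 = 0.
Proof. by rewrite /cabs normr0. Qed.

Lemma cabs1 : cabs 1 = 1.
Proof. by rewrite /cabs normr1. Qed.

Lemma cabs_eq0 x : (cabs x == 0) = (x == 0).
Proof. by rewrite -(inj_eq (@complexI R)) -cabsE normr_eq0. Qed.

Lemma cabs_gt0 x : (0 < cabs x) = (x != 0).
Proof. by rewrite lt_def cabs_ge0 andbT cabs_eq0. Qed.

Lemma cabsV x : cabs x^-1 = (cabs x)^-1.
Proof. by apply: complexI; rewrite -cabsE normfV cabsE fmorphV. Qed.

Lemma cabsR (r : R) : cabs r%:C = `|r|.
Proof. by rewrite /cabs normc_def /= expr0n addr0 sqrtr_sqr. Qed.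

Lemma cabs_nat n : cabs n%:R = n%:R.
Proof. by rewrite -(rmorph_nat (real_complex R)) cabsR ger0_norm. Qed.

Lemma cabsX x n : cabs (x ^+ n) = cabs x ^+ n.
Proof. by elim: n => [|n IH]; rewrite ?expr0 ?cabs1 // !exprS cabsM IH. Qed.

Lemma cabs_prod (I : Type) (r : seq I) (P : pred I) (F : I -> C) :
  cabs (\prod_(i <- r | P i) F i) = \prod_(i <- r | P i) cabs (F i).
Proof. by apply: (big_morph cabs cabsM cabs1). Qed.

Lemma ler_cabs_sum (I : Type) (r : seq I) (P : pred I) (F : I -> C) :
  cabs (\sum_(i <- r | P i) F i) <= \sum_(i <- r | P i) cabs (F i).
Proof.
elim/big_rec2: _ => [|i y x _ h]; first by rewrite cabs0.
by apply: le_trans (ler_cabsD _ _) _; rewrite lerD2l.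
Qed.

Lemma Re_le_cabs x : `|complex.Re x| <= cabs x.
Proof. by rewrite -lecR -cabsE normc_ge_Re. Qed.

Lemma Im_le_cabs x : `|complex.Im x| <= cabs x.
Proof.
have -> : complex.Im x = complex.Re (- 'i * x) by case: x => a b /=; ring.
apply: le_trans (Re_le_cabs _) _.
by rewrite cabsM cabsN /cabs normc_def /= expr0n expr1n add0r sqrtr1 mul1r.
Qed.

Lemma cabs_le_ReIm x : cabs x <= `|complex.Re x| + `|complex.Im x|.
Proof.
rewrite [in leLHS](complexE x); apply: le_trans (ler_cabsD _ _) _.
rewrite cabsM !cabsR lerD2l.
by rewrite /cabs normc_def /= expr0n expr1n add0r sqrtr1 mul1r.
Qed.

Lemma cvgCP (T : Type) (F : set_system T) (FF : Filter F) (f : T -> C) (l : C) :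
  f @ F --> l <-> forall e : R, 0 < e -> \forall t \near F, cabs (f t - l) < e.
Proof.
split=> [/cvgrPdist_lt h e e0|h].
  have := h e%:C; rewrite ltcR => /(_ e0); apply: filterS => t.
  by rewrite distrC cabsE ltcR.
apply/cvgrPdist_lt => e e0.
have [r re] : exists r, e = r%:C by apply/complex_realP; exact: gtr0_real.
move: e0; rewrite re ltcR => r0.
by have := h r r0; apply: filterS => t; rewrite distrC cabsE ltcR.
Qed.

Lemma cvg_Re (T : Type) (F : set_system T) (FF : Filter F) (f : T -> C) (l : C) :
  f @ F --> l -> complex.Re (f t) @[t --> F] --> complex.Re l.
Proof.
move=> /cvgCP h; apply/cvgrPdist_lt => e /h; apply: filterS => t.
by apply: le_lt_trans; rewrite distrC -raddfB; exact: Re_le_cabs.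
Qed.

Lemma cvg_Im (T : Type) (F : set_system T) (FF : Filter F) (f : T -> C) (l : C) :
  f @ F --> l -> complex.Im (f t) @[t --> F] --> complex.Im l.
Proof.
move=> /cvgCP h; apply/cvgrPdist_lt => e /h; apply: filterS => t.
by apply: le_lt_trans; rewrite distrC -raddfB; exact: Im_le_cabs.
Qed.

Lemma cvg_complex (T : Type) (F : set_system T) (FF : Filter F)
    (f : T -> C) (l : C) :
  complex.Re (f t) @[t --> F] --> complex.Re l ->
  complex.Im (f t) @[t --> F] --> complex.Im l -> f @ F --> l.
Proof.
move=> /cvgrPdist_lt hr /cvgrPdist_lt hi; apply/cvgCP => e e0.
have e20 : 0 < e / 2 by rewrite divr_gt0.
apply: filterS2 (hr _ e20) (hi _ e20) => t h1 h2.
apply: le_lt_trans (cabs_le_ReIm _) _.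
rewrite !raddfB /= (distrC (complex.Re _)) (distrC (complex.Im _)).
by rewrite [e]splitr ltrD.
Qed.

Lemma cexpD x y : cexp (x + y) = cexp x * cexp y.
Proof.
case: x => a b; case: y => c d; rewrite /cexp /= expRD cosD sinD.
by apply/eqP; rewrite eq_complex /=; apply/andP; split; apply/eqP; ring.
Qed.

Lemma cexp0 : cexp 0 = 1 :> C.
Proof.
rewrite /cexp /= expR0 cos0 sin0.
by apply/eqP; rewrite eq_complex /=; apply/andP; split; apply/eqP; ring.
Qed.

Lemma cabs_cexp x : cabs (cexp x) = expR (complex.Re x).
Proof.
rewrite /cexp cabsM cabsR ger0_norm ?expR_ge0 // /cabs normc_def /=.
by rewrite cos2Dsin2 sqrtr1 mulr1.
Qed.

Lemma cexp_neq0 x : cexp x != 0.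
Proof. by rewrite -cabs_gt0 cabs_cexp expR_gt0. Qed.

Lemma cexpN x : cexp (- x) = (cexp x)^-1.
Proof.
by apply: (mulfI (cexp_neq0 x)); rewrite -cexpD subrr cexp0 mulfV ?cexp_neq0.
Qed.

Lemma cexpB x y : cexp (x - y) = cexp x / cexp y.
Proof. by rewrite cexpD cexpN. Qed.

Lemma cexp_sum (I : Type) (r : seq I) (P : pred I) (F : I -> C) :
  cexp (\sum_(i <- r | P i) F i) = \prod_(i <- r | P i) cexp (F i).
Proof. by apply: (big_morph (@cexp R) cexpD cexp0). Qed.

Lemma cexpMn x n : cexp (x *+ n) = cexp x ^+ n.
Proof. by elim: n => [|n IH]; rewrite ?mulr0n ?cexp0 // mulrS exprS cexpD IH. Qed.

Lemma continuous_cexp : continuous (@cexp R).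
Proof.
move=> x; rewrite /cexp.
have hr : complex.Re (t : C) @[t --> x] --> complex.Re x by exact: (@cvg_Re _ (nbhs x) _ id x (@cvg_id _ _)).
have hi : complex.Im (t : C) @[t --> x] --> complex.Im x by exact: (@cvg_Im _ (nbhs x) _ id x (@cvg_id _ _)).
have he : expR (complex.Re (t : C)) @[t --> x] --> expR (complex.Re x).
  by apply: continuous_cvg hr; exact: continuous_expR.
have hc : cos (complex.Im (t : C)) @[t --> x] --> cos (complex.Im x).
  by apply: continuous_cvg hi; exact: continuous_cos.
have hs : sin (complex.Im (t : C)) @[t --> x] --> sin (complex.Im x).
  by apply: continuous_cvg hi; exact: continuous_sin.
have Ere (t : C) : complex.Re (cexp t) = expR (complex.Re t) * cos (complex.Im t).
  by rewrite /= mul0r subr0.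
have Eim (t : C) : complex.Im (cexp t) = expR (complex.Re t) * sin (complex.Im t).
  by rewrite /= mul0r addr0.
apply: (@cvg_complex _ (nbhs x) _ (@cexp R) (cexp x)).
- by rewrite Ere (eq_cvg _ _ Ere); exact: cvgM he hc.
- by rewrite Eim (eq_cvg _ _ Eim); exact: cvgM he hs.
Qed.

End ComplexBasics.

Section CompleteComplex.
Variable R : realType.
Local Notation C := R[i].

(** The completeness of the real line, applied to both coordinates. The
    condition is the Cauchy condition in a form that names only the centres
    of the discs. *)
Lemma cauchyC_cvg (T : Type) (F : set_system T) (FF : ProperFilter F)
    (f : T -> C) :
  (forall e : R, 0 < e -> exists c, \forall t \near F, cabs (f t - c) < e) ->
  exists l : C, f @ F --> l.
Proof.
move=> h.
have hR : cvg (complex.Re (f t) @[t --> F]).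
  apply/cauchy_cvgP/cauchy_exP => e e0; have [c hc] := h e e0.
  exists (complex.Re c); rewrite /fmap; move: hc; apply: filterS => t.
  by rewrite /ball /=; apply: le_lt_trans; rewrite distrC -raddfB; exact: Re_le_cabs.
have hI : cvg (complex.Im (f t) @[t --> F]).
  apply/cauchy_cvgP/cauchy_exP => e e0; have [c hc] := h e e0.
  exists (complex.Im c); rewrite /fmap; move: hc; apply: filterS => t.
  by rewrite /ball /=; apply: le_lt_trans; rewrite distrC -raddfB; exact: Im_le_cabs.
exists (lim (complex.Re (f t) @[t --> F]) +i* lim (complex.Im (f t) @[t --> F])).
by apply: cvg_complex; [exact: hR | exact: hI].
Qed.

Lemma cvg_cabs_le (T : Type) (F : set_system T) (FF : ProperFilter F)
    (f : T -> C) (l c : C) (b : R) :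
  f @ F --> l -> (\forall t \near F, cabs (f t - c) <= b) -> cabs (l - c) <= b.
Proof.
move=> /cvgCP hl hb; apply/ler_addgt0Pr => e e0.
have [t [h1 h2]] : exists t, cabs (f t - l) < e /\ cabs (f t - c) <= b.
  by have [t [? ?]] := filter_ex (filterI (hl e e0) hb); exists t.
have -> : l - c = (f t - c) - (f t - l) by ring.
by apply: le_trans (ler_cabsB _ _) _; rewrite lerD // ltW.
Qed.

(** A sequence whose relative increments are bounded by those of a function
    staying below 1/2. *)
Lemma slow_seq (p : nat -> C) (s : nat -> R) (M : nat) :
  s M = 0 -> (forall m, (M <= m)%N -> s m <= 2^-1) ->
  (forall m, (M <= m)%N -> cabs (p m.+1 - p m) <= (s m.+1 - s m) * cabs (p m)) ->
  (forall m, (M <= m)%N -> s m <= s m.+1) ->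
  forall m, (M <= m)%N -> cabs (p m - p M) <= 2 * s m * cabs (p M).
Proof.
move=> s0 s2 hp si; elim=> [|m IH].
  by rewrite leqn0 => /eqP M0; rewrite -M0 s0 mulr0 mul0r subrr cabs0.
rewrite leq_eqVlt => /predU1P[<-|]; first by rewrite s0 mulr0 mul0r subrr cabs0.
rewrite ltnS => Mm; have {}IH := IH Mm.
have pm : cabs (p m) <= 2 * cabs (p M).
  have -> : p m = (p m - p M) + p M by ring.
  apply: le_trans (ler_cabsD _ _) _; have := s2 m Mm; have := cabs_ge0 (p M); nra.
have -> : p m.+1 - p M = (p m.+1 - p m) + (p m - p M) by ring.
apply: le_trans (ler_cabsD _ _) _.
have := hp m Mm; have := si m Mm; nra.
Qed.

End CompleteComplex.

Section CexpBounds.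
Variable R : realType.
Local Notation C := R[i].

Lemma ler_norm_sin (b : R) : `|sin b| <= `|b|.
Proof.
wlog b0 : b / 0 < b.
  move=> h; have [b0|b0|->] := ltgtP b 0; last by rewrite sin0.
    by have := h (- b); rewrite oppr_gt0 sinN !normrN => ->.
  exact: h.
have [c _] : exists2 c, c \in `]0, b[ & sin b - sin 0 = cos c * (b - 0).
  by apply: MVT => //; apply: continuous_subspaceT; exact: continuous_sin.
rewrite sin0 !subr0 => ->; rewrite normrM ler_piMl //.
by rewrite ler_norml cos_geN1 cos_le1.
Qed.

Lemma cos_lower (b : R) : 1 - cos b <= b ^+ 2 / 2.
Proof.
have -> : cos b = 1 - (sin (b / 2)) ^+ 2 *+ 2.
  have {1}-> : b = (b / 2) *+ 2 by rewrite -mulr_natr -mulrA mulVf ?mulr1.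
  by rewrite mulr2n cosD; have := cos2Dsin2 (b / 2); rewrite !expr2 mulr2n; lra.
have := ler_norm_sin (b / 2); rewrite -[X in X <= _]normr_id.
move=> /(fun h => lerXn2r 2 (normr_ge0 _) (normr_ge0 _) h).
rewrite normr_id !real_normK ?num_real // expr_div_n => h.
rewrite mulr2n; nra.
Qed.

Lemma sin_near (b : R) : `|b| <= 1 -> `|sin b - b| <= b ^+ 2.
Proof.
wlog b0 : b / 0 < b.
  move=> h; have [b0|b0|->] := ltgtP b 0; last by rewrite sin0 subr0 normr0 expr0n.
    move=> b1; have := h (- b); rewrite oppr_gt0 normrN sinN sqrrN => /(_ b0 b1).
    by rewrite -opprD normrN.
  exact: h.
rewrite gtr0_norm // => b1.
have [c cb] : exists2 c, c \in `]0, b[ & (sin b - b) - (sin 0 - 0) = (cos c - 1) * (b - 0).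
  apply: (@MVT _ (fun x => sin x - x)) => //.
  apply: continuous_subspaceT => x; apply: cvgB; [exact: continuous_sin|exact: cvg_id].
rewrite sin0 !subr0 => ->; move: cb; rewrite in_itv /= => /andP[c0 cb].
rewrite normrM (gtr0_norm b0) expr2 ler_pM2r //.
rewrite distrC ger0_norm ?subr_ge0 ?cos_le1 //.
apply: le_trans (cos_lower _) _; nra.
Qed.

Lemma expR_near (a : R) : `|a| <= 2^-1 -> `|expR a - 1 - a| <= 2 * a ^+ 2.
Proof.
rewrite ler_norml => /andP[a1 a2].
have h1 := expR_ge1Dx a.
have h2 := expR_ge1Dx (- a).
have h3 : expR a * expR (- a) = 1 by rewrite -expRD subrr expR0.
have h4 := expR_gt0 a.
rewrite ger0_norm; last by lra.
have h5 : expR a * (1 - a) <= 1 by rewrite -[leRHS]h3 ler_pM2l.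
have h6 : (1 + a + 2 * a^+2) * (1 - a) >= 1 by nra.
have : 0 <= ((1 + a + 2 * a^+2) - expR a) * (1 - a) by rewrite mulrBl; lra.
by rewrite pmulr_lge0; lra.
Qed.

(** The quadratic remainder of the exponential, from the mean value theorem
    for the coordinates. The constant 6 is not sharp. *)
Lemma cexp_near (u : C) : cabs u <= 2^-1 -> cabs (cexp u - 1 - u) <= 6 * cabs u ^+ 2.
Proof.
move=> hu.
have ha := le_trans (Re_le_cabs u) hu; have hb := le_trans (Im_le_cabs u) hu.
have ha' := Re_le_cabs u; have hb' := Im_le_cabs u.
set A := cabs u in hu ha' hb' *.
case: u @A hu ha hb ha' hb' => a b /= hu ha hb ha' hb'.
have A0 := cabs_ge0 (a +i* b).
set A := cabs (a +i* b) in hu ha' hb' A0 *.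
have b1 : `|b| <= 1 by lra.
have h1 := expR_near ha; have h2 := cos_lower b; have h3 := sin_near b1.
have h4 := ler_norm_sin b; have h5 := cos_le1 b; have h6 := expR_gt0 a.
apply: le_trans (cabs_le_ReIm _) _.
have -> : complex.Re (cexp (a +i* b) - 1 - a +i* b) = expR a * cos b - 1 - a.
  by rewrite !raddfB /= mul0r subr0.
have -> : complex.Im (cexp (a +i* b) - 1 - a +i* b) = expR a * sin b - b.
  by rewrite !raddfB /= mul0r addr0 subr0.
have sa : a ^+ 2 <= A ^+ 2.
  by rewrite -(real_normK (num_real a)) lerXn2r // nnegrE ?normr_ge0.
have sb : b ^+ 2 <= A ^+ 2.
  by rewrite -(real_normK (num_real b)) lerXn2r // nnegrE ?normr_ge0.
have ea : `|expR a - 1| <= 2 * `|a|.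
  have -> : expR a - 1 = (expR a - 1 - a) + a by ring.
  apply: le_trans (ler_normD _ _) _.
  apply: le_trans (lerD h1 (lexx _)) _.
  rewrite -(real_normK (num_real a)); have := normr_ge0 a; nra.
have ea2 : expR a <= 2.
  by move: ea; rewrite ler_norml => /andP[_]; lra.
have -> : expR a * cos b - 1 - a = (expR a - 1 - a) - expR a * (1 - cos b) by ring.
have -> : expR a * sin b - b = (expR a - 1) * sin b + (sin b - b) by ring.
have k1 : `|expR a - 1 - a - expR a * (1 - cos b)| <= 3 * A ^+ 2.
  apply: le_trans (ler_normB _ _) _.
  rewrite [X in _ + X]ger0_norm; last by rewrite mulr_ge0 ?expR_ge0 // subr_ge0.
  have : expR a * (1 - cos b) <= 2 * (b ^+ 2 / 2) by rewrite ler_pM ?expR_ge0 ?subr_ge0.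
  lra.
have k2 : `|(expR a - 1) * sin b + (sin b - b)| <= 3 * A ^+ 2.
  apply: le_trans (ler_normD _ _) _; rewrite normrM.
  have : `|expR a - 1| * `|sin b| <= (2 * A) * A.
    by rewrite ler_pM //; [apply: le_trans ea _; rewrite ler_pM2l|apply: le_trans h4 _].
  lra.
lra.
Qed.

End CexpBounds.

Section ContinuityAlgebra.
Variables (R : realType) (T : topologicalType).
Local Notation C := R[i].
Implicit Types (f g : T -> C) (x : T).

Lemma cont_cst (c : C) x : {for x, continuous (fun _ : T => c)}.
Proof. exact: cvg_cst. Qed.

Lemma contD f g x : {for x, continuous f} -> {for x, continuous g} ->
  {for x, continuous (fun y => f y + g y)}.
Proof. by move=> hf hg; exact: (cvgD hf hg). Qed.

Lemma contN f x : {for x, continuous f} -> {for x, continuous (fun y => - f y)}.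
Proof. by move=> hf; exact: (cvgN hf). Qed.

Lemma contB f g x : {for x, continuous f} -> {for x, continuous g} ->
  {for x, continuous (fun y => f y - g y)}.
Proof. by move=> hf hg; exact: (cvgB hf hg). Qed.

Lemma contM f g x : {for x, continuous f} -> {for x, continuous g} ->
  {for x, continuous (fun y => f y * g y)}.
Proof. by move=> hf hg; exact: (cvgM hf hg). Qed.

Lemma contV f x : f x != 0 -> {for x, continuous f} ->
  {for x, continuous (fun y => (f y)^-1)}.
Proof. by move=> f0 hf; exact: (cvgV f0 hf). Qed.

Lemma cont_comp (h : C -> C) f x : {for x, continuous f} ->
  {for f x, continuous h} -> {for x, continuous (fun y => h (f y))}.
Proof. by move=> hf hh; exact: (continuous_comp hf hh). Qed.

Lemma cont_eq f g x : f =1 g -> {for x, continuous f} -> {for x, continuous g}.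
Proof. by move=> /funext ->. Qed.

Lemma cont_prod (I : Type) (r : seq I) (P : pred I) (F : I -> T -> C) x :
  (forall i, P i -> {for x, continuous (F i)}) ->
  {for x, continuous (fun y => \prod_(i <- r | P i) F i y)}.
Proof.
move=> h; elim: r => [|i r IH].
  by apply: cont_eq (@cont_cst _ _) => y; rewrite big_nil.
case Pi: (P i).
  by apply: cont_eq (contM (h i Pi) IH) => y; rewrite big_cons Pi.
by apply: cont_eq IH => y; rewrite big_cons Pi.
Qed.

Lemma cont_sum (I : Type) (r : seq I) (P : pred I) (F : I -> T -> C) x :
  (forall i, P i -> {for x, continuous (F i)}) ->
  {for x, continuous (fun y => \sum_(i <- r | P i) F i y)}.
Proof.
move=> h; elim: r => [|i r IH].
  by apply: cont_eq (@cont_cst _ _) => y; rewrite big_nil.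
case Pi: (P i).
  by apply: cont_eq (contD (h i Pi) IH) => y; rewrite big_cons Pi.
by apply: cont_eq IH => y; rewrite big_cons Pi.
Qed.

Lemma cont_cexp f x : {for x, continuous f} ->
  {for x, continuous (fun y => cexp (f y))}.
Proof. by move=> hf; apply: cont_comp hf _; exact: continuous_cexp. Qed.

End ContinuityAlgebra.

Lemma cont_id (R : realType) (x : R[i]) : {for x, continuous (fun y : R[i] => y)}.
Proof. exact: cvg_id. Qed.

Section ContinuityC.
Variable R : realType.
Local Notation C := R[i].

Lemma continuousCP (f : C -> C) (x : C) :
  {for x, continuous f} <->
  forall e : R, 0 < e -> \forall y \near x, cabs (f y - f x) < e.
Proof. exact: (@cvgCP R _ (nbhs x) _ f (f x)). Qed.

Lemma near_cabs (x : C) (e : R) : 0 < e -> \forall y \near x, cabs (y - x) < e.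
Proof. exact: (@cvgCP R _ (nbhs x) _ id x).1 (@cvg_id _ _) e. Qed.

Lemma near_bounded (f : C -> C) (x : C) : {for x, continuous f} ->
  \forall y \near x, cabs (f y) <= cabs (f x) + 1.
Proof.
move=> /continuousCP/(_ 1 ltr01) h; near=> y.
have -> : f y = f x + (f y - f x) by ring.
apply: le_trans (ler_cabsD _ _) _; rewrite lerD2l; apply: ltW; near: y; exact: h.
Unshelve. all: by end_near.
Qed.

End ContinuityC.

Section Gamma.
Variable R : realType.
Local Notation C := R[i].
Implicit Types x y : C.

Definition gauss (m : nat) (x : C) : C :=
  (m`!)%:R * cexp (x * (ln (m%:R : R))%:C) / \prod_(k < m.+1) (x + k%:R).

Lemma gaussS m x : x + m.+1%:R != 0 ->
  gauss m.+1 x = gauss m x *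
    (m.+1%:R * cexp (x * (ln m.+1%:R - ln (m%:R : R))%:C) / (x + m.+1%:R)).
Proof.
move=> hx; rewrite /gauss big_ord_recr /= factS natrM.
have -> : x * (ln m.+1%:R)%:C =
    x * (ln (m%:R : R))%:C + x * (ln m.+1%:R - ln (m%:R : R))%:C.
  by rewrite -mulrDr -rmorphD /= addrC subrK.
rewrite cexpD invfM; ring.
Qed.

Definition gaussK (B : R) : R := 24 * B ^+ 2 + 2 * B.

(** The relative increment of Gauss' product is O(1/m^2), because (m+1)
    (exp(x log(1+1/m)) - 1) is x up to O(1/m); it is bounded by a
    telescoping sequence, as required by [slow_seq]. *)
Lemma gauss_step (B : R) (m : nat) x : 0 <= B -> cabs x <= B ->
  (0 < m)%N -> 2 * B + 1 <= m%:R ->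
  cabs (gauss m.+1 x - gauss m x) <=
    gaussK B * (m%:R^-1 - m.+1%:R^-1) * cabs (gauss m x).
Proof.
move=> B0 xB m0 Bm.
have m0R : 0 < m%:R :> R by rewrite ltr0n.
have m1R : 0 < m.+1%:R :> R by rewrite ltr0n.
have mS : m.+1%:R = m%:R + 1 :> R by rewrite -natr1.
have xm : m.+1%:R / 2 <= cabs (x + m.+1%:R).
  have -> : x + m.+1%:R = m.+1%:R - (- x) by rewrite opprK addrC.
  apply: le_trans (lerB_cabs _ _); rewrite cabs_nat cabsN; lra.
have xm0 : x + m.+1%:R != 0 by rewrite -cabs_gt0; apply: lt_le_trans xm; rewrite divr_gt0.
rewrite gaussS //; set d := ln m.+1%:R - ln m%:R.
have dE1 : d = ln (1 + m%:R^-1 : R).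
  by rewrite /d -lnV ?posrE // -lnM ?posrE ?invr_gt0 // mS mulrDl mulfV ?gt_eqF // mul1r.
have dE2 : - d = ln (1 + - m.+1%:R^-1 : R).
  rewrite /d opprB -lnV ?posrE // -lnM ?posrE ?invr_gt0 //.
  by congr ln; rewrite -{1}[m%:R](addrK 1) -mS mulrBl mulfV ?gt_eqF // mul1r.
have d1 : d <= m%:R^-1.
  by rewrite dE1 le_ln1Dx // (lt_trans (ltrN10 _)) // invr_gt0.
have d2 : m.+1%:R^-1 <= d.
  rewrite -lerN2 dE2 le_ln1Dx // ltrN2 invf_lt1 // mS; lra.
have im0 : 0 < m%:R^-1 :> R by rewrite invr_gt0.
have im1 : 0 < m.+1%:R^-1 :> R by rewrite invr_gt0.
have prec : m%:R^-1 - m.+1%:R^-1 = m%:R^-1 * m.+1%:R^-1 :> R.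
  by rewrite mS; field; rewrite -mS !gt_eqF.
have dge0 : 0 <= d by exact: le_trans (ltW im1) d2.
have xd : cabs (x * d%:C) = cabs x * d by rewrite cabsM cabsR ger0_norm.
have xd2 : cabs (x * d%:C) <= 2^-1.
  rewrite xd; apply: le_trans (ler_pM _ _ xB d1) _; rewrite ?cabs_ge0 //.
  by rewrite ler_pdivrMr //; lra.
have hc := cexp_near xd2; rewrite xd in hc.
have -> : gauss m x * (m.+1%:R * cexp (x * d%:C) / (x + m.+1%:R)) - gauss m x =
   gauss m x * ((m.+1%:R * (cexp (x * d%:C) - 1 - x * d%:C)
      + m.+1%:R * (x * (d - m.+1%:R^-1)%:C)) / (x + m.+1%:R)).
  have -> : (d - m.+1%:R^-1)%:C = d%:C - m.+1%:R^-1 :> C.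
    by rewrite rmorphB /= fmorphV rmorph_nat.
  have n0 : m.+1%:R != 0 :> C by rewrite pnatr_eq0.
  by move: xm0 n0; move: (m.+1%:R : C) => w xw w0; field; rewrite xw w0.
rewrite cabsM mulrC ler_wpM2r ?cabs_ge0 //.
rewrite cabsM cabsV ler_pdivrMr; last by rewrite cabs_gt0.
apply: le_trans (ler_cabsD _ _) _; rewrite !cabsM cabs_nat cabsR.
have dd : 0 <= d - m.+1%:R^-1 by rewrite subr_ge0.
rewrite (ger0_norm dd).
have K0 : 0 <= gaussK B by rewrite /gaussK; nra.
apply: (@le_trans _ _ (gaussK B * (m%:R^-1 - m.+1%:R^-1) * (m.+1%:R / 2))); last first.
  by rewrite ler_wpM2l // prec !mulr_ge0 // ltW.
rewrite prec /gaussK.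
have k1 : (cabs x * d) ^+ 2 <= B ^+ 2 * (m%:R^-1 * (2 * m.+1%:R^-1)).
  rewrite exprMn ler_pM ?sqr_ge0 //.
    by rewrite lerXn2r ?nnegrE ?cabs_ge0.
  rewrite expr2 ler_pM //; apply: le_trans d1 _.
  rewrite mS -ler_pdivrMl //.
  by rewrite -[leLHS]invfM lef_pV2 ?posrE; lra.
have k2 : cabs x * (d - m.+1%:R^-1) <= B * (m%:R^-1 * m.+1%:R^-1).
  rewrite ler_pM ?cabs_ge0 ?subr_ge0 // -prec lerD2r //.
move: hc k1 k2; set u := cabs _; set v := _ * (d - _).
rewrite [_ * (2 * _)]mulrCA; set p := m%:R^-1 * m.+1%:R^-1 => hc k1 k2.
have huv : u + v <= (24 * B ^+ 2 + 2 * B) * p / 2 by lra.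
rewrite -mulrDr mulrC; apply: le_trans (ler_wpM2r (ltW m1R) huv) _.
by rewrite le_eqVlt; apply/predU1P; left; ring.
Qed.

Lemma gauss_tail (B : R) (M : nat) x : 0 <= B -> cabs x <= B ->
  (0 < M)%N -> 2 * B + 1 <= M%:R -> 2 * gaussK B <= M%:R ->
  forall m, (M <= m)%N ->
    cabs (gauss m x - gauss M x) <= 2 * gaussK B / M%:R * cabs (gauss M x).
Proof.
move=> B0 xB M0 M1 M2 m Mm.
have K0 : 0 <= gaussK B by rewrite /gaussK; nra.
have M0R : 0 < M%:R :> R by rewrite ltr0n.
pose s (m : nat) : R := gaussK B * (M%:R^-1 - m%:R^-1).
have sM k : s k <= gaussK B / M%:R.
  by rewrite /s ler_wpM2l // gerBl invr_ge0 ler0n.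
apply: le_trans (@slow_seq R (gauss^~ x) s M _ _ _ _ m Mm) _.
- by rewrite /s subrr mulr0.
- move=> k _; apply: le_trans (sM k) _; rewrite ler_pdivrMr //; lra.
- move=> k Mk; apply: le_trans (gauss_step B0 xB _ _) _.
  + exact: leq_trans Mk.
  + by apply: le_trans M1 _; rewrite ler_nat.
  + by rewrite /s; rewrite le_eqVlt; apply/predU1P; left; ring.
- move=> k Mk; rewrite /s ler_wpM2l // lerD2l lerN2 lef_pV2 ?posrE ?ltr0n ?ler_nat //.
  exact: leq_trans M0 Mk.
by rewrite ler_wpM2r ?cabs_ge0 // -mulrA ler_wpM2l.
Qed.

(** An index after which the products stay relatively close to their limit.
    It depends only on a bound for the modulus of x, so the convergence is
    uniform on discs; nonvanishing and continuity of the gamma function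
    follow. *)
Lemma gauss_threshold (B : R) (e : R) : 0 < e -> exists M : nat,
  [/\ (0 < M)%N, 2 * B + 1 <= M%:R, 2 * gaussK B <= M%:R
    & 2 * gaussK B / M%:R <= e].
Proof.
move=> e0.
have [n hn] : exists n : nat, `|2 * B + 1| + `|2 * gaussK B| + `|2 * gaussK B / e| <= n%:R.
  by exists (Num.bound (`|2 * B + 1| + `|2 * gaussK B| + `|2 * gaussK B / e|)); apply/ltW/archi_boundP; rewrite !addr_ge0.
have l1 := ler_norm (2 * B + 1); have l2 := ler_norm (2 * gaussK B).
have l3 := ler_norm (2 * gaussK B / e).
have g1 := normr_ge0 (2 * B + 1); have g2 := normr_ge0 (2 * gaussK B).
have g3 := normr_ge0 (2 * gaussK B / e).
have nS : n.+1%:R = n%:R + 1 :> R by rewrite -natr1.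
exists n.+1; split=> //; rewrite ?nS; [lra|lra|].
rewrite ler_pdivrMr; last by rewrite -nS ltr0n.
by rewrite [leRHS]mulrC -ler_pdivrMr //; lra.
Qed.

Lemma gauss_bounded (B : R) (M : nat) x : 0 <= B -> cabs x <= B ->
  (0 < M)%N -> 2 * B + 1 <= M%:R -> 2 * gaussK B <= M%:R ->
  2 * gaussK B / M%:R <= 1 ->
  forall m, (M <= m)%N -> cabs (gauss m x) <= 2 * cabs (gauss M x).
Proof.
move=> B0 xB M0 M1 M2 M3 m Mm.
have h := gauss_tail B0 xB M0 M1 M2 Mm.
have -> : gauss m x = (gauss m x - gauss M x) + gauss M x by ring.
apply: le_trans (ler_cabsD _ _) _.
have : 2 * gaussK B / M%:R * cabs (gauss M x) <= cabs (gauss M x).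
  by rewrite ler_piMl ?cabs_ge0.
lra.
Qed.

Lemma cGamma_cvg x : gauss^~ x @ \oo --> cGamma x.
Proof.
have [l hl] : exists l : C, gauss^~ x @ \oo --> l.
  apply: cauchyC_cvg => e e0.
  pose B := cabs x.
  have [M0 [a1 a2 a3 a4]] := @gauss_threshold B 1 ltr01.
  pose b := 2 * cabs (gauss M0 x) + 1.
  have b0 : 0 < b by rewrite /b; have := cabs_ge0 (gauss M0 x); lra.
  have [M1 [c1 c2 c3 c4]] := @gauss_threshold B (e / (2 * b)) (divr_gt0 e0 (mulr_gt0 (ltr0Sn _ _) b0)).
  pose M := maxn M0 M1.
  exists (gauss M x).
  have hM : cabs (gauss M x) <= b.
    have := gauss_bounded (cabs_ge0 _) (lexx _) a1 a2 a3 a4 (leq_maxl M0 M1).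
    rewrite -/M /b => h; apply: le_trans h _; lra.
  have K0 : 0 <= gaussK B by rewrite /gaussK /B; have := cabs_ge0 x; nra.
  have M1M : (M1%:R : R) <= M%:R by rewrite ler_nat leq_maxr.
  near=> m.
  have := @gauss_tail B M x (cabs_ge0 _) (lexx _) _ _ _ m _.
  rewrite (leq_trans a1 (leq_maxl _ _)) (le_trans c2 M1M) (le_trans c3 M1M).
  have -> : (M <= m)%N by near: m; exists M.
  move=> /(_ isT isT isT isT) h; apply: le_lt_trans h _.
  apply: (@le_lt_trans _ _ (e / (2 * b) * b)); last first.
    by rewrite invfM mulrA mulfVK ?gt_eqF //; lra.
  rewrite ler_pM ?cabs_ge0 //; first by rewrite !mulr_ge0 ?invr_ge0.
  apply: le_trans c4; rewrite ler_wpM2l ?mulr_ge0 // lef_pV2 ?posrE ?ltr0n //.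
  by rewrite (leq_trans a1) // leq_maxl.
have -> : cGamma x = l by apply/cvg_lim.
exact: hl.
Unshelve. all: by end_near.
Qed.

Lemma cGamma_approx (B : R) (M : nat) x : 0 <= B -> cabs x <= B ->
  (0 < M)%N -> 2 * B + 1 <= M%:R -> 2 * gaussK B <= M%:R ->
  cabs (cGamma x - gauss M x) <= 2 * gaussK B / M%:R * cabs (gauss M x).
Proof.
move=> B0 xB M0 M1 M2; apply: cvg_cabs_le (@cGamma_cvg x) _.
by exists M => // m /= Mm; exact: gauss_tail.
Qed.

Definition nopole x := forall k : nat, x + k%:R != 0.

Lemma gauss_neq0 x m : nopole x -> gauss m x != 0.
Proof.
move=> hx; rewrite /gauss; apply: mulf_neq0.
  by apply: mulf_neq0; rewrite ?cexp_neq0 // pnatr_eq0 -lt0n fact_gt0.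
by rewrite invr_neq0 //; apply/prodf_neq0 => k _; exact: hx.
Qed.

(** The relative distance between the limit and a late, nonzero product is
    less than 1/2. *)
Lemma cGamma_neq0 x : nopole x -> cGamma x != 0.
Proof.
move=> hx; have e0 : 0 < 2^-1 :> R by rewrite invr_gt0.
have [M [h1 h2 h3 h4]] := gauss_threshold (cabs x) e0.
have := cGamma_approx (cabs_ge0 x) (lexx _) h1 h2 h3.
have [->|//] := eqVneq (cGamma x) 0.
have g0 : 0 < cabs (gauss M x) by rewrite cabs_gt0 gauss_neq0.
rewrite sub0r cabsN => h.
have : 2 * gaussK (cabs x) / M%:R * cabs (gauss M x) <= 2^-1 * cabs (gauss M x).
  by rewrite ler_wpM2r // ltW.
lra.
Qed.

Lemma cvg_inv_natD (c : C) : ((m%:R + c)^-1 : C) @[m --> \oo] --> (0 : C).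
Proof.
apply/cvgCP => e e0; near=> m.
rewrite subr0 cabsV -[e]invrK ltf_pV2 ?posrE ?invr_gt0 //; last first.
  rewrite cabs_gt0 -[c]opprK subr_eq0; apply/eqP => /(congr1 (@cabs R)).
  rewrite cabs_nat cabsN => h; have : m%:R > cabs c by near: m; exact: nbhs_infty_gtr.
  by rewrite h ltxx.
have : m%:R > cabs c + e^-1 by near: m; exact: nbhs_infty_gtr.
have := lerB_cabs m%:R (- c); rewrite opprK cabs_nat cabsN; lra.
Unshelve. all: by end_near.
Qed.

Lemma cvg_ratio_nat (c : C) : (m%:R / (m%:R + c) : C) @[m --> \oo] --> (1 : C).
Proof.
have h : (1 - c * (m%:R + c)^-1 : C) @[m --> \oo] --> (1 - c * 0 : C).
  by apply: cvgB; [exact: cvg_cst | apply: cvgMr; exact: cvg_inv_natD].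
rewrite mulr0 subr0 in h.
apply: cvg_trans h; apply: near_eq_cvg; near=> m.
have m0 : m%:R + c != 0.
  rewrite -[c]opprK subr_eq0; apply/eqP => /(congr1 (@cabs R)).
  rewrite cabs_nat cabsN => h; have : m%:R > cabs c by near: m; exact: nbhs_infty_gtr.
  by rewrite h ltxx.
by rewrite -{1}(mulfV m0) -mulrBl addrK.
Unshelve. all: by end_near.
Qed.

Lemma cGamma1 : cGamma 1 = 1 :> C.
Proof.
apply/cvg_lim => //; apply: cvg_trans (@cvg_ratio_nat 1); apply: near_eq_cvg.
exists 1%N => // m /= m1.
have m0 : 0 < m%:R :> R by rewrite ltr0n.
have -> : \prod_(k < m.+1) (1 + k%:R) = (m.+1)`!%:R :> C.
  elim: m {m1 m0} => [|m IH]; first by rewrite big_ord1 addr0.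
  by rewrite big_ord_recr /= IH nat1r -natrM mulnC -factS.
rewrite mul1r /cexp /= lnK ?posrE // cos0 sin0 complexr0 mulr1 rmorph_nat.
have f0 : m`!%:R != 0 :> C by rewrite pnatr_eq0 -lt0n fact_gt0.
rewrite factS natrM -natr1; have : m%:R + 1 != 0 :> C by rewrite natr1 pnatr_eq0.
by move: f0; move: (m`!%:R : C) (m%:R : C) => u v u0 v0; field; rewrite u0 v0.
Qed.

Lemma cGammaS x : nopole x -> cGamma (x + 1) = x * cGamma x.
Proof.
move=> hx; apply/cvg_lim => //.
have h : (x * (gauss m x * (m%:R / (m%:R + (x + 1)))) : C) @[m --> \oo] -->
    x * (cGamma x * 1).
  by apply: cvgMr; apply: cvgM; [exact: cGamma_cvg | exact: cvg_ratio_nat].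
rewrite mulr1 in h; apply: cvg_trans h; apply: near_eq_cvg.
exists 1%N => // m /= m1; rewrite /gauss.
have m0 : 0 < m%:R :> R by rewrite ltr0n.
have x0 : x != 0 by have := hx 0%N; rewrite addr0.
rewrite mulrDl mul1r cexpD.
have -> : cexp (ln (m%:R : R))%:C = m%:R :> C.
  by rewrite /cexp /= lnK ?posrE // cos0 sin0 complexr0 mulr1 rmorph_nat.
have -> : \prod_(k < m.+1) (x + 1 + k%:R) =
    \prod_(k < m.+1) (x + k%:R) * (m%:R + (x + 1)) / x.
  rewrite [in RHS]big_ord_recl big_ord_recr /= addr0.
  under eq_bigr do rewrite -addrA nat1r.
  have -> : \prod_(i < m) (x + (bump 0 i)%:R) = \prod_(i < m) (x + i.+1%:R).
    by apply: eq_bigr.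
  by move: (\prod_(i < m) _) => p; field.
rewrite !invfM invrK; ring.
Qed.

(** Locally uniform convergence of continuous functions. *)
Lemma continuous_cGamma x : nopole x -> {for x, continuous (@cGamma R)}.
Proof.
move=> hx; pose B := cabs x + 1.
have B0 : 0 <= B by rewrite /B addr_ge0 ?cabs_ge0.
have nB : \forall y \near x, cabs y <= B by exact: (@near_bounded R id x (@cvg_id _ _)).
have gc m : {for x, continuous (@gauss m)}.
  rewrite /gauss; apply: contM; first apply: contM.
  - exact: cont_cst.
  - by apply: cont_cexp; apply: contM; [exact: cont_id | exact: cont_cst].
  apply: contV; first by apply/prodf_neq0 => k _; exact: hx.
  by apply: cont_prod => k _; apply: contD; [exact: cont_id | exact: cont_cst].
have [M0 [a1 a2 a3 a4]] := @gauss_threshold B 1 ltr01.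
pose b := 2 * (cabs (gauss M0 x) + 1).
have b0 : 0 < b by rewrite /b mulr_gt0 // ltr_wpDl ?cabs_ge0.
have nM0 := near_bounded (gc M0).
apply/continuousCP => e e0.
have e4 : 0 < e / (4 * b) by rewrite divr_gt0 // mulr_gt0.
have [M1 [c1 c2 c3 c4]] := @gauss_threshold B (e / (4 * b)) e4.
pose M := maxn M0 M1.
have K0 : 0 <= gaussK B by rewrite /gaussK; nra.
have key y : cabs y <= B -> cabs (gauss M0 y) <= cabs (gauss M0 x) + 1 ->
    cabs (cGamma y - gauss M y) <= e / 4.
  move=> yB yM; apply: le_trans (cGamma_approx B0 yB _ _ _) _.
  - by rewrite (leq_trans a1) // leq_maxl.
  - by apply: (le_trans a2); rewrite ler_nat leq_maxl.
  - by apply: (le_trans a3); rewrite ler_nat leq_maxl.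
  have -> : e / 4 = e / (4 * b) * b by field; rewrite gt_eqF.
  rewrite ler_pM ?cabs_ge0 //; first by rewrite !mulr_ge0 ?invr_ge0.
    apply: le_trans c4; rewrite ler_wpM2l ?mulr_ge0 // lef_pV2 ?posrE ?ltr0n ?ler_nat ?leq_maxr //.
    by rewrite (leq_trans a1) // leq_maxl.
  apply: le_trans (gauss_bounded B0 yB a1 a2 a3 a4 (leq_maxl _ _)) _.
  by rewrite /b ler_wpM2l.
have e2 : 0 < e / 2 by rewrite divr_gt0.
have kx := key x (nbhs_singleton nB) (nbhs_singleton nM0).
have nM := (continuousCP _ _).1 (gc M) _ e2.
near=> y.
have -> : cGamma y - cGamma x = (cGamma y - gauss M y)
   + ((gauss M y - gauss M x) - (cGamma x - gauss M x)) by ring.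
apply: le_lt_trans (ler_cabsD _ _) _.
have h1 := ler_cabsB (gauss M y - gauss M x) (cGamma x - gauss M x).
have h2 : cabs (cGamma y - gauss M y) <= e / 4 by apply: key; near: y.
have h3 : cabs (gauss M y - gauss M x) < e / 2 by near: y.
lra.
Unshelve. all: by end_near.
Qed.

End Gamma.

(** * Residues at simple poles and iterated residues *)

Section Residue.
Variable R : realType.
Local Notation C := R[i].
Implicit Types (f g : C -> C) (s x : C).

Lemma imE : 'i%R = 0 +i* 1 :> C. Proof. by rewrite -complexiE. Qed.

Lemma cabs_i : cabs 'i%R = 1 :> R.
Proof. by rewrite imE /cabs normc_def /= expr0n expr1n add0r sqrtr1. Qed.

Lemma cabs_circle (r th : R) : 0 <= r -> cabs (r%:C * cexp ('i%R * th%:C)) = r.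
Proof.
move=> r0; rewrite cabsM cabsR cabs_cexp imE /= mul0r mulr0 subr0 expR0 mulr1.
by rewrite ger0_norm.
Qed.

Lemma nearC_ball (P : C -> Prop) s : (\forall x \near s, P x) ->
  exists2 d : R, 0 < d & forall x, cabs (x - s) < d -> P x.
Proof.
move=> /nbhs_ballP[e /= e0 h].
have [r re] : exists r : R, e = r%:C by apply/complex_realP; exact: gtr0_real.
move: e0; rewrite re ltcR => r0; exists r => // x xs.
by apply: h; rewrite re /ball /= distrC cabsE ltcR.
Qed.

Lemma ball_nearC (P : C -> Prop) s (d : R) : 0 < d ->
  (forall x, cabs (x - s) < d -> P x) -> \forall x \near s, P x.
Proof.
by move=> d0 h; near=> x; apply: h; near: x; exact: near_cabs.
Unshelve. all: by end_near.
Qed.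

Lemma continuous_realC (t : R) : {for t, continuous (fun u : R => u%:C : C)}.
Proof.
apply: (@cvg_complex _ _ (nbhs t) _ (fun u : R => u%:C)); first exact: cvg_id.
exact: cvg_cst.
Qed.

(** An integrand that is uniformly close to a constant has an integral close
    to that of the constant; this replaces a limit under the integral sign. *)
Lemma Rintegral_approx (F : R -> R) (b c e : R) : 0 <= b ->
  (forall t : R, {for t, continuous F}) ->
  (forall t, `|F t - c| <= e) ->
  `|\int[lebesgue_measure]_(t in `[0, b]) F t - c * b| <= e * b.
Proof.
move=> b0 cF hF.
have mF : lebesgue_measure.-integrable `[0, b]%classic (EFin \o F).
  apply: continuous_compact_integrable; first exact: segment_compact.
  by apply: continuous_subspaceT => t; exact: cF.
have mc (k : R) : lebesgue_measure.-integrable `[0, b]%classic (EFin \o (fun=> k)).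
  apply: continuous_compact_integrable; first exact: segment_compact.
  by apply: continuous_subspaceT => t; exact: cvg_cst.
have ic (k : R) : \int[lebesgue_measure]_(t in `[0, b]) k = k * b.
  by rewrite Rintegral_cst //= lebesgue_measure_itv /= lte_fin; case: ltgtP b0 => //= [b0|<-] _; rewrite ?oppr0 ?addr0 ?mulr0 ?subr0.
rewrite ler_norml; apply/andP; split.
- rewrite lerBrDr -mulNr -mulrDl -ic; apply: le_Rintegral => // t _.
  by have := hF t; rewrite ler_norml => /andP[]; lra.
- rewrite lerBlDr -mulrDl -ic; apply: le_Rintegral => // t _.
  by have := hF t; rewrite ler_norml => /andP[]; lra.
Qed.

(** At a simple pole only the continuity of the numerator matters, since the
    residue is defined by the limit over small circles. *)
Lemma residue_simple f g s :
  (\forall x \near s, x != s -> f x = g x / (x - s)) ->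
  (\forall x \near s, {for x, continuous g}) ->
  residue f s = g s.
Proof.
move=> /nearC_ball[d1 d10 h1] /nearC_ball[d2 d20 h2].
apply/cvg_lim => //; apply/cvgCP => e e0.
have gs : {for s, continuous g} by apply: h2; rewrite subrr cabs0.
have e8 : 0 < e / 8 by rewrite divr_gt0.
have [d3 d30 h3] := nearC_ball ((continuousCP _ _).1 gs _ e8).
have pi0 := pi_gt0 R.
near=> r.
have r0 : 0 < r by [].
have rd1 : r < d1 by near: r; exact: nbhs_right_lt.
have rd2 : r < d2 by near: r; exact: nbhs_right_lt.
have rd3 : r < d3 by near: r; exact: nbhs_right_lt.
pose w (t : R) : C := r%:C * cexp ('i%R * t%:C).
have wr t : cabs (w t) = r by rewrite /w cabs_circle // ltW.
have w0 t : w t != 0 by rewrite -cabs_gt0 wr.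
have wE t : f (s + w t) * ('i%R * w t) = g (s + w t) * 'i%R.
  rewrite h1; last by rewrite -subr_eq0 addrAC subrr add0r.
    by rewrite addrAC subrr add0r mulrCA mulrVK ?unitfE // mulrC.
  by rewrite addrAC subrr add0r wr.
have cw (t : R) : {for t, continuous (fun t => g (s + w t) * 'i%R)}.
  apply: contM; last exact: cont_cst.
  apply: cont_comp; last first.
    by apply: h2; rewrite addrAC subrr add0r wr.
  apply: contD; first exact: cont_cst.
  apply: contM; first exact: cont_cst.
  apply: cont_cexp; apply: contM; first exact: cont_cst.
  exact: continuous_realC.
have gw t : cabs (g (s + w t) * 'i%R - g s * 'i%R) <= e / 8.
  rewrite -mulrBl cabsM cabs_i mulr1; apply/ltW/h3.
  by rewrite addrAC subrr add0r wr.
have ->: circle_integral f s r =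
   (\int[lebesgue_measure]_(t in `[0, (2 * pi)]) complex.Re (g (s + w t) * 'i%R))
   +i* (\int[lebesgue_measure]_(t in `[0, (2 * pi)]) complex.Im (g (s + w t) * 'i%R)).
  rewrite /circle_integral; congr (_ +i* _).
    by congr (Rintegral _ _ _); apply/funext => t; rewrite -/(w t) wE.
  by congr (Rintegral _ _ _); apply/funext => t; rewrite -/(w t) wE.
have pi2 : 0 <= 2 * pi :> R by rewrite mulr_ge0 // ltW.
have iR : `|\int[lebesgue_measure]_(t in `[0, (2 * pi)])
    complex.Re (g (s + w t) * 'i%R) - complex.Re (g s * 'i%R) * (2 * pi)|
    <= e / 8 * (2 * pi).
  apply: Rintegral_approx => // t; first exact: (cvg_Re _ (cw t)).
  by apply: le_trans (gw t); rewrite -raddfB; exact: Re_le_cabs.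
have iI : `|\int[lebesgue_measure]_(t in `[0, (2 * pi)])
    complex.Im (g (s + w t) * 'i%R) - complex.Im (g s * 'i%R) * (2 * pi)|
    <= e / 8 * (2 * pi).
  apply: Rintegral_approx => // t; first exact: (cvg_Im _ (cw t)).
  by apply: le_trans (gw t); rewrite -raddfB; exact: Im_le_cabs.
set J := (_ +i* _).
have c0 : 2 * 'i%R * pi%:C != 0 :> C.
  apply: mulf_neq0; first by rewrite mulf_neq0 ?pnatr_eq0 // -cabs_gt0 cabs_i.
  by rewrite -cabs_gt0 cabsR normr_gt0 gt_eqF.
have -> : (2 * 'i%R * pi%:C)^-1 * J - g s =
    (2 * 'i%R * pi%:C)^-1 * (J - g s * 'i%R * (2 * pi)%:C).
  rewrite mulrBr; congr (_ - _).
  rewrite rmorphM /= rmorph_nat; apply: (mulfI c0); rewrite [RHS]mulrA mulfV // mul1r; ring.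
rewrite cabsM cabsV !cabsM cabs_i cabs_nat cabsR (gtr0_norm pi0) mulr1.
rewrite mulrC ltr_pdivrMr; last by rewrite mulr_gt0.
apply: le_lt_trans (cabs_le_ReIm _) _; rewrite !raddfB /=.
have -> : complex.Re (g s * 'i%R * (2 * pi)%:C) = complex.Re (g s * 'i%R) * (2 * pi).
  by case: (g s * 'i%R) => a b /=; rewrite mulr0 subr0.
have -> : complex.Im (g s * 'i%R * (2 * pi)%:C) = complex.Im (g s * 'i%R) * (2 * pi).
  by case: (g s * 'i%R) => a b /=; rewrite mulr0 add0r.
apply: le_lt_trans (lerD iR iI) _.
rewrite -mulrDl ltr_pM2r ?mulr_gt0 //; lra.
Unshelve. all: by end_near.
Qed.

End Residue.

Section IteratedResidue.
Variables (R : realType) (N : nat) (lam : N.-tuple nat).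
Local Notation C := R[i].
Local Notation V := {j : nat & 'I_(psum lam j)}.
Implicit Types (t s : tfam R lam) (v u : V).

Definition tget t v : C := t (tag v) (tagged v).

Lemma tfam_ext t t' : (forall v, tget t v = tget t' v) -> t = t'.
Proof.
by move=> h; apply: functional_extensionality_dep => j; apply/funext => a;
  exact: (h (Tagged _ a)).
Qed.

Lemma tget_set_var t v x u :
  tget (set_var t (tagged v) x) u = if u == v then x else tget t u.
Proof.
case: v u => [j a] [k b]; rewrite /tget /set_var /set_level /=.
have [jk|jk] := eqVneq k j.
  by subst k; rewrite dfwithin; congr (if _ then _ else _); rewrite -tag_eqE /tag_eq eqxx tagged_asE.
rewrite dfwithout 1?eq_sym //; case: eqP => // /(congr1 tag) /= /eqP.
by rewrite eq_sym (negPf jk).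
Qed.

Definition freeze s (vs : seq V) t : tfam R lam :=
  fun j a => if Tagged (fun j => 'I_(psum lam j)) a \in vs then s j a else t j a.

Lemma tget_freeze s vs t v :
  tget (freeze s vs t) v = if v \in vs then tget s v else tget t v.
Proof. by case: v. Qed.

Variables (f G : tfam R lam -> C) (s : tfam R lam) (vs : seq V) (par : V -> V).
Variables (ph : C -> C) (chi : V -> C -> C) (d : R).
Hypothesis vs_uniq : uniq vs.
Hypothesis d_gt0 : 0 < d.
Local Notation kap v := (tget s v - tget s (par v)).

(** Iterating residues only moves the variables of vs. *)
Definition fixed_off t := forall v, v \notin vs -> tget t v = tget s v.

Hypothesis par_later : forall v pre post, vs = pre ++ v :: post ->
  par v \notin pre /\ par v != v.
Hypothesis fE : forall t, fixed_off t ->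
  (forall v, v \in vs -> 0 < cabs (tget t v - tget s v) < d) ->
  f t = G t * \prod_(v <- vs) ph (tget t v - tget t (par v)).
Hypothesis G_cont : forall t v, v \in vs -> fixed_off t ->
  (forall u, u \in vs -> cabs (tget t u - tget s u) < d) ->
  {for tget t v, continuous (fun x => G (set_var t (tagged v) x))}.
Hypothesis ph_cont : forall v y, v \in vs -> 0 < cabs (y - kap v) < d ->
  {for y, continuous ph}.
Hypothesis chi_cont : forall v y, v \in vs -> cabs (y - kap v) < d ->
  {for y, continuous (chi v)}.
Hypothesis chiE : forall v y, v \in vs -> 0 < cabs (y - kap v) < d ->
  ph y = chi v y / (y - kap v).

Let F (post : seq V) := foldr (fun v F t =>
   residue (fun x => F (set_var t (tagged v) x)) (tget s v)) f post.

(** After the residues in the last variables, post, have been taken, the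
    remaining function has the factors of the variables in pre with their
    parents frozen at s. A variable of pre whose parent is v gives a factor
    that is regular at v = s v, because that variable is kept at a positive
    distance from s; thus the only singular factor at the next step is the
    one between v and its own parent. *)
Let partial_residue pre post t : vs = pre ++ post -> fixed_off t ->
  (forall v, v \in pre -> 0 < cabs (tget t v - tget s v) < d) ->
  F post t = G (freeze s post t) * \prod_(v <- post) chi v (kap v)
    * \prod_(v <- pre) ph (tget t v - tget (freeze s post t) (par v)).
Proof.
elim: post pre t => [|v post IH] pre t vsE toff tpre.
  rewrite cats0 in vsE; have -> : freeze s [::] t = t.
    by apply: tfam_ext => u; rewrite tget_freeze.
  by rewrite big_nil mulr1 /= -vsE fE //; rewrite vsE.
rewrite /=.
have vvs : v \in vs by rewrite vsE mem_cat inE eqxx orbT.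
have sub u : u \in pre -> u \in vs by rewrite vsE mem_cat => ->.
have [vpre vpost] : v \notin pre /\ v \notin post.
  move: vs_uniq; rewrite vsE cat_uniq /= => /and3P[_ h /andP[-> _]]; split=> //.
  by apply: contra h => vp; apply/orP; left.
have [parv1 parv2] := par_later vsE.
pose T x := freeze s post (set_var t (tagged v) x).
have TE x u : tget (T x) u = if u == v then x else tget (freeze s (v :: post) t) u.
  rewrite /T !tget_freeze tget_set_var inE; case: eqP => [->|_] /=.
    by rewrite (negPf vpost).
  by [].
have Tv x : tget (T x) v = x by rewrite TE eqxx.
have Tpar x : tget (T x) (par v) = tget s (par v).
  rewrite TE (negPf parv2) tget_freeze; case: ifP => // /negbT h.
  apply: toff; rewrite vsE mem_cat negb_or parv1 /=.
  by move: h; rewrite inE.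
have Toff x : fixed_off (T x).
  move=> u unvs; rewrite TE; case: eqP => [uv|_]; first by rewrite uv vvs in unvs.
  by rewrite tget_freeze; case: ifP => // _; exact: toff.
have Ts : T (tget s v) = freeze s (v :: post) t.
  by apply: tfam_ext => u; rewrite TE !tget_freeze inE; case: eqP => [->|].
pose g x := G (T x) * \prod_(u <- post) chi u (kap u)
   * (\prod_(u <- pre) ph (tget t u - tget (T x) (par u)))
   * chi v (x - tget s (par v)).
rewrite (@residue_simple _ _ g (tget s v)).
- rewrite /g Ts big_cons; ring.
- apply: ball_nearC d_gt0 _ => x xs xv.
  rewrite (IH (rcons pre v)); last 3 first.
  + by rewrite cat_rcons.
  + move=> u unvs; rewrite tget_set_var; case: eqP => [uv|_]; last exact: toff.
    by rewrite uv vvs in unvs.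
  + move=> u; rewrite mem_rcons inE tget_set_var; case: eqP => [-> _|_ /= up].
      by rewrite xs cabs_gt0 subr_eq0 xv.
    exact: tpre.
  rewrite -/(T x) big_rcons /= tget_set_var eqxx Tpar.
  have kk : x - tget s (par v) - kap v = x - tget s v by ring.
  rewrite (chiE vvs); last by rewrite kk xs cabs_gt0 subr_eq0 xv.
  rewrite kk /g.
  have -> : \prod_(i <- pre) ph (tget (set_var t (tagged v) x) i - tget (T x) (par i)) =
     \prod_(u <- pre) ph (tget t u - tget (T x) (par u)).
    apply: eq_big_seq => u up; rewrite tget_set_var; case: eqP => // uv.
    by rewrite -uv up in vpre.
  rewrite !mulrA; congr (_ * _); ring.
- (* continuity of the numerator *)
  have pre_ok : \forall x \near tget s v, forall u, u \in pre -> par u = v ->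
      0 < cabs (tget t u - x - kap u) < d.
    have : forall l : seq V, {subset l <= pre} -> \forall x \near tget s v,
        forall u, u \in l -> par u = v -> 0 < cabs (tget t u - x - kap u) < d.
      elim=> [_|u l IHl sl]; first by near=> x.
      have {}IHl := IHl (fun w wl => sl w (mem_behead (s := u :: l) wl)).
      have up : u \in pre by apply: sl; rewrite mem_head.
      have /andP[a1 a2] := tpre u up.
      pose m := Num.min (cabs (tget t u - tget s u)) (d - cabs (tget t u - tget s u)).
      have m0 : 0 < m by rewrite /m lt_min a1 subr_gt0.
      near=> x => w; rewrite inE => /predU1P[->|wl] pv; last first.
        by move: w wl pv; near: x.
      rewrite pv.
      have -> : tget t u - x - (tget s u - tget s v) =
          (tget t u - tget s u) - (x - tget s v) by ring.
      have : cabs (x - tget s v) < m by near: x; exact: near_cabs.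
      rewrite /m lt_min => /andP[b1 b2]; apply/andP; split.
        by apply: lt_le_trans (lerB_cabs _ _); rewrite subr_gt0.
      by apply: le_lt_trans (ler_cabsB _ _) _; lra.
    by apply.
  near=> x.
  have xd : cabs (x - tget s v) < d by near: x; exact: near_cabs.
  rewrite /g; apply: contM; first apply: contM; first apply: contM.
  + have := @G_cont (T x) v vvs (Toff x).
    rewrite Tv; have -> : (fun y => G (set_var (T x) (tagged v) y)) = (fun y => G (T y)).
      apply/funext => y; congr G; apply: tfam_ext => u.
      by rewrite tget_set_var !TE; case: eqP.
    apply=> u uvs; rewrite TE; case: eqP => [->//|uv].
    rewrite tget_freeze inE; case: ifP => [_|/negbT h]; first by rewrite subrr cabs0.
    have up : u \in pre.
      by move: uvs; rewrite vsE mem_cat inE => /orP[//|h']; rewrite h' in h.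
    by have /andP[] := tpre u up.
  + exact: cont_cst.
  + rewrite (_ : (fun _ => _) = fun y => \prod_(u <- pre | u \in pre) ph (tget t u - tget (T y) (par u))); last first.
      by apply/funext => y; rewrite big_seq.
    apply: cont_prod => u up.
    have [puv|puv] := eqVneq (par u) v.
      apply: cont_comp.
        apply: contB; first exact: cont_cst.
        apply: cont_eq (@cont_id _ x) => y; by rewrite puv Tv.
      apply: (ph_cont (sub _ up)); have -> : tget (T x) (par u) = x by rewrite puv Tv.
      by move: u up puv; near: x.
    apply: cont_eq (@cont_cst _ _ (ph (tget t u - tget (T x) (par u))) x) => y.
    by rewrite !TE (negPf puv).
  + apply: cont_comp.
      by apply: contB; [exact: cont_id | exact: cont_cst].
    apply: chi_cont => //.
    by have -> : x - tget s (par v) - kap v = x - tget s v by ring.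
Unshelve. all: by end_near.
Qed.

(** For a product over a forest of functions of the differences between a
    variable and its parent, the iterated residue is the product of the
    one-variable residues. The function chi is the numerator of ph at its
    simple pole. *)
Lemma iterated_residue :
  foldr (fun v F t =>
   residue (fun x => F (set_var t (tagged v) x)) (tget s v)) f vs s
  = G s * \prod_(v <- vs) chi v (kap v).
Proof.
rewrite -/(F vs) (@partial_residue [::] vs s) //.
by rewrite big_nil mulr1; congr (G _ * _); apply: tfam_ext => u; rewrite tget_freeze if_same.
Qed.

End IteratedResidue.

(** * Unconditional summation *)

Lemma subr_cancell (G : zmodType) (x a b : G) : (x + a) - (x + b) = a - b.
Proof. by rewrite opprD addrACA subrr add0r. Qed.

#[local] Existing Instance summability.totally_filter.

Section Summation.
Variable R : realType.
Local Notation C := R[i].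

(** The limit over finite sets, spelled out with duplicate-free lists. *)
Definition has_sum (K : choiceType) (a : K -> C) (s : C) :=
  forall e : R, 0 < e -> exists l0 : seq K, forall l, uniq l ->
    {subset l0 <= l} -> cabs (\sum_(k <- l) a k - s) < e.

Definition abs_sum (K : choiceType) (a : K -> R) (B : R) :=
  forall l : seq K, uniq l -> \sum_(k <- l) a k <= B.

Lemma partial_sumE (K : choiceType) (a : K -> C) (A : {fset K}) :
  summability.partial_sum a A = \sum_(k <- A) a k.
Proof. by rewrite /summability.partial_sum big_seq_fsetE. Qed.

Lemma has_sumP (K : choiceType) (a : K -> C) (s : C) :
  has_sum a s <-> summability.partial_sum a @ summability.totally --> s.
Proof.
rewrite cvgCP; split=> h e e0.
  have [l0 hl0] := h e e0; exists [fset k in l0]%fset => // A /= lA.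
  rewrite partial_sumE; apply: hl0; first exact: fset_uniq.
  by move=> k kl; apply: (fsubsetP lA); rewrite inE.
have [A _ hA] := h e e0; exists (A : seq K) => l ul Al.
have := hA [fset k in l]%fset; rewrite /= partial_sumE.
have -> : \sum_(k <- [fset k in l]%fset) a k = \sum_(k <- l) a k.
  apply: perm_big; apply: uniq_perm => //.
  by move=> k; rewrite inE.
by apply; apply/fsubsetP => k kA; rewrite inE; exact: Al.
Qed.

Lemma has_sum_unique (K : choiceType) (a : K -> C) (s t : C) :
  has_sum a s -> has_sum a t -> s = t.
Proof.
move=> /has_sumP hs /has_sumP ht.
by rewrite -(cvg_lim (@norm_hausdorff _ _) hs) -(cvg_lim (@norm_hausdorff _ _) ht).
Qed.

Lemma has_sum_sum (K : choiceType) (a : K -> C) (s : C) :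
  has_sum a s -> summability.sum a = s.
Proof. by move=> /has_sumP hs; apply/cvg_lim. Qed.

Lemma eq_has_sum (K : choiceType) (a b : K -> C) (s : C) :
  a =1 b -> has_sum a s -> has_sum b s.
Proof. by move=> /funext ->. Qed.

Lemma has_sumZ (K : choiceType) (k : C) (a : K -> C) (s : C) :
  has_sum a s -> has_sum (fun i => k * a i) (k * s).
Proof.
move=> h e e0.
have e1 : 0 < e / (cabs k + 1) by rewrite divr_gt0 // ltr_wpDl ?cabs_ge0.
have [l0 hl] := h _ e1; exists l0 => l ul /(hl l ul).
rewrite -mulr_sumr -mulrBr cabsM ltr_pdivlMr; last by rewrite ltr_wpDl ?cabs_ge0.
apply: le_lt_trans; rewrite mulrC ler_wpM2l ?cabs_ge0 // lerDl //.
Qed.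

Lemma ler_sum_sub (K : choiceType) (a : K -> R) (l l' : seq K) :
  (forall k, 0 <= a k) -> uniq l -> {subset l <= l'} ->
  \sum_(k <- l) a k <= \sum_(k <- l') a k.
Proof.
move=> a0; elim: l l' => [|k l IH] l' ul sub; first by rewrite big_nil sumr_ge0.
have kl' : k \in l' by rewrite sub ?mem_head.
rewrite (perm_big _ (perm_to_rem kl')) !big_cons lerD2l.
move: ul => /= /andP[kl ul]; apply: IH => // i il.
have : i \in l' by rewrite sub // inE il orbT.
rewrite (perm_mem (perm_to_rem kl')) inE => /predU1P[ik|//].
by rewrite -ik il in kl.
Qed.

(** A finite list whose sum is close to the supremum of all finite sums. *)
Lemma abs_sum_tail (K : choiceType) (a : K -> R) (B : R) :
  (forall k, 0 <= a k) -> abs_sum a B ->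
  forall e, 0 < e -> exists l0, uniq l0 /\
    forall l, uniq l -> {subset l0 <= l} ->
      \sum_(k <- l) a k - \sum_(k <- l0) a k < e.
Proof.
move=> a0 hB e e0.
pose E := [set x : R | exists2 l : seq K, uniq l & x = \sum_(k <- l) a k].
have hE : has_sup E.
  split; first by exists 0, [::] => //; rewrite big_nil.
  by exists B => x [l ul ->]; exact: hB.
have [x [l0 ul0 ->] hx] := sup_adherent e0 hE.
exists l0; split=> // l ul _.
have : \sum_(k <- l) a k <= sup E by apply: ub_le_sup; [exact: hE.2 | exists l].
lra.
Qed.

Lemma sum_sub_tail (K : choiceType) (a : K -> C) (l0 l : seq K) :
  uniq l0 -> uniq l -> {subset l0 <= l} ->
  cabs (\sum_(k <- l) a k - \sum_(k <- l0) a k) <=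
  \sum_(k <- l) cabs (a k) - \sum_(k <- l0) cabs (a k).
Proof.
elim: l0 l => [|k l0 IH] l u0 ul sub.
  by rewrite !big_nil !subr0 ler_cabs_sum.
have kl : k \in l by rewrite sub ?mem_head.
rewrite !(perm_big _ (perm_to_rem kl)) /= !big_cons.
rewrite !subr_cancell.
move: u0 => /= /andP[kl0 u0]; apply: IH; rewrite ?rem_uniq // => i il.
rewrite mem_rem_uniq // inE sub ?inE ?il ?orbT // andbT.
by apply: contraNneq kl0 => <-.
Qed.

Lemma abs_sum_has_sum (K : choiceType) (a : K -> C) (B : R) :
  abs_sum (fun k => cabs (a k)) B -> exists s, has_sum a s.
Proof.
move=> hB.
have [s hs] : exists s : C, summability.partial_sum a @ summability.totally --> s; last first.
  by exists s; apply/has_sumP.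
apply: cauchyC_cvg => e e0.
have [l0 [u0 h]] := abs_sum_tail (fun k => cabs_ge0 _) hB e0.
exists (\sum_(k <- l0) a k); exists [fset k in l0]%fset => // A /= lA.
rewrite partial_sumE.
have sA : {subset l0 <= A} by move=> k kl; apply: (fsubsetP lA); rewrite inE.
apply: le_lt_trans (h (A : seq K) _ sA); last exact: fset_uniq.
by apply: sum_sub_tail => //; exact: fset_uniq.
Qed.

Lemma has_sum_near (K : choiceType) (a : K -> C) (s : C) (l0 : seq K) (e : R) :
  uniq l0 -> has_sum a s ->
  (forall l, uniq l -> {subset l0 <= l} ->
    \sum_(k <- l) cabs (a k) - \sum_(k <- l0) cabs (a k) <= e) ->
  cabs (s - \sum_(k <- l0) a k) <= e.
Proof.
move=> u0 hs h; apply/ler_addgt0Pr => r r0.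
have [l1 h1] := hs r r0.
pose l := undup (l0 ++ l1).
have ul : uniq l by exact: undup_uniq.
have s0 : {subset l0 <= l} by move=> k kl; rewrite mem_undup mem_cat kl.
have s1 : {subset l1 <= l} by move=> k kl; rewrite mem_undup mem_cat kl orbT.
have -> : s - \sum_(k <- l0) a k = (\sum_(k <- l) a k - \sum_(k <- l0) a k)
   - (\sum_(k <- l) a k - s) by ring.
apply: le_trans (ler_cabsB _ _) _; apply: lerD; last exact/ltW/h1.
exact: le_trans (sum_sub_tail a u0 ul s0) (h l ul s0).
Qed.

(** Dominated convergence for unconditional sums: outside a finite list, all
    sums are uniformly small. *)
Lemma dominated_has_sum (K : choiceType) (T : Type) (F : set_system T)
    (FF : Filter F) (a : T -> K -> C) (b : K -> C) (s : T -> C) (t : C)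
    (M : K -> R) (B : R) :
  abs_sum M B -> (forall k, 0 <= M k) ->
  (\forall x \near F, forall k, cabs (a x k) <= M k) ->
  (forall k, a x k @[x --> F] --> b k) ->
  (\forall x \near F, has_sum (a x) (s x)) -> has_sum b t ->
  (forall k, cabs (b k) <= M k) ->
  s x @[x --> F] --> t.
Proof.
move=> hM M0 ha hab has hb hbM; apply/cvgCP => e e0.
have e4 : 0 < e / 4 by rewrite divr_gt0.
have [l0 [u0 h0]] := abs_sum_tail M0 hM e4.
have tail (c : K -> C) : (forall k, cabs (c k) <= M k) ->
    forall l, uniq l -> {subset l0 <= l} ->
    \sum_(k <- l) cabs (c k) - \sum_(k <- l0) cabs (c k) <= e / 4.
  move=> hc l ul sl; apply: le_trans (ltW (h0 l ul sl)).
  elim: l0 l u0 ul sl {h0} => [|k l1 IH] l u0 ul sub.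
    by rewrite !big_nil !subr0 ler_sum.
  have kl : k \in l by rewrite sub ?mem_head.
  rewrite !(perm_big _ (perm_to_rem kl)) /= !big_cons.
  rewrite !subr_cancell.
  move: u0 => /= /andP[kl0 u0]; apply: IH; rewrite ?rem_uniq // => i il.
  rewrite mem_rem_uniq // inE sub ?inE ?il ?orbT // andbT.
  by apply: contraNneq kl0 => <-.
have hsum : (\sum_(k <- l0) a x k) @[x --> F] --> \sum_(k <- l0) b k.
  elim: l0 {u0 h0 tail} => [|k l IH].
    by under eq_fun do rewrite big_nil; rewrite big_nil; exact: cvg_cst.
  have -> : (fun x => \sum_(k <- k :: l) a x k) =
      (fun x => a x k + \sum_(k <- l) a x k).
    by apply/funext => x; rewrite big_cons.
  by rewrite big_cons; exact: (cvgD (hab k) IH).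
move/cvgCP : hsum => /(_ _ e4) hsum.
have hbt := has_sum_near u0 hb (tail b hbM).
near=> x.
have h1 : cabs (s x - \sum_(k <- l0) a x k) <= e / 4.
  apply: has_sum_near => //; first by near: x.
  by apply: tail; near: x.
have h2 : cabs (\sum_(k <- l0) a x k - \sum_(k <- l0) b k) < e / 4 by near: x.
have -> : s x - t = (s x - \sum_(k <- l0) a x k) +
  ((\sum_(k <- l0) a x k - \sum_(k <- l0) b k) - (t - \sum_(k <- l0) b k)) by ring.
apply: le_lt_trans (ler_cabsD _ _) _.
have h3 := ler_cabsB (\sum_(k <- l0) a x k - \sum_(k <- l0) b k) (t - \sum_(k <- l0) b k).
lra.
Unshelve. all: by end_near.
Qed.

Section Regroup.
Variables (K M : choiceType) (p : K -> M) (a : K -> C) (B : R) (s : C) (c : M -> C).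
Hypothesis aB : abs_sum (fun k => cabs (a k)) B.
Hypothesis as_ : has_sum a s.
Hypothesis hc : forall m, has_sum (fun k => if p k == m then a k else 0) (c m).

(** Finite parts of finitely many fibres of p, which together contain a
    given finite part and nearly exhaust each of the fibres. *)
Let fibre_approx (l0 : seq K) (lm : seq M) (e : R) : 0 < e -> uniq lm ->
  exists A : M -> seq K,
    [/\ uniq (flatten [seq A m | m <- lm]),
        {subset [seq k <- l0 | p k \in lm] <= flatten [seq A m | m <- lm]} &
        \sum_(m <- lm) cabs (c m - \sum_(k <- A m) a k) <= e].
Proof.
move=> e0 ulm.
have e1 : 0 < e / (size lm).+1%:R by rewrite divr_gt0.
have [L hL] := choice (fun m => hc m e1).
pose A m := [seq k <- undup (L m ++ l0) | p k == m].
exists A; split.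
- elim: lm ulm {e1 hL} => //= m lm IH /andP[mlm ulm].
  rewrite cat_uniq filter_uniq ?undup_uniq //= IH // andbT.
  apply/hasPn => k /flattenP[_ /mapP[m' m'l ->]]; rewrite !mem_filter => /andP[/eqP pk _].
  by apply/negP => /andP[/eqP pk' _]; rewrite -pk' pk m'l in mlm.
- move=> k; rewrite mem_filter => /andP[pk kl]; apply/flattenP.
  exists (A (p k)); first by apply: map_f.
  by rewrite mem_filter eqxx mem_undup mem_cat kl orbT.
- apply: (@le_trans _ _ (\sum_(m <- lm) e / (size lm).+1%:R)).
    apply: ler_sum => m _; rewrite cabsB.
    have -> : \sum_(k <- A m) a k = \sum_(k <- undup (L m ++ l0)) (if p k == m then a k else 0).
      by rewrite big_filter big_mkcond.
    apply/ltW/hL; rewrite ?undup_uniq // => k kl.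
    by rewrite mem_undup mem_cat kl.
  rewrite big_const_seq iter_addr_0 count_predT.
  have -> : e / (size lm).+1%:R *+ size lm = e * ((size lm)%:R / (size lm).+1%:R).
    by rewrite mulrCA mulr_natl.
  rewrite -[leRHS]mulr1 ler_wpM2l ?(ltW e0) // ler_pdivrMr ?ltr0n // mul1r.
  by rewrite ler_nat.
Qed.

Lemma regroup_abs : abs_sum (fun m => cabs (c m)) B.
Proof.
move=> lm ulm; apply/ler_addgt0Pr => e e0.
have [A [uA _ hA]] := @fibre_approx [::] lm e e0 ulm.
apply: (@le_trans _ _ (\sum_(m <- lm) (cabs (\sum_(k <- A m) a k)
     + cabs (c m - \sum_(k <- A m) a k)))).
  apply: ler_sum => m _; apply: le_trans (ler_cabsD _ _).
  by rewrite addrC subrK.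
rewrite big_split /= lerD //; apply: le_trans (aB uA).
rewrite big_flatten /= big_map; apply: ler_sum => m _; exact: ler_cabs_sum.
Qed.

(** Any finite list of fibres is approximated by one finite list of terms
    ([fibre_approx]). *)
Lemma regroup_has_sum : has_sum c s.
Proof.
move=> e e0; have e2 : 0 < e / 2 by rewrite divr_gt0.
have [l0 hl0] := as_ e2; exists (undup (map p l0)) => lm ulm sub.
have [A [uA sA hA]] := @fibre_approx l0 lm (e / 2) e2 ulm.
have h1 : cabs (\sum_(k <- flatten [seq A m | m <- lm]) a k - s) < e / 2.
  apply: hl0 => // k kl; apply: sA; rewrite mem_filter kl andbT.
  by apply: sub; rewrite mem_undup map_f.
have -> : \sum_(m <- lm) c m - s = \sum_(m <- lm) (c m - \sum_(k <- A m) a k)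
   + (\sum_(k <- flatten [seq A m | m <- lm]) a k - s).
  by rewrite big_flatten /= big_map sumrB addrA subrK.
apply: le_lt_trans (ler_cabsD _ _) _; rewrite [e]splitr ler_ltD //.
exact: le_trans (ler_cabs_sum _ _ _) hA.
Qed.

End Regroup.

Section Product.
Variables (K L : choiceType) (a : K -> C) (b : L -> C) (A B : R) (s t : C).
Hypothesis aA : abs_sum (fun k => cabs (a k)) A.
Hypothesis bB : abs_sum (fun k => cabs (b k)) B.
Hypothesis hs : has_sum a s.
Hypothesis ht : has_sum b t.

Let box (l : seq (K * L)) : exists l1 l2, [/\ uniq l1, uniq l2 &
  {subset l <= [seq (x, y) | x <- l1, y <- l2]} ].
Proof.
exists (undup (unzip1 l)), (undup (unzip2 l)); split; rewrite ?undup_uniq //.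
move=> [x y] xy; apply/allpairsP; exists (x, y); split=> //=; rewrite mem_undup.
  by apply/mapP; exists (x, y).
by apply/mapP; exists (x, y).
Qed.

Lemma product_abs : abs_sum (fun k : K * L => cabs (a k.1 * b k.2)) (A * B).
Proof.
move=> l ul; have [l1 [l2 [u1 u2 sub]]] := box l.
apply: (le_trans (ler_sum_sub (fun _ => cabs_ge0 _) ul sub)).
rewrite big_allpairs /=; under eq_bigr do under eq_bigr do rewrite cabsM.
under eq_bigr do rewrite -mulr_sumr; rewrite -mulr_suml.
by rewrite ler_pM ?aA ?bB // sumr_ge0 // => *; exact: cabs_ge0.
Qed.

(** The sum over a box of finite lists factors, and every finite list of
    pairs lies in a box. *)
Lemma product_has_sum : has_sum (fun k : K * L => a k.1 * b k.2) (s * t).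
Proof.
have [u hu] := abs_sum_has_sum product_abs.
suff -> : s * t = u by [].
apply/eqP; rewrite -subr_eq0 -cabs_eq0 eq_le cabs_ge0 andbT.
apply/ler_addgt0Pr => e e0; rewrite add0r.
pose e' := Num.min 1 (e / 2 / (1 + cabs s + cabs t)).
have st0 : 0 < 1 + cabs s + cabs t by have := cabs_ge0 s; have := cabs_ge0 t; lra.
have e'0 : 0 < e' by rewrite lt_min ltr01 !divr_gt0.
have e2 : 0 < e / 2 by rewrite divr_gt0.
have [l0 h0] := hu _ e2; have [l1 h1] := hs e'0; have [l2 h2] := ht e'0.
have [k1 [k2 [_ _ sub]]] := box l0.
pose m1 := undup (l1 ++ k1); pose m2 := undup (l2 ++ k2).
have {}h1 : cabs (\sum_(k <- m1) a k - s) < e'.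
  by apply: h1; rewrite ?undup_uniq // => k kl; rewrite mem_undup mem_cat kl.
have {}h2 : cabs (\sum_(k <- m2) b k - t) < e'.
  by apply: h2; rewrite ?undup_uniq // => k kl; rewrite mem_undup mem_cat kl.
have := h0 [seq (x, y) | x <- m1, y <- m2].
rewrite big_allpairs /=; under eq_bigr do rewrite -mulr_sumr; rewrite -mulr_suml.
set x := \sum_(k <- m1) a k in h1 *; set y := \sum_(k <- m2) b k in h2 *.
move=> h; have {}h : cabs (x * y - u) < e / 2.
  apply: h; first by apply: allpairs_uniq; rewrite ?undup_uniq // => -[? ?] [? ?].
  move=> k /sub /allpairsP[q [q1 q2 ->]]; apply: allpairs_f.
    by rewrite mem_undup mem_cat q1 orbT.
  by rewrite mem_undup mem_cat q2 orbT.
have -> : s * t - u = (x * y - u) - ((x - s) * (y - t) + s * (y - t) + t * (x - s)) by ring.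
apply: le_trans (ler_cabsB _ _) _.
have k1' : cabs ((x - s) * (y - t) + s * (y - t) + t * (x - s)) <= e' * (1 + cabs s + cabs t).
  apply: le_trans (ler_cabsD _ _) _; rewrite cabsM.
  apply: le_trans (lerD (ler_cabsD _ _) (lexx _)) _; rewrite !cabsM.
  have g1 := cabs_ge0 s; have g2 := cabs_ge0 t.
  have g3 := cabs_ge0 (x - s); have g4 := cabs_ge0 (y - t).
  have : cabs (x - s) * cabs (y - t) <= e' * 1.
    by rewrite ler_pM //; [exact: ltW | apply: le_trans (ltW h2) _; rewrite ge_min lexx].
  have : cabs s * cabs (y - t) <= cabs s * e' by rewrite ler_wpM2l // ltW.
  have : cabs t * cabs (x - s) <= cabs t * e' by rewrite ler_wpM2l // ltW.
  lra.
have : e' * (1 + cabs s + cabs t) <= e / 2.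
  by rewrite -ler_pdivlMr // ge_min lexx orbT.
lra.
Qed.

End Product.
End Summation.

(** * The binomial series *)

Section Growth.
Variable R : realType.

Lemma bernoulli (y : R) n : 0 <= y -> 1 + y *+ n <= (1 + y) ^+ n.
Proof.
move=> y0; elim: n => [|n IH]; first by rewrite mulr0n addr0 expr0.
have h : 0 <= y *+ n by rewrite mulrn_wge0.
by rewrite exprS mulrSr; nra.
Qed.

Lemma growth_step (A k : nat) :
  (1 + A%:R / k.+1%:R) * k.+1%:R ^+ A <= (k.+2%:R : R) ^+ A.
Proof.
have k0 : 0 < k.+1%:R :> R by rewrite ltr0n.
have -> : (k.+2%:R : R) = (1 + k.+1%:R^-1) * k.+1%:R.
  by rewrite mulrDl mulVf ?gt_eqF // mul1r -natr1 addrC.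
rewrite exprMn ler_wpM2r ?exprn_ge0 ?(ltW k0) //.
by rewrite mulr_natl bernoulli // invr_ge0 (ltW k0).
Qed.

(** The discrete form of the fact that u'/u <= A/k gives polynomial growth
    of degree A. *)
Lemma poly_growth (u : nat -> R) (A : nat) :
  (forall k, 0 <= u k) ->
  (forall k, u k.+1 <= (1 + A%:R / k.+1%:R) * u k) ->
  forall k, u k <= u 0%N * k.+1%:R ^+ A.
Proof.
move=> u0 h; elim=> [|k IH]; first by rewrite expr1n mulr1.
apply: le_trans (h k) _.
have k1 : 0 <= 1 + A%:R / k.+1%:R :> R by rewrite addr_ge0 // divr_ge0.
apply: le_trans (ler_wpM2l k1 IH) _; rewrite mulrCA ler_wpM2l //; exact: growth_step.
Qed.

(** A larger geometric ratio absorbs a polynomial: compare with one term of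
    the exponential series. *)
Lemma poly_geometric (D : nat) (r q : R) : 0 < r -> r < q ->
  exists2 c, 0 < c & forall k, k.+1%:R ^+ D * r ^+ k <= c * q ^+ k.
Proof.
move=> r0 rq; have q0 := lt_trans r0 rq.
pose e := ln (q / r).
have e0 : 0 < e by rewrite ln_gt0 // ltr_pdivlMr ?mul1r.
have hq : expR e * r = q by rewrite lnK ?posrE ?divr_gt0 // mulfVK // gt_eqF.
have f0 : 0 < D`!%:R :> R by rewrite ltr0n fact_gt0.
exists (D`!%:R * expR e / e ^+ D); first by rewrite divr_gt0 ?exprn_gt0 ?mulr_gt0 ?expR_gt0.
move=> k; have k0 : 0 < k.+1%:R :> R by rewrite ltr0n.
have h : (e * k.+1%:R) ^+ D <= D`!%:R * expR (e * k.+1%:R).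
  have y0 : 0 <= e * k.+1%:R by rewrite mulr_ge0 // ltW.
  case: D f0 => [|D] f0; first by rewrite expr0 fact0 mul1r (le_trans _ (expR_ge1Dx _)) // lerDl.
  have h := expR_ge1Dxn D y0.
  rewrite [leRHS]mulrC -ler_pdivrMr //; lra.
have -> : D`!%:R * expR e / e ^+ D * q ^+ k =
    (D`!%:R * expR (e * k.+1%:R)) / e ^+ D * r ^+ k.
  rewrite -hq exprMn -[expR e ^+ k]expRM_natl -natr1 mulrDr mulr1 expRD [e * _]mulrC.
  ring.
rewrite ler_wpM2r ?exprn_ge0 ?(ltW r0) // ler_pdivlMr ?exprn_gt0 //.
by rewrite -exprMn [_ * e]mulrC.
Qed.

Lemma geometric_sum_le (q : R) n : 0 <= q -> q < 1 ->
  \sum_(k < n) q ^+ k <= (1 - q)^-1.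
Proof.
move=> q0 q1; have d0 : 0 < 1 - q by rewrite subr_gt0.
rewrite -[leRHS]mul1r ler_pdivlMr //.
have -> : (\sum_(k < n) q ^+ k) * (1 - q) = 1 - q ^+ n.
  elim: n => [|n IH]; first by rewrite big_ord0 mul0r expr0 subrr.
  by rewrite big_ord_recr /= mulrDl IH exprSr; ring.
by rewrite gerBl exprn_ge0.
Qed.

End Growth.

Section ComplexCurves.
Variable R : realType.
Local Notation C := R[i].

Section RealRules.
Implicit Types (f g : R -> R) (t d e : R).

Lemma derM f g t d e : is_derive t 1 f d -> is_derive t 1 g e ->
  is_derive t 1 (fun u => f u * g u) (d * g t + f t * e).
Proof.
by move=> hf hg; apply: is_derive_eq (is_deriveM hf hg) _; rewrite addrC mulrC.
Qed.

Lemma derD f g t d e : is_derive t 1 f d -> is_derive t 1 g e ->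
  is_derive t 1 (fun u => f u + g u) (d + e).
Proof. by move=> hf hg; exact: (is_deriveD hf hg). Qed.

Lemma derB f g t d e : is_derive t 1 f d -> is_derive t 1 g e ->
  is_derive t 1 (fun u => f u - g u) (d - e).
Proof. by move=> hf hg; exact: (is_deriveB hf hg). Qed.

Lemma derV f t d : f t != 0 -> is_derive t 1 f d ->
  is_derive t 1 (fun u => (f u)^-1) (- d / f t ^+ 2).
Proof.
move=> f0 [df <-]; apply: DeriveDef; first exact: derivableV.
by rewrite deriveV // /GRing.scale /=; field.
Qed.

Lemma der_comp f g t d e : is_derive (g t) 1 f d -> is_derive t 1 g e ->
  is_derive t 1 (fun u => f (g u)) (d * e).
Proof. by move=> hf hg; exact: (is_derive1_comp hf hg). Qed.

Lemma der_eq f g t d e : is_derive t 1 f d -> f =1 g -> d = e -> is_derive t 1 g e.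
Proof. by move=> h /funext <- <-. Qed.

Lemma der_affine (a b : R) t : is_derive t 1 (fun u => a + u * b) b.
Proof.
have h := derD (is_derive_cst a t 1) (derM (is_derive_id t 1) (is_derive_cst b t 1)).
by apply: der_eq h _ _ => //=; rewrite mulr0 mul1r addr0 add0r.
Qed.

End RealRules.

(** Differentiability of a complex curve, by coordinates: the real
    differential calculus then applies along a segment. *)
Definition cderiv (f : R -> C) (t : R) (d : C) : Prop :=
  is_derive t 1 (fun u => complex.Re (f u)) (complex.Re d) /\
  is_derive t 1 (fun u => complex.Im (f u)) (complex.Im d).

Lemma cderivM f g t df dg : cderiv f t df -> cderiv g t dg ->
  cderiv (fun u => f u * g u) t (df * g t + f t * dg).
Proof.
move=> [f1 f2] [g1 g2]; split.
- apply: der_eq (derB (derM f1 g1) (derM f2 g2)) _ _.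
    by move=> u /=; case: (f u) => a b; case: (g u) => c e.
  case: (f t) => a b; case: (g t) => c e.
  case: df {f1 f2} => df1 df2; case: dg {g1 g2} => dg1 dg2 /=; ring.
- apply: der_eq (derD (derM f1 g2) (derM f2 g1)) _ _.
    by move=> u /=; case: (f u) => a b; case: (g u) => c e.
  case: (f t) => a b; case: (g t) => c e.
  case: df {f1 f2} => df1 df2; case: dg {g1 g2} => dg1 dg2 /=; ring.
Qed.

Lemma cderiv_cst (c : C) t : cderiv (fun=> c) t 0.
Proof. by split => /=; exact: is_derive_cst. Qed.

Lemma cderiv_eq f t d d' : cderiv f t d -> d = d' -> cderiv f t d'.
Proof. by move=> h <-. Qed.

Lemma cderiv_cexp f t d : cderiv f t d ->
  cderiv (fun u => cexp (f u)) t (d * cexp (f t)).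
Proof.
move=> [f1 f2].
have he := @der_comp (@expR R) (fun u => complex.Re (f u)) _ _ _ (is_derive_expR (complex.Re (f t))) f1.
have hc := der_comp (is_derive_cos (complex.Im (f t))) f2.
have hs := der_comp (is_derive_sin (complex.Im (f t))) f2.
split.
- apply: der_eq (derM he hc) _ _; first by move=> u; rewrite /cexp /= mul0r subr0.
  by rewrite /cexp /=; case: d {f1 f2 he hc hs} => d1 d2 /=; ring.
- apply: der_eq (derM he hs) _ _; first by move=> u; rewrite /cexp /= mul0r addr0.
  by rewrite /cexp /=; case: d {f1 f2 he hc hs} => d1 d2 /=; ring.
Qed.

Lemma is_derive0_segment (f : R -> R) :
  (forall t : R, 0 <= t <= 1 -> is_derive t 1 f 0) -> f 0 = f 1.
Proof.
move=> h.
have [c _] : exists2 c : R, c \in `]0, 1[ & f 1 - f 0 = (fun=> 0 : R) c * (1 - 0).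
  apply: MVT => //.
    by move=> x; rewrite in_itv /= => /andP[x0 x1]; apply: h; rewrite !ltW.
  apply: derivable_within_continuous => x; rewrite in_itv /= => x01.
  by have [] := h x x01.
by rewrite mul0r => /eqP; rewrite subr_eq0 => /eqP.
Qed.

Lemma cderiv0_segment (f : R -> C) :
  (forall t : R, 0 <= t <= 1 -> cderiv f t 0) -> f 0 = f 1.
Proof.
move=> h; apply/eqP; rewrite eq_complex.
have e1 := @is_derive0_segment (fun u => complex.Re (f u)) (fun t ht => (h t ht).1).
have e2 := @is_derive0_segment (fun u => complex.Im (f u)) (fun t ht => (h t ht).2).
by rewrite e1 e2 !eqxx.
Qed.

Lemma carg_atan (a b : R) : 0 < a -> carg (a +i* b) = atan (b / a).
Proof.
move=> a0; rewrite /carg normc_def /=.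
have [y yd yE] : exists2 y, b / a = y & b = y * a.
  by exists (b / a); rewrite // mulfVK // gt_eqF.
rewrite yd.
have pi0 := pi_gt0 R.
have h1 := atan_ltpi2 y; have h2 : - (pi / 2) < atan y by have [/andP[]] := atan_def y.
have hc : a / Num.sqrt (a ^+ 2 + b ^+ 2) = cos (atan y).
  have -> : a ^+ 2 + b ^+ 2 = (1 + y ^+ 2) * a ^+ 2 by rewrite yE; ring.
  rewrite cos_atan [_ * a ^+ 2]mulrC sqrtrM ?sqr_ge0 //.
  by rewrite sqrtr_sqr gtr0_norm // invfM mulrA mulfV ?gt_eqF // mul1r.
rewrite hc; case: ifP => b0.
- apply: cosK; rewrite in_itv /=; apply/andP; split; last lra.
  have y0 : 0 <= y by rewrite -yd divr_ge0 // ltW.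
  rewrite leNgt; apply/negP => ha.
  have : tan (atan y) < tan 0 by rewrite ltr_tan ?in_itv //= ?h1 ?h2 //; lra.
  by rewrite atanK tan0; lra.
- rewrite cosKN ?opprK //; apply/andP; split; first lra.
  have y0 : y < 0 by rewrite -yd ltr_pdivrMr // mul0r ltNge b0.
  rewrite leNgt; apply/negP => ha.
  have : tan 0 < tan (atan y) by rewrite ltr_tan ?in_itv //= ?h1 ?h2 //; lra.
  by rewrite atanK tan0; lra.
Qed.

Lemma ln_norm (a b : R) : 0 < a ->
  ln (complex.Re `|a +i* b|) = ln (a ^+ 2 + b ^+ 2) / 2.
Proof.
move=> a0; rewrite normc_def /=.
have p0 : 0 < a ^+ 2 + b ^+ 2 by rewrite ltr_wpDr ?sqr_ge0 // exprn_gt0.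
rewrite -{2}[a ^+ 2 + b ^+ 2]sqr_sqrtr ?ltW // lnXn ?sqrtr_gt0 //.
by move: (ln _) => l; field.
Qed.

(** On the half-plane of positive real part the principal argument is the
    arctangent of the slope, so that the derivative is computed with real
    functions. *)
Lemma cderiv_clog (w : C) (t : R) : 0 < 1 - t * complex.Re w ->
  cderiv (fun u => clog (1 - u%:C * w)) t (- w / (1 - t%:C * w)).
Proof.
case: w => w1 w2 /= h0.
have near0 : \forall u \near t, 0 < 1 - u * w1.
  have hc : {for t, continuous (fun u : R => 1 - u * w1)}.
    by apply: cvgB; [exact: cvg_cst | apply: cvgMl; exact: cvg_id].
  exact: (cvgr_gt _ hc).
have uE u : 1 - u%:C * (w1 +i* w2) = (1 - u * w1) +i* (- (u * w2)).
  by apply/eqP; rewrite eq_complex /=; apply/andP; split; apply/eqP; ring.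
have da : is_derive t 1 (fun u : R => 1 - u * w1) (- w1).
  by apply: der_eq (der_affine 1 (- w1) t) _ _ => // u; rewrite mulrN.
have db : is_derive t 1 (fun u : R => - (u * w2)) (- w2).
  by apply: der_eq (der_affine 0 (- w2) t) _ _ => // u; rewrite mulrN add0r.
pose a u : R := 1 - u * w1; pose b u : R := - (u * w2).
have n0 : 0 < a t * a t + b t * b t by rewrite ltr_wpDr -?expr2 ?sqr_ge0 // exprn_gt0.
have eqn1 : \forall u \near t, ln (a u * a u + b u * b u) / 2 =
    complex.Re (clog (1 - u%:C * (w1 +i* w2))).
  by near=> u; rewrite uE /clog /= ln_norm ?expr2 //; near: u.
have eqn2 : \forall u \near t, atan (b u / a u) =
    complex.Im (clog (1 - u%:C * (w1 +i* w2))).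
  by near=> u; rewrite uE /clog /= carg_atan //; near: u.
have dn := derD (derM da da) (derM db db).
have dl := @der_comp (@ln R) (fun u => a u * a u + b u * b u) _ _ _ (is_derive1_ln n0) dn.
have di : is_derive t 1 (fun u => (a u)^-1) (- (- w1) / (a t) ^+ 2).
  exact: (@derV a _ _ (lt0r_neq0 h0) da).
have dat := @der_comp (@atan R) (fun u => b u / a u) _ _ _ (is_derive1_atan (b t / a t)) (derM db di).
have at0 : a t != 0 by rewrite gt_eqF.
have nt0 : a t * a t + b t * b t != 0 by rewrite gt_eqF.
have nt1 : 1 + (b t / a t) ^+ 2 != 0 by rewrite gt_eqF // ltr_wpDr ?sqr_ge0.
have dE : - (w1 +i* w2) / (1 - t%:C * (w1 +i* w2)) =
   ((- w1 * a t - w2 * b t) / (a t * a t + b t * b t)) +i*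
   ((- w2 * a t + w1 * b t) / (a t * a t + b t * b t)).
  rewrite uE -/(a t) -/(b t); apply: (mulIf (x := a t +i* b t)).
    by rewrite eq_complex /= negb_and at0.
  rewrite divfK; last by rewrite eq_complex /= negb_and at0.
  apply/eqP; rewrite eq_complex /=; apply/andP; split; apply/eqP; field => //.
split; rewrite dE /=.
- apply: near_eq_is_derive eqn1 _.
  have dc : is_derive t 1 (fun _ : R => 2^-1 : R) 0 by exact: is_derive_cst.
  have dh := derM dl dc.
  apply: (der_eq dh) => //=.
  by move: nt0; rewrite /a /b => nt0; field.
- apply: near_eq_is_derive eqn2 _.
  apply: (der_eq dat) => //=.
  move: nt0 at0; rewrite /a /b => nt0 at0; field; rewrite nt0 at0.
Unshelve. all: by end_near.
Qed.

End ComplexCurves.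

Section NatSums.
Variable R : realType.
Local Notation C := R[i].

Lemma has_sum_cvg (a : nat -> C) (s : C) :
  has_sum a s -> (\sum_(k < n) a k) @[n --> \oo] --> s.
Proof.
move=> h; apply/cvgCP => e e0; have [l0 hl0] := h e e0.
exists (\max_(k <- l0) k).+1 => // n /= hn.
rewrite -(big_mkord xpredT a); apply: hl0; first exact: iota_uniq.
move=> k kl; rewrite mem_index_iota /=; apply: leq_trans hn; rewrite ltnS.
by rewrite (big_rem k) //= leq_max leqnn.
Qed.

Lemma abs_sum_geometric (a : nat -> R) (c q : R) : 0 <= c -> 0 <= q -> q < 1 ->
  (forall k, 0 <= a k <= c * q ^+ k) -> abs_sum a (c / (1 - q)).
Proof.
move=> c0 q0 q1 h l ul.
pose n := (\max_(k <- l) k).+1.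
have sub : {subset l <= iota 0 n}.
  move=> k kl; rewrite mem_iota /= add0n ltnS (big_rem k) //= leq_max leqnn //.
have a0 k : 0 <= a k by have /andP[] := h k.
apply: (le_trans (ler_sum_sub a0 ul sub)).
rewrite -[iota 0 n]/(index_iota 0 n) big_mkord.
apply: (@le_trans _ _ (\sum_(k < n) c * q ^+ k)).
  by apply: ler_sum => k _; have /andP[] := h k.
by rewrite -mulr_sumr ler_wpM2l // geometric_sum_le.
Qed.

End NatSums.

Section Binomial.
Variable R : realType.
Local Notation C := R[i].

(** The coefficients of the expansion of (1 - w) ^ s. *)
Definition binc (s : C) (k : nat) : C := \prod_(i < k) ((i%:R - s) / i.+1%:R).

Lemma binc0 s : binc s 0 = 1.
Proof. by rewrite /binc big_ord0. Qed.

Lemma bincS s k : k.+1%:R * binc s k.+1 = (k%:R - s) * binc s k.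
Proof.
rewrite /binc big_ord_recr /=; have : k.+1%:R != 0 :> C by rewrite pnatr_eq0.
by move: (\prod_(i < k) _) (k.+1%:R : C) => p n n0; field.
Qed.

(** The ratio of consecutive coefficients is 1 - (1 + s)/(k + 1). *)
Lemma binc_growth (s : C) (A : nat) : cabs (1 + s) <= A%:R ->
  forall k, cabs (binc s k) <= k.+1%:R ^+ A.
Proof.
move=> sA k; apply: le_trans (@poly_growth R (fun k => cabs (binc s k)) A _ _ k) _.
- by move=> ?; exact: cabs_ge0.
- move=> {}k; rewrite /binc big_ord_recr /= cabsM mulrC ler_wpM2r ?cabs_ge0 //.
  have k0 : 0 < k.+1%:R :> R by rewrite ltr0n.
  rewrite cabsM cabsV cabs_nat ler_pdivrMr // mulrDl mul1r mulfVK ?gt_eqF //.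
  have -> : k%:R - s = k.+1%:R - (1 + s) :> C by rewrite -natr1; ring.
  apply: le_trans (ler_cabsB _ _) _; rewrite cabs_nat.
  by rewrite lerD2l.
- by rewrite binc0 cabs1 mul1r.
Qed.

Lemma binomial_abs_sum (s w : C) : cabs w < 1 ->
  exists B, abs_sum (fun k => cabs (binc s k * w ^+ k)) B.
Proof.
move=> w1; pose A := Num.bound (cabs (1 + s)).
have hA : cabs (1 + s) <= A%:R by apply/ltW/archi_boundP/cabs_ge0.
pose r := (cabs w + 1) / 2; pose q := (r + 1) / 2.
have w0 := cabs_ge0 w.
have r0 : 0 < r by rewrite /r; lra.
have rq : r < q by rewrite /q /r; lra.
have [c c0 hc] := poly_geometric A r0 rq.
exists (c / (1 - q)); apply: abs_sum_geometric; rewrite ?(ltW c0) //; [lra|rewrite /q /r; lra|].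
move=> k; rewrite cabs_ge0 /= cabsM cabsX; apply: le_trans (hc k).
rewrite ler_pM ?exprn_ge0 ?cabs_ge0 ?binc_growth //.
by rewrite lerXn2r ?nnegrE ?(ltW r0) //; rewrite /r; lra.
Qed.

Lemma cvg_pseries_growth (c : nat -> R) (a : R) (D : nat) (r K : R) :
  0 <= a -> 0 < r -> 0 < K -> r * K < 1 ->
  (forall k, `|c k| <= a * (k.+1%:R ^+ D * r ^+ k)) -> cvgn (pseries c K).
Proof.
move=> a0 r0 K0 rK h.
have rK0 : 0 < r * K by rewrite mulr_gt0.
pose q := (r * K + 1) / 2.
have rq : r * K < q by rewrite /q; lra.
have q1 : q < 1 by rewrite /q; lra.
have q0 : 0 < q by apply: lt_trans rq.
have [b b0 hb] := poly_geometric D rK0 rq.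
apply: normed_cvg.
apply: (@series_le_cvg _ _ (geometric (a * b) q)).
- by move=> n; exact: normr_ge0.
- by move=> n /=; rewrite !mulr_ge0 ?exprn_ge0 // ltW.
- move=> n /=; rewrite normrM normrX (gtr0_norm K0).
  apply: (@le_trans _ _ (a * (n.+1%:R ^+ D * r ^+ n) * K ^+ n)).
    by rewrite ler_wpM2r ?exprn_ge0 // ltW.
  rewrite -!mulrA ler_wpM2l // -exprMn; exact: hb.
- by apply: is_cvg_geometric_series; rewrite gtr0_norm.
Qed.

Lemma pseries_diffs_growth (c : nat -> R) (a : R) (D : nat) (r : R) :
  0 <= a -> 0 < r ->
  (forall k, `|c k| <= a * (k.+1%:R ^+ D * r ^+ k)) ->
  forall k, `|pseries_diffs c k| <= (a * 2 ^+ D * r) * (k.+1%:R ^+ D.+1 * r ^+ k).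
Proof.
move=> a0 r0 h k; rewrite /pseries_diffs normrM normr_nat.
have k0 : 0 < k.+1%:R :> R by rewrite ltr0n.
apply: le_trans (ler_wpM2l (ltW k0) (h _)) _.
have -> : a * 2 ^+ D * r * (k.+1%:R ^+ D.+1 * r ^+ k) =
    k.+1%:R * (a * ((2 * k.+1%:R) ^+ D * r ^+ k.+1)).
  by rewrite exprMn !exprS; ring.
rewrite ler_wpM2l ?(ltW k0) // ler_wpM2l // ler_wpM2r ?exprn_ge0 ?(ltW r0) //.
rewrite lerXn2r ?nnegrE ?mulr_ge0 ?(ltW k0) // -[in leLHS]natr1.
have : 1 <= k.+1%:R :> R by rewrite ler1n.
lra.
Qed.

(** The binomial series, by its differential equation along the segment from
    0 to w. *)
Lemma binomial_cvg (s w : C) : cabs w < 1 ->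
  (\sum_(k < n) binc s k * w ^+ k) @[n --> \oo] --> cpow (1 - w) s.
Proof.
move=> w1; have w0 := cabs_ge0 w.
pose A := Num.bound (cabs (1 + s)).
have hA : cabs (1 + s) <= A%:R by apply/ltW/archi_boundP/cabs_ge0.
have [r [r0 r1 wr]] : exists r : R, [/\ 0 < r, r < 1 & cabs w <= r].
  by exists ((cabs w + 1) / 2); split; lra.
(* a radius K > 1 of convergence, so that t = 1 is an interior point *)
have [K [K1 rK]] : exists K : R, 1 < K /\ r * K < 1.
  exists (2 / (r + 1)); rewrite ltr_pdivlMr ?mulrA ?ltr_pdivrMr; lra.
have K0 : 0 < K by lra.
pose a k := binc s k * w ^+ k.
pose al k := complex.Re (a k); pose be k := complex.Im (a k).
have ag k : cabs (a k) <= 1 * (k.+1%:R ^+ A * r ^+ k).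
  rewrite mul1r cabsM cabsX ler_pM ?exprn_ge0 ?cabs_ge0 ?binc_growth //.
  by rewrite lerXn2r ?nnegrE ?(ltW r0).
have alg k : `|al k| <= 1 * (k.+1%:R ^+ A * r ^+ k) := le_trans (Re_le_cabs _) (ag k).
have beg k : `|be k| <= 1 * (k.+1%:R ^+ A * r ^+ k) := le_trans (Im_le_cabs _) (ag k).
have conv (c : nat -> R) : (forall k, `|c k| <= 1 * (k.+1%:R ^+ A * r ^+ k)) ->
   [/\ cvgn (pseries c K), cvgn (pseries (pseries_diffs c) K)
     & cvgn (pseries (pseries_diffs (pseries_diffs c)) K)].
  move=> h; have h1 := pseries_diffs_growth ler01 r0 h.
  have a1 : 0 <= 1 * 2 ^+ A * r by rewrite !mulr_ge0 ?exprn_ge0 ?(ltW r0) //.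
  have h2 := pseries_diffs_growth a1 r0 h1.
  split; [exact: cvg_pseries_growth h|exact: cvg_pseries_growth h1|].
  apply: cvg_pseries_growth h2 => //.
  by rewrite mulr_ge0 ?(ltW r0) // mulr_ge0 // exprn_ge0.
have [cal1 cal2 cal3] := conv al alg; have [cbe1 cbe2 cbe3] := conv be beg.
have inK (t : R) : 0 <= t <= 1 -> `|t| < `|K|.
  by move=> /andP[t0 t1]; rewrite ger0_norm // gtr0_norm //; lra.
(* the sum of the series at t w, and its derivative in t *)
pose B (t : R) : C := limn (pseries al t) +i* limn (pseries be t).
pose B' (t : R) : C := limn (pseries (pseries_diffs al) t) +i* limn (pseries (pseries_diffs be) t).
have dB t : 0 <= t <= 1 -> cderiv B t (B' t).
  by move=> t01; split; apply: (@pseries_snd_diffs _ _ K) => //; exact: inK.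
have cB t : 0 <= t <= 1 -> (\sum_(k < n) a k * t%:C ^+ k) @[n --> \oo] --> B t.
  move=> t01; have c1 := is_cvg_pseries_inside cal1 (inK t t01).
  have c2 := is_cvg_pseries_inside cbe1 (inK t t01).
  apply: cvg_complex.
    apply: cvg_trans c1; apply: near_eq_cvg; near=> n.
    rewrite /pseries /series /= raddf_sum big_mkord; apply: eq_bigr => k _.
    by rewrite -rmorphXn /= /al; case: (a k) => x y /=; rewrite mulr0 subr0.
  apply: cvg_trans c2; apply: near_eq_cvg; near=> n.
  rewrite /pseries /series /= raddf_sum big_mkord; apply: eq_bigr => k _.
  by rewrite -rmorphXn /= /be; case: (a k) => x y /=; rewrite mulr0 add0r.
have cB' t : 0 <= t <= 1 ->
    (\sum_(k < n) k.+1%:R * a k.+1 * t%:C ^+ k) @[n --> \oo] --> B' t.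
  move=> t01; have c1 := is_cvg_pseries_inside cal2 (inK t t01).
  have c2 := is_cvg_pseries_inside cbe2 (inK t t01).
  apply: cvg_complex.
    apply: cvg_trans c1; apply: near_eq_cvg; near=> n.
    rewrite /pseries /series /= raddf_sum big_mkord; apply: eq_bigr => k _.
    rewrite -rmorphXn /= -(rmorph_nat (real_complex R)) /pseries_diffs /al.
    by case: (a k.+1) => x y /=; rewrite !(mulr0, mul0r, subr0, addr0).
  apply: cvg_trans c2; apply: near_eq_cvg; near=> n.
  rewrite /pseries /series /= raddf_sum big_mkord; apply: eq_bigr => k _.
  rewrite -rmorphXn /= -(rmorph_nat (real_complex R)) /pseries_diffs /be.
  by case: (a k.+1) => x y /=; rewrite !(mulr0, mul0r, subr0, addr0, add0r).
(* the partial sums telescope, by the recurrence of the coefficients *)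
have ode t : 0 <= t <= 1 -> (1 - t%:C * w) * B' t + s * w * B t = 0.
  move=> t01.
  have h1 : ((1 - t%:C * w) * (\sum_(k < n) k.+1%:R * a k.+1 * t%:C ^+ k)
     + s * w * (\sum_(k < n) a k * t%:C ^+ k)) @[n --> \oo] -->
     (1 - t%:C * w) * B' t + s * w * B t.
    by apply: cvgD; apply: cvgMr; [exact: cB' | exact: cB].
  have h2 n : (1 - t%:C * w) * (\sum_(k < n) k.+1%:R * a k.+1 * t%:C ^+ k)
     + s * w * (\sum_(k < n) a k * t%:C ^+ k) = - (n%:R * a n * w * t%:C ^+ n).
    elim: n => [|n IH]; first by rewrite !big_ord0; ring.
    rewrite !big_ord_recr /= !mulrDr addrACA IH /a.
    rewrite -[n.+1%:R * _ in LHS]/(n.+1%:R * (binc s n.+1 * w ^+ n.+1)).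
    have -> : n.+1%:R * (binc s n.+1 * w ^+ n.+1) = (n%:R - s) * binc s n * w ^+ n.+1.
      by rewrite mulrA bincS.
    rewrite !exprS; ring.
  have h3 : (- (n%:R * a n * w * t%:C ^+ n)) @[n --> \oo] --> (0 : C).
    pose q := (r + 1) / 2.
    have rq : r < q by rewrite /q; lra.
    have q1 : q < 1 by rewrite /q; lra.
    have [c c0 hc] := poly_geometric A.+1 r0 rq.
    have hg : geometric c q @ \oo --> (0 : R) by apply: cvg_geometric; rewrite ger0_norm; lra.
    apply/cvgCP => e e0; move/cvgrPdist_lt : hg => /(_ e e0); apply: filterS => n.
    rewrite sub0r normrN ger0_norm; last by rewrite mulr_ge0 ?exprn_ge0; lra.
    apply: le_lt_trans; have := ag n; rewrite mul1r; move: (a n) => an agn.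
    rewrite subr0 cabsN 3!cabsM cabsX cabs_nat cabsR.
    apply: le_trans (hc n).
    apply: (@le_trans _ _ (n%:R * cabs an * 1 * 1)).
      rewrite ler_pM ?mulr_ge0 ?exprn_ge0 ?cabs_ge0 ?ler0n //.
        by rewrite ler_wpM2l ?mulr_ge0 ?cabs_ge0 ?ler0n // ltW.
      by rewrite exprn_ile1 ?normr_ge0 //; move: t01 => /andP[t0 t1]; rewrite ger0_norm.
    rewrite !mulr1 exprS -mulrA ler_pM ?cabs_ge0 ?ler0n ?ler_nat //.
  move: h1; under eq_fun do rewrite h2; move=> h1.
  exact: (cvg_unique _ h1 h3).
(* E = (1 - t w)^(-s), and B E is constant along the segment *)
pose E (t : R) : C := cexp (- s * clog (1 - t%:C * w)).
have wre : complex.Re w < 1 by apply: le_lt_trans w1; apply: le_trans (Re_le_cabs w); exact: ler_norm.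
have tw t : 0 <= t <= 1 -> 0 < 1 - t * complex.Re w by move=> /andP[t0 t1]; have [?|?] := lerP (complex.Re w) 0; nra.
have dE t : 0 <= t <= 1 -> cderiv E t (s * w / (1 - t%:C * w) * E t).
  move=> t01; have h := cderiv_cexp (cderivM (cderiv_cst (- s) t) (cderiv_clog (tw t t01))).
  apply: cderiv_eq h _; rewrite /E; congr (_ * _); rewrite mul0r add0r; ring.
have BE t : 0 <= t <= 1 -> cderiv (fun t => B t * E t) t 0.
  move=> t01; apply: cderiv_eq (cderivM (dB t t01) (dE t t01)) _.
  have u0 : 1 - t%:C * w != 0.
    apply: contraTneq (tw t t01) => /(congr1 (@complex.Re R)).
    by case: (w) => x y /=; rewrite mul0r subr0 => ->; rewrite ltxx.
  have -> : B' t = - (s * w * B t) / (1 - t%:C * w).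
    apply: (mulfI u0); rewrite mulrC mulrCA mulfV // mulr1; apply/eqP.
    by rewrite -subr_eq0 opprK mulrC ode.
  by field.
have := cderiv0_segment BE.
have E0 : E 0 = 1.
  rewrite /E rmorph0 mul0r subr0 /clog normr1 /= ln1.
  have -> : carg (1 : C) = 0.
    by rewrite -[1 : C]/(1 +i* 0) carg_atan ?ltr01 // mul0r atan0.
  by rewrite complexr0 rmorph0 mulr0 cexp0.
have B0 : B 0 = 1.
  have t01 : 0 <= (0 : R) <= 1 by rewrite lexx ler01.
  have h : (\sum_(k < n) a k * (0 : R)%:C ^+ k) @[n --> \oo] --> (1 : C).
    apply: cvg_near_cst; exists 1%N => // n /= n1.
    case: n n1 => // n _; rewrite big_ord_recl /= expr0 mulr1 /a binc0 expr0 mulr1.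
    by rewrite big1 ?addr0 // => k _; rewrite rmorph0 expr0n /= mulr0.
  exact: (cvg_unique _ (cB 0 t01) h).
rewrite E0 B0 mulr1 => e1.
have -> : cpow (1 - w) s = B 1.
  have E1 : E 1 != 0 by exact: cexp_neq0.
  apply: (mulIf E1); rewrite -e1 /cpow /E rmorph1 mul1r -cexpD.
  by rewrite mulNr subrr cexp0.
have t11 : 0 <= (1 : R) <= 1 by rewrite lexx ler01.
have := cB 1 t11; apply: cvg_trans; apply: near_eq_cvg; near=> n.
by apply: eq_bigr => k _; rewrite rmorph1 expr1n mulr1.
Unshelve. all: by end_near.
Qed.

Lemma binomial_has_sum (s w : C) : cabs w < 1 ->
  has_sum (fun k => binc s k * w ^+ k) (cpow (1 - w) s).
Proof.
move=> w1; have [B hB] := binomial_abs_sum s w1.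
have [t ht] := abs_sum_has_sum hB.
have -> // : cpow (1 - w) s = t.
exact: (cvg_unique _ (binomial_cvg (s := s) w1) (has_sum_cvg ht)).
Qed.

End Binomial.

(** * Power series in the ratios of the parameters *)

Section TupleSums.
Variable R : realType.

(** The powers of the weight bound every polynomial in the coordinates of r. *)
Definition weight n (r : n.-tuple nat) : R := \prod_(i < n) (tnth r i).+1%:R.
Definition total n (r : n.-tuple nat) : nat := \sum_(i < n) tnth r i.

Lemma weight_ge1 n (r : n.-tuple nat) : 1 <= weight r.
Proof.
rewrite /weight; elim/big_ind: _ => // [x y x1 y1|i _]; last by rewrite ler1n.
by rewrite -[1]mulr1 ler_pM.
Qed.

Lemma coord_le_weight n (r : n.-tuple nat) k : (nth 0%N r k).+1%:R <= weight r.
Proof.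
have [kn|kn] := ltnP k n; last by rewrite nth_default ?size_tuple // weight_ge1.
rewrite /weight (bigD1 (Ordinal kn)) //= (tnth_nth 0%N) /= ler_peMr //.
elim/big_ind: _ => // [x y x1 y1|i _]; last by rewrite ler1n.
by rewrite -[1]mulr1 ler_pM.
Qed.

(** The sum over a box factors into one-variable sums of polynomials times a
    geometric sequence. *)
Lemma tuple_abs_sum n (D : nat) (c q : R) (a : n.-tuple nat -> R) :
  0 <= c -> 0 <= q -> q < 1 ->
  (forall r, 0 <= a r <= c * (weight r ^+ D * q ^+ total r)) ->
  exists B, abs_sum a B.
Proof.
move=> c0 q0 q1 h.
pose r1 := (q + 1) / 2; pose s1 := (r1 + 1) / 2.
have r10 : 0 < r1 by rewrite /r1; lra.
have rs : r1 < s1 by rewrite /s1 /r1; lra.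
have s11 : s1 < 1 by rewrite /s1 /r1; lra.
have s10 : 0 <= s1 by apply/ltW/(lt_trans r10).
have [b b0 hb] := poly_geometric D r10 rs.
have b0' := ltW b0.
exists (c * (b / (1 - s1)) ^+ n) => l ul.
have a0 r : 0 <= a r by have /andP[] := h r.
pose B := (\max_(r <- l) total r).+1.
pose emb (f : {ffun 'I_n -> 'I_B}) : n.-tuple nat := [tuple val (f i) | i < n].
have sub : {subset l <= [seq emb f | f <- enum {ffun 'I_n -> 'I_B}]}.
  move=> r rl; have hr (i : 'I_n) : (tnth r i < B)%N.
    rewrite ltnS (big_rem r) //= leq_max; apply/orP; left.
    by rewrite /total (bigD1 i) //= leq_addr.
  apply/mapP; exists [ffun i => Ordinal (hr i)]; first by rewrite mem_enum.
  by apply: eq_from_tnth => i; rewrite tnth_mktuple ffunE.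
apply: (le_trans (ler_sum_sub a0 ul sub)).
rewrite big_map big_enum /=.
apply: (@le_trans _ _ (\sum_(f : {ffun 'I_n -> 'I_B}) c * \prod_(i < n) (b * s1 ^+ f i))).
  apply: ler_sum => f _; have /andP[_ /le_trans] := h (emb f); apply.
  rewrite ler_wpM2l // /weight /total -prodrXl expr_sum -big_split /=.
  apply: ler_prod => i _; rewrite tnth_mktuple mulr_ge0 ?exprn_ge0 //=.
  apply: le_trans (hb (f i)); rewrite ler_wpM2l ?exprn_ge0 //.
  by rewrite lerXn2r ?nnegrE ?(ltW r10) // /r1; lra.
rewrite -mulr_sumr ler_wpM2l //.
rewrite -(bigA_distr_bigA (fun (i : 'I_n) (k : 'I_B) => b * s1 ^+ k)) /=.
rewrite -[X in _ <= _ ^+ X](card_ord n) -prodr_const; apply: ler_prod => i _.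
rewrite sumr_ge0 ?mulr_ge0 //=; last by move=> k _; rewrite mulr_ge0 ?exprn_ge0.
by rewrite -mulr_sumr ler_wpM2l // geometric_sum_le.
Qed.

End TupleSums.

Section PowerSeries.
Variables (R : realType) (N : nat).
Local Notation C := R[i].
Local Notation M := {ffun 'I_N.-1 -> nat}.
Implicit Type lq : N.-tuple C.

Definition mono lq (m : M) : C := \prod_(i < N.-1) (qpar lq i / qpar lq i.+1) ^+ m i.

Definition zero_exp : M := [ffun=> 0%N].
Definition addM (m m' : M) : M := [ffun i => (m i + m' i)%N].

Lemma ratio_neq0 lq i j : qpar lq i / qpar lq j != 0.
Proof. by rewrite mulf_neq0 ?invr_neq0 // cexp_neq0. Qed.

Lemma mono_neq0 lq m : mono lq m != 0.
Proof. by apply/prodf_neq0 => i _; rewrite expf_neq0 // ratio_neq0. Qed.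

Lemma monoD lq m m' : mono lq (addM m m') = mono lq m * mono lq m'.
Proof. by rewrite /mono -big_split; apply: eq_bigr => i _; rewrite ffunE exprD. Qed.

(** The coefficients do not depend on lq. Absolute convergence on the whole
    domain is part of the notion, which makes it stable under products. *)
Definition power_series (F : N.-tuple C -> C) (c0 : C) : Prop :=
  exists c : M -> C, c zero_exp = c0 /\ forall lq, q_domain lq ->
    (exists B, abs_sum (fun m => cabs (c m * mono lq m)) B) /\
    has_sum (fun m => c m * mono lq m) (F lq).

(** The terms of an absolutely convergent family of monomials are regrouped
    by their exponents. The coefficients are sums over the fibres of p,
    independent of lq. *)
Lemma power_series_family (K : choiceType) (p : K -> M) (a : K -> C)
    (F : N.-tuple C -> C) (k0 : K) :
  (forall k, p k = zero_exp <-> k = k0) ->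
  (forall lq, q_domain lq ->
    (exists B, abs_sum (fun k => cabs (a k * mono lq (p k))) B) /\
    has_sum (fun k => a k * mono lq (p k)) (F lq)) ->
  power_series F (a k0).
Proof.
move=> pk h.
pose masked m k := if p k == m then a k else 0.
have h0 : has_sum (masked zero_exp) (a k0).
  move=> e e0; exists [:: k0] => l ul sub.
  have kl : k0 \in l by apply: sub; rewrite mem_head.
  rewrite (bigD1_seq k0) //= {1}/masked (pk k0).2 // eqxx big1 ?addr0 ?subrr ?cabs0 //.
  move=> k kk; rewrite /masked; case: eqP => // /pk k0E.
  by rewrite k0E eqxx in kk.
have [c hc] : exists c : M -> C, c zero_exp = a k0 /\
    forall m, (exists s, has_sum (masked m) s) -> has_sum (masked m) (c m).
  have hs m : exists s, (exists s, has_sum (masked m) s) -> has_sum (masked m) s.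
    by have [[s hs]|ns] := pselect (exists s, has_sum (masked m) s);
      [exists s | exists 0 => /ns].
  have [c hc] := choice hs; exists c; split=> //.
  exact: has_sum_unique (hc zero_exp (ex_intro _ _ h0)) h0.
exists c; split; first by case: hc.
move=> lq qd; have [[B hB] hF] := h lq qd.
have hm m : has_sum (fun k => if p k == m then a k * mono lq (p k) else 0) (c m * mono lq m).
  have [s hs] : exists s, has_sum (fun k => if p k == m then a k * mono lq (p k) else 0) s.
    apply: (@abs_sum_has_sum _ _ _ B) => l ul; apply: le_trans (hB l ul).
    by apply: ler_sum => k _; case: eqP => // _; rewrite cabs0 cabs_ge0.
  have hms : has_sum (masked m) ((mono lq m)^-1 * s).
    apply: eq_has_sum (has_sumZ (mono lq m)^-1 hs) => k; rewrite /masked.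
    case: eqP => [->|_]; last by rewrite mulr0.
    by rewrite mulrC mulfK ?mono_neq0.
  have hcm := hc.2 m (ex_intro _ _ hms).
  have -> : c m * mono lq m = mono lq m * c m by rewrite mulrC.
  apply: eq_has_sum (has_sumZ (mono lq m) hcm) => k; rewrite /masked.
  by case: eqP => [->|_]; rewrite ?mulr0 // mulrC.
split; last exact: regroup_has_sum hF hm.
exists B; exact: regroup_abs hB hm.
Qed.

Lemma power_seriesM F G c0 d0 : power_series F c0 -> power_series G d0 ->
  power_series (fun lq => F lq * G lq) (c0 * d0).
Proof.
move=> [c [<- hc]] [d [<- hd]].
apply: (@power_series_family _ (fun k : M * M => addM k.1 k.2)
  (fun k => c k.1 * d k.2) _ (zero_exp, zero_exp)).
- move=> [m m'] /=; split=> [/ffunP h|[-> ->]]; last first.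
    by apply/ffunP => i; rewrite !ffunE.
  congr (_, _); apply/ffunP => i; have := h i; rewrite !ffunE => /eqP.
    by rewrite addn_eq0 => /andP[/eqP].
  by rewrite addn_eq0 => /andP[_ /eqP].
- move=> lq qd; have [[A hA] hF] := hc lq qd; have [[B hB] hG] := hd lq qd.
  have e (k : M * M) : c k.1 * mono lq k.1 * (d k.2 * mono lq k.2) =
      c k.1 * d k.2 * mono lq (addM k.1 k.2) by rewrite monoD; ring.
  split; last exact: eq_has_sum e (product_has_sum hA hB hF hG).
  exists (A * B) => l ul; have := product_abs hA hB ul.
  by under eq_bigr do rewrite e.
Qed.

Lemma power_series_cst (c0 : C) : power_series (fun=> c0) c0.
Proof.
apply: (@power_series_family unit (fun=> zero_exp) (fun=> c0) _ tt); first by move=> [].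
have hl (V : zmodType) (l : seq unit) (v : V) : uniq l -> {subset [:: tt] <= l} -> \sum_(k <- l) v = v.
  move=> ul sub; have -> : l = [:: tt].
    apply: perm_small_eq => //; apply: uniq_perm => // -[]; rewrite mem_head.
    by apply: sub; rewrite mem_head.
  by rewrite big_seq1.
move=> lq _.
have -> : mono lq zero_exp = 1 by rewrite /mono big1 // => i _; rewrite ffunE expr0.
rewrite mulr1; split; last by move=> e e0; exists [:: tt] => l ul sub; rewrite hl // subrr cabs0.
by exists (cabs c0) => -[|[] [|[] l]] //= _; rewrite ?big_nil ?big_seq1 ?cabs_ge0.
Qed.

Lemma power_series_prod (J : Type) (s : seq J) (P : pred J) F (c : J -> C) :
  (forall j, P j -> power_series (F j) (c j)) ->
  power_series (fun lq => \prod_(j <- s | P j) F j lq) (\prod_(j <- s | P j) c j).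
Proof.
move=> h; elim: s => [|j s IH].
  rewrite big_nil; have -> : (fun lq => \prod_(j <- [::] | P j) F j lq) = fun=> 1.
    by apply/funext => lq; rewrite big_nil.
  exact: power_series_cst.
rewrite big_cons.
have -> : (fun lq => \prod_(j <- j :: s | P j) F j lq) =
   (fun lq => if P j then F j lq * \prod_(j <- s | P j) F j lq else \prod_(j <- s | P j) F j lq).
  by apply/funext => lq; rewrite big_cons.
by case Pj: (P j) => //; apply: power_seriesM => //; exact: h.
Qed.

Lemma qpar_ratio lq (i j : 'I_N) : (i < j)%N ->
  qpar lq i / qpar lq j =
  \prod_(l < N.-1 | (i <= l < j)%N) (qpar lq l / qpar lq l.+1).
Proof.
move=> ij; have h : (j <= N.-1)%N by have := ltn_ord j; lia.
rewrite -(big_mkord (fun l => (i <= l < j)%N) (fun l => qpar lq l / qpar lq l.+1)).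
have -> : \prod_(0 <= l < N.-1 | (i <= l < j)%N) (qpar lq l / qpar lq l.+1) =
   \prod_(i <= l < j) (qpar lq l / qpar lq l.+1).
  rewrite (@big_cat_nat _ _ _ i) ?leq0n //=; last by lia.
  rewrite [X in X * _ = _]big1_seq; last first.
    by move=> l /andP[/andP[il _]]; rewrite mem_index_iota => /andP[_]; rewrite ltnNge il.
  rewrite mul1r (@big_cat_nat _ _ _ j) //=; last by lia.
  rewrite [X in _ * X = _]big1_seq; last first.
    by move=> l /andP[/andP[_ lj]]; rewrite mem_index_iota => /andP[jl _]; lia.
  rewrite mulr1 big_nat_cond [RHS]big_nat_cond; apply: eq_bigl => l.
  by case: (i <= l < j)%N.
have qn0 k : qpar lq k != 0 by exact: cexp_neq0.
elim: (val j) {h} ij => // k IH; rewrite ltnS leq_eqVlt => /predU1P[->|ik].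
  by rewrite big_nat1.
by rewrite big_nat_recr ?(ltnW ik) //= -IH // mulrA mulfVK.
Qed.

Lemma qpar_ratio_lt1 lq (i j : 'I_N) : q_domain lq -> (i < j)%N ->
  cabs (qpar lq i / qpar lq j) < 1.
Proof.
move=> qd ij.
have q1 l : (l < N.-1)%N -> cabs (qpar lq l / qpar lq l.+1) < 1.
  by move=> hl; have := qd (Ordinal hl); rewrite cabsE -[1]/((1 : R)%:C) ltcR.
have qn0 k : qpar lq k != 0 by exact: cexp_neq0.
have hj : (j <= N.-1)%N by have := ltn_ord j; lia.
elim: (val j) hj ij => // k IH hk; rewrite ltnS leq_eqVlt => /predU1P[->|ik].
  exact: q1.
have -> : qpar lq i / qpar lq k.+1 = (qpar lq i / qpar lq k) * (qpar lq k / qpar lq k.+1).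
  by rewrite mulrA mulfVK.
have h1 := IH (ltnW hk) ik; have h2 := q1 k hk.
by rewrite cabsM mulr_ilt1 ?cabs_ge0.
Qed.

(** A ratio q_i / q_j is the product of consecutive ratios, so the powers of
    this monomial occur in the binomial series. *)
Lemma power_series_binomial (s : C) (i j : 'I_N) : (i < j)%N ->
  power_series (fun lq => cpow (1 - qpar lq i / qpar lq j) s) 1.
Proof.
move=> ij; rewrite -[1 in X in power_series _ X](binc0 s).
have h : (i < N.-1)%N by have := ltn_ord j; lia.
pose p (k : nat) : M := [ffun l : 'I_N.-1 => if (i <= l < j)%N then k else 0%N].
apply: (@power_series_family nat p (binc s) _ 0%N).
- move=> k; split=> [/ffunP/(_ (Ordinal h))|->]; first by rewrite !ffunE /= leqnn ij.
  by apply/ffunP => l; rewrite !ffunE; case: ifP.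
- move=> lq qd.
  have e k : binc s k * (qpar lq i / qpar lq j) ^+ k = binc s k * mono lq (p k).
    congr (_ * _); rewrite qpar_ratio // /mono -prodrXl [LHS]big_mkcond.
    by apply: eq_bigr => l _; rewrite ffunE; case: ifP => // _; rewrite expr0.
  have w1 := qpar_ratio_lt1 qd ij.
  split; last exact: eq_has_sum e (binomial_has_sum s w1).
  have [B hB] := binomial_abs_sum s w1; exists B => l ul.
  by have := hB l ul; under eq_bigr do rewrite e.
Qed.

End PowerSeries.

(** * Initial unions of the blocks of an ordered partition *)

Lemma psum0 (N : nat) (lam : N.-tuple nat) : psum lam 0 = 0%N.
Proof. by rewrite /psum big_ord0. Qed.

Lemma psumS (N : nat) (lam : N.-tuple nat) j :
  psum lam j.+1 = (psum lam j + part lam j)%N.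
Proof. by rewrite /psum big_ord_recr. Qed.

Section Positions.
Variables (N : nat) (lam : N.-tuple nat).
Variables (I : 'I_N -> {set 'I_(psum lam N)}) (IP : ordered_partition I).
Local Notation n := (psum lam N).
Variable x0 : 'I_n.

Lemma blocks_uptoS j (jN : (j < N)%N) :
  blocks_upto I j.+1 = blocks_upto I j :|: I (Ordinal jN).
Proof.
rewrite /blocks_upto (bigD1 (Ordinal jN)) //= finset.setUC; congr (_ :|: _).
apply: eq_bigl => i; rewrite ltnS leq_eqVlt -val_eqE /=.
by case: ltngtP.
Qed.

Lemma mem_blocks_upto j x :
  (x \in blocks_upto I j) = [exists i : 'I_N, (i < j)%N && (x \in I i)].
Proof.
apply/bigcupP/existsP => [[i ij xi]|[i /andP[ij xi]]]; exists i => //.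
by rewrite ij.
Qed.

Lemma block_unique i k x : x \in I i -> x \in I k -> i = k.
Proof.
have [dis _ _] := IP.
move=> xi xk; apply/eqP/negPn/negP => /dis /setP/(_ x).
by rewrite !inE xi xk.
Qed.

Lemma card_blocks_upto j : (j <= N)%N -> #|blocks_upto I j| = psum lam j.
Proof.
have [dis _ crd] := IP.
elim: j => [|j IH] jN.
  have -> : blocks_upto I 0 = finset.set0 by rewrite /blocks_upto big_pred0.
  by rewrite finset.cards0 psum0.
rewrite blocks_uptoS cardsU (IH (ltnW jN)) crd [RHS]psumS.
have -> : blocks_upto I j :&: I (Ordinal jN) = finset.set0.
  apply/setP => x; rewrite !inE; apply/negP => /andP[]; rewrite mem_blocks_upto.
  move=> /existsP[i /andP[ij xi]] xj.
  by move: ij; rewrite (block_unique xi xj) /= ltnn.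
by rewrite finset.cards0 subn0.
Qed.

Lemma blocks_upto_all : blocks_upto I N = [set: 'I_n]%SET.
Proof.
have [_ cov _] := IP; rewrite -cov /blocks_upto; apply: eq_bigl => i; exact: ltn_ord.
Qed.

(** The index of the z at the coordinate t^(j)_a of Sigma_I. *)
Definition bnth j (a : 'I_(psum lam j)) : 'I_n := nth x0 (enum (blocks_upto I j)) a.

Lemma size_blocks_upto j : (j <= N)%N -> size (enum (blocks_upto I j)) = psum lam j.
Proof. by move=> jN; rewrite -cardE card_blocks_upto. Qed.

Lemma bnth_inj j : (j <= N)%N -> injective (@bnth j).
Proof.
move=> jN a b /eqP; rewrite nth_uniq ?size_blocks_upto ?enum_uniq //.
by move=> /eqP/val_inj.
Qed.

Lemma bnth_mem j (a : 'I_(psum lam j)) : (j <= N)%N -> bnth a \in blocks_upto I j.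
Proof. by move=> jN; rewrite -mem_enum mem_nth // size_blocks_upto. Qed.

Lemma bnth_surj j x : (j <= N)%N -> x \in blocks_upto I j ->
  exists a : 'I_(psum lam j), bnth a = x.
Proof.
move=> jN; rewrite -mem_enum => xB.
have h : (index x (enum (blocks_upto I j)) < psum lam j)%N.
  by rewrite -(size_blocks_upto jN) index_mem.
by exists (Ordinal h); rewrite /bnth nth_index.
Qed.

Lemma bnthN (a : 'I_n) : bnth a = a.
Proof.
rewrite /bnth blocks_upto_all; apply: val_inj.
rewrite (_ : enum [set: 'I_n]%SET = enum 'I_n) ?nth_ord_enum //.
by apply: eq_enum => x; rewrite !inE.
Qed.

Lemma big_bnth (T : Type) (idx : T) (op : Monoid.com_law idx) j (F : 'I_n -> T) :
  (j <= N)%N ->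
  \big[op/idx]_(a < psum lam j) F (bnth a) = \big[op/idx]_(x in blocks_upto I j) F x.
Proof.
move=> jN; rewrite -[RHS]big_enum (big_nth x0) size_blocks_upto // big_mkord.
by [].
Qed.

Lemma parent_exists j (a : 'I_(psum lam j)) : (j < N)%N ->
  exists c : 'I_(psum lam j.+1), bnth c = bnth a.
Proof.
move=> jN; apply: bnth_surj => //; rewrite (blocks_uptoS jN) inE bnth_mem //; exact: ltnW.
Qed.

(** The variable of the next level based at the same z. *)
Definition parent j (a : 'I_(psum lam j)) : option 'I_(psum lam j.+1) :=
  [pick c | bnth c == bnth a].

Lemma parentP j (a : 'I_(psum lam j)) : (j < N)%N ->
  exists2 c, parent a = Some c & bnth c = bnth a.
Proof.
move=> jN; rewrite /parent; case: pickP => [c /eqP|h]; first by exists c.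
by have [c hc] := parent_exists a jN; have := h c; rewrite hc eqxx.
Qed.

End Positions.

(** * The gamma factors of the master function *)

Section Integers.
Variable R : realType.
Local Notation C := R[i].
Implicit Types (x y h : C) (d : R).

Definition notint x := forall k : int, x != k%:~R.
Definition away d x := forall k : int, d <= cabs (x - k%:~R).

Lemma away_notint d x : 0 < d -> away d x -> notint x.
Proof.
by move=> d0 h k; rewrite -subr_eq0 -cabs_gt0; apply: lt_le_trans (h k).
Qed.

Lemma away_le d d' x : d' <= d -> away d x -> away d' x.
Proof. by move=> dd h k; apply: le_trans (h k). Qed.

Lemma away_shift d x (k : int) : away d x -> away d (x + k%:~R).
Proof.
move=> h l; have -> : x + k%:~R - l%:~R = x - (l - k)%:~R by rewrite intrB; ring.
exact: h.
Qed.

Lemma notint_shift x (k : int) : notint x -> notint (x + k%:~R).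
Proof.
move=> h l; apply: contra (h (l - k)) => /eqP e; apply/eqP.
by rewrite intrB -e; ring.
Qed.

Lemma notintN x : notint x -> notint (- x).
Proof.
move=> h k; apply: contra (h (- k)) => /eqP e; apply/eqP.
by rewrite intrN -e opprK.
Qed.

Lemma away_near d x y e : away d x -> cabs (y - x) < e -> away (d - e) y.
Proof.
move=> h yx k; have -> : y - k%:~R = (x - k%:~R) - (x - y) by ring.
by apply: le_trans (lerB_cabs _ _); have := h k; rewrite (cabsB x y); lra.
Qed.

Lemma cabs_int (k : int) : cabs (k%:~R : C) = `|k|%:~R.
Proof.
have -> : (k%:~R : C) = (k%:~R : R)%:C by rewrite rmorph_int.
by rewrite cabsR -intr_norm.
Qed.

(** The integers form a closed discrete set. *)
Lemma notint_away x : notint x -> exists2 d, 0 < d & away d x.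
Proof.
move=> hx; case: (eqVneq (complex.Im x) 0) => [x0|x0]; last first.
  exists `|complex.Im x|; first by rewrite normr_gt0.
  move=> k; apply: le_trans (Im_le_cabs _).
  have -> : (k%:~R : C) = (k%:~R : R)%:C by rewrite rmorph_int.
  by rewrite raddfB /= subr0.
set a := complex.Re x.
have xE : x = a%:C by rewrite [x]complexE x0 /= rmorph0 mulr0 addr0.
pose f := Num.floor a.
have h1 : f%:~R <= a by exact: floor_le_tmp.
have h2 : a < (f + 1)%:~R by exact: floorD1_gt.
have ha : f%:~R != a.
  by apply: contra (hx f) => /eqP e; rewrite xE -e rmorph_int.
exists (Num.min (a - f%:~R) ((f + 1)%:~R - a)).
  by rewrite lt_min !subr_gt0 h2 lt_def eq_sym ha h1.
move=> k; have -> : x - k%:~R = (a - k%:~R)%:C by rewrite xE rmorphB /= rmorph_int.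
rewrite cabsR ge_min; have [kf|kf] := lerP k f.
- have : (k%:~R : R) <= f%:~R by rewrite ler_int.
  by move=> h; apply/orP; left; apply: le_trans (ler_norm _); lra.
- have : ((f + 1)%:~R : R) <= k%:~R by rewrite ler_int lezD1.
  by move=> h; apply/orP; right; rewrite distrC; apply: le_trans (ler_norm _); lra.
Qed.

Lemma notint_away_fin (J : finType) (x : J -> C) : (forall i, notint (x i)) ->
  exists2 d, 0 < d & forall i, away d (x i).
Proof.
move=> hx; have h i : exists d, 0 < d /\ away d (x i).
  by have [d d0 hd] := notint_away (hx i); exists d.
have [D hD] := choice h.
exists (\big[Num.min/1]_i D i).
  by elim/big_ind: _ => // [u v u0 v0|i _]; [rewrite lt_min u0 | have [] := hD i].
move=> i; apply: away_le (hD i).2.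
by rewrite (bigD1 i) //= ge_min lexx.
Qed.

Lemma notint_nopole x : notint x -> nopole x.
Proof.
move=> hx k; apply: contra (hx (- k%:Z)) => /eqP e; apply/eqP.
by rewrite intrN; apply/eqP; rewrite -subr_eq0 opprK; apply/eqP.
Qed.

(** The function phi for the step -1; its value at t - t' is the factor of
    two variables of adjacent levels. *)
Definition gpair h x := cGamma (- x) * cGamma (x - h).

Lemma phiE h x : phi h (-1) x = gpair h x.
Proof. by rewrite /phi /gpair invrN1 mulrN1 mulrN1 opprB. Qed.

Lemma gpair_neq0 h x : notint x -> notint (x - h) -> gpair h x != 0.
Proof.
by move=> h1 h2; rewrite mulf_neq0 // cGamma_neq0 //; apply: notint_nopole => //;
  exact: notintN.
Qed.

Lemma gpair_cont h x : notint x -> notint (x - h) -> {for x, continuous (gpair h)}.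
Proof.
move=> h1 h2; apply: contM.
  apply: cont_comp; first by apply: contN; exact: cont_id.
  by apply/continuous_cGamma/notint_nopole/notintN.
apply: cont_comp; first by apply: contB; [exact: cont_id | exact: cont_cst].
by apply/continuous_cGamma/notint_nopole.
Qed.

Lemma gpair_cont_h h x : notint x -> notint (x - h) -> {for h, continuous (fun h => gpair h x)}.
Proof.
move=> h1 h2; apply: contM; first exact: cont_cst.
apply: cont_comp; first by apply: contB; [exact: cont_cst | exact: cont_id].
by apply/continuous_cGamma/notint_nopole.
Qed.

(** The arguments of the two gamma functions move in opposite directions, so the
    coefficient of the recurrence is a quotient of two linear functions. *)
Lemma gpairS h x : notint x -> notint (x - h) ->
  gpair h (x + 1) * (x + 1) = - (x - h) * gpair h x.
Proof.
move=> h1 h2; rewrite /gpair.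
have -> : x + 1 - h = (x - h) + 1 by ring.
rewrite cGammaS; last exact: notint_nopole.
have e : cGamma (- x) = (- (x + 1)) * cGamma (- (x + 1)).
  rewrite -cGammaS; first by congr cGamma; ring.
  by apply/notint_nopole/notintN/(@notint_shift _ 1).
rewrite e; ring.
Qed.

(** The residue at x = k of gpair h is -(-1)^k binc h k times Gamma(-h). *)
Definition pole_coef h (m m' : nat) : C :=
  if (m' <= m)%N then - (-1) ^+ (m - m') * binc h (m - m') else 0.

(** The numerator of the gamma factors at their pole y = m - m'. The first
    case writes out Gamma(-y) by the functional equation; in the second case
    Gamma(-y) is regular at the negative integer m - m', and the numerator
    vanishes there. *)
Definition pole_num h (m m' : nat) (y : C) : C :=
  if (m' <= m)%N then
    - (cGamma ((m - m').+1%:R - y) * cGamma (y - h)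
       / \prod_(i < m - m') (i%:R - y))
  else gpair h y * (y - (m%:R - m'%:R)).

Lemma pole_num_value h m m' : notint h ->
  pole_num h m m' (m%:R - m'%:R) = cGamma (- h) * pole_coef h m m'.
Proof.
move=> hh; rewrite /pole_num /pole_coef; case: leqP => [mm|_]; last by rewrite subrr !mulr0.
rewrite -natrB //; set k := (m - m')%N.
rewrite -natr1 [_ + 1]addrC addrK cGamma1 mul1r.
have gk : cGamma (k%:R - h) = (\prod_(i < k) (i%:R - h)) * cGamma (- h).
  elim: k => [|k IH]; first by rewrite big_ord0 mul1r sub0r.
  rewrite big_ord_recr /= -natr1.
  have -> : k%:R + 1 - h = (k%:R - h) + 1 by ring.
  rewrite cGammaS ?IH; first by ring.
  apply: notint_nopole; rewrite addrC; exact: (notint_shift k (notintN hh)).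
have pk : \prod_(i < k) (i%:R - k%:R) = (-1) ^+ k * \prod_(i < k) i.+1%:R :> C.
  rewrite (reindex_inj rev_ord_inj) /=.
  have -> : (-1) ^+ k = \prod_(i < k) (-1 : C) by rewrite prodr_const card_ord.
  rewrite -big_split /=; apply: eq_bigr => i _.
  by rewrite natrB ?ltn_ord //; ring.
rewrite gk pk /binc big_split /= prodfV invfM.
have -> : ((-1) ^+ k)^-1 = (-1) ^+ k :> C by rewrite -exprVn invrN1.
ring.
Qed.

Lemma notint_near_int (k : int) y : cabs (y - k%:~R) < 2^-1 -> y != k%:~R -> notint y.
Proof.
move=> yk ynk l; have [->//|kl] := eqVneq l k.
rewrite -subr_eq0 -cabs_gt0.
have -> : y - l%:~R = (k - l)%:~R - (k%:~R - y) by rewrite intrB; ring.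
apply: lt_le_trans (lerB_cabs _ _); rewrite cabs_int (cabsB _ y).
have : 1 <= `|k - l|%:~R :> R by rewrite ler1z -gtz0_ge1 normr_gt0 subr_eq0 eq_sym.
lra.
Qed.

Lemma cGammaD_nat x k : nopole x ->
  cGamma (x + k%:R) = cGamma x * \prod_(i < k) (i%:R + x).
Proof.
move=> hx; elim: k => [|k IH]; first by rewrite big_ord0 addr0 mulr1.
rewrite big_ord_recr /= -natr1 addrA cGammaS ?IH; first by ring.
by move=> j; rewrite -addrA -natrD.
Qed.

Section Chi.
Variables (h : C) (m m' : nat) (y : C).
Hypothesis yk : cabs (y - (m%:R - m'%:R)) < 2^-1.
Hypothesis yh : notint (y - h).

Lemma far_from_kappa (x : C) : 1 <= cabs (x - (m%:R - m'%:R)) -> x - y != 0.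
Proof.
move=> h1; rewrite -cabs_gt0.
have -> : x - y = (x - (m%:R - m'%:R)) - (y - (m%:R - m'%:R)) by ring.
apply: lt_le_trans (lerB_cabs _ _); rewrite subr_gt0.
by apply: lt_le_trans yk (le_trans _ h1); lra.
Qed.

Lemma pole_num_cont : {for y, continuous (pole_num h m m')}.
Proof.
have [mm|mm] := leqP m' m.
- have kE : m%:R - m'%:R = (m - m')%:R :> C by rewrite natrB.
  rewrite /pole_num mm; set k := (m - m')%N in kE *.
  apply: contN; apply: contM; first apply: contM.
  + apply: cont_comp; first by apply: contB; [exact: cont_cst | exact: cont_id].
    apply: continuous_cGamma => j; rewrite addrAC; apply: far_from_kappa.
    by rewrite kE -natrD -natrB ?cabs_nat ?ler1n; lia.
  + apply: cont_comp; first by apply: contB; [exact: cont_id | exact: cont_cst].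
    by apply/continuous_cGamma/notint_nopole.
  + apply: contV.
      apply/prodf_neq0 => i _; apply: far_from_kappa.
      by rewrite kE cabsB -natrB ?cabs_nat ?ler1n ?subn_gt0 // ltnW.
    by apply: cont_prod => i _; apply: contB; [exact: cont_cst | exact: cont_id].
- rewrite /pole_num leqNgt mm /=; apply: contM; last first.
    by apply: contB; [exact: cont_id | exact: cont_cst].
  apply: contM; last first.
    apply: cont_comp; first by apply: contB; [exact: cont_id | exact: cont_cst].
    by apply/continuous_cGamma/notint_nopole.
  apply: cont_comp; first by apply: contN; exact: cont_id.
  apply: continuous_cGamma => j; rewrite addrC; apply: far_from_kappa.
  have -> : j%:R - (m%:R - m'%:R) = (j + (m' - m))%:R :> C.
    by rewrite natrD natrB ?(ltnW mm) //; ring.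
  by rewrite cabs_nat ler1n; lia.
Qed.

Hypothesis yk0 : 0 < cabs (y - (m%:R - m'%:R)).

Lemma near_kappa_notint : notint y.
Proof.
have e : m%:R - m'%:R = (m%:Z - m'%:Z)%:~R :> C by rewrite intrB.
by apply: (@notint_near_int (m%:Z - m'%:Z)); rewrite -e // -subr_eq0 -cabs_gt0.
Qed.

Lemma pole_numE : gpair h y = pole_num h m m' y / (y - (m%:R - m'%:R)).
Proof.
have y0 : y - (m%:R - m'%:R) != 0 by rewrite -cabs_gt0.
have [mm|mm] := leqP m' m; last by rewrite /pole_num leqNgt mm /= mulfK.
have kE : m%:R - m'%:R = (m - m')%:R :> C by rewrite natrB.
have np : nopole (- y) by apply/notint_nopole/notintN/near_kappa_notint.
rewrite /pole_num mm kE in y0 *; set k := (m - m')%N in y0 *.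
have -> : k.+1%:R - y = - y + k.+1%:R by ring.
rewrite cGammaD_nat // big_ord_recr /= /gpair.
have p0 : \prod_(i < k) (i%:R - y) != 0.
  by apply/prodf_neq0 => i _; have := np i; rewrite addrC.
by field; rewrite p0 y0.
Qed.

End Chi.
End Integers.

(** * Iterated residues of the master function *)

Section IntegrationVariables.
Variables (N : nat) (lam : N.-tuple nat).
Local Notation V := {j : nat & 'I_(psum lam j)}.
Local Notation tag_ := (Tagged (fun j => 'I_(psum lam j))).

Lemma mem_tvars (v : V) : (v \in tvars lam) = (1 <= tag v < N)%N.
Proof.
apply/allpairsPdep/idP => [[j [a [jN _ ->]]] /=|vN].
  by move: jN; rewrite mem_iota; lia.
exists (tag v), (tagged v); split; rewrite ?mem_enum //; last by case: v {vN}.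
by rewrite mem_iota; lia.
Qed.

Lemma tvars_uniq : uniq (tvars lam).
Proof.
apply: allpairs_uniq_dep => [|j _|]; [exact: iota_uniq|exact: enum_uniq|].
by move=> /= [i a] [j b] _ _ /= [].
Qed.

Lemma big_tvars (T : Type) (idx : T) (op : Monoid.com_law idx) (F : V -> T) :
  \big[op/idx]_(v <- tvars lam) F v =
  \big[op/idx]_(1 <= j < N) \big[op/idx]_(a < psum lam j) F (tag_ a).
Proof.
rewrite /tvars big_allpairs_dep /index_iota subn1.
by apply: eq_bigr => j _; rewrite big_enum.
Qed.

Lemma tvars_order pre v post u : tvars lam = pre ++ v :: post ->
  u \in pre -> (tag u <= tag v)%N.
Proof.
have h : pairwise (fun u w : V => (tag u <= tag w)%N) (tvars lam).
  rewrite /tvars; elim: (N.-1) (1%N) => [|k IH] i //=.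
  rewrite pairwise_cat IH andbT; apply/andP; split.
    apply/allrelP => x y /mapP[a _ ->] /allpairsPdep[j [b [jk _ ->]]] /=.
    by move: jk; rewrite mem_iota; lia.
  elim: (enum _) => //= a l ->; rewrite andbT all_map.
  by apply/allP => b _ /=.
move=> E; move: h; rewrite E pairwise_cat => /and3P[/allrelP h _ _] up.
by apply: h up _; rewrite mem_head.
Qed.

Lemma size_tvars : size (tvars lam) = nvars lam.
Proof.
rewrite -sum1_size (big_tvars _ (fun=> 1%N)) /nvars; apply: eq_bigr => j _.
by rewrite sum1_card card_ord.
Qed.

End IntegrationVariables.

Lemma cont_prod_in (R : realType) (T : topologicalType) (J : eqType) (s : seq J)
    (P : pred J) (F : J -> T -> R[i]) (x : T) :
  (forall i, i \in s -> P i -> {for x, continuous (F i)}) ->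
  {for x, continuous (fun y => \prod_(i <- s | P i) F i y)}.
Proof.
move=> h; apply: (@cont_eq R T (fun y => \prod_(i <- s | (i \in s) && P i) F i y)).
  by move=> y; rewrite [RHS]big_seq_cond.
by apply: cont_prod => i /andP[si Pi]; exact: h.
Qed.

Section PhiResidue.
Variables (R : realType) (N : nat) (lam : N.-tuple nat).
Local Notation C := R[i].
Local Notation n := (psum lam N).
Local Notation V := {j : nat & 'I_(psum lam j)}.
Local Notation tag_ := (Tagged (fun j => 'I_(psum lam j))).
Variables (I : 'I_N -> {set 'I_n}) (IP : ordered_partition I) (x0 : 'I_n).
Variables (z : 'I_n -> C) (N_gt0 : (0 < N)%N).

Local Notation bnth := (bnth I x0).
Local Notation parent := (parent I x0).

(** The coordinate r^(j)_a of the shift. *)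
Definition shift_ (r : (nvars lam).-tuple nat) j (a : 'I_(psum lam j)) : nat :=
  nth 0%N r (\sum_(1 <= k < j) psum lam k + a).

Lemma Sigma_shiftE r j (a : 'I_(psum lam j)) : (j <= N)%N ->
  Sigma_shift I z 1 r a = z (bnth a) + (shift_ r a)%:R.
Proof.
by move=> jN; rewrite /Sigma_shift mulr1 (nth_map x0) // size_blocks_upto.
Qed.

Lemma shiftN r (a : 'I_n) : shift_ r a = 0%N.
Proof. by rewrite /shift_ nth_default // size_tuple /nvars leq_addr. Qed.

Lemma Sigma_shiftN r (a : 'I_n) : Sigma_shift I z 1 r a = z a.
Proof. by rewrite Sigma_shiftE // shiftN addr0 bnthN. Qed.

(** The default value v is only met at the top level. *)
Definition par (v : V) : V :=
  if parent (tagged v) is Some c then tag_ c else v.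

Lemma par_some j (a : 'I_(psum lam j)) : (j < N)%N ->
  exists2 c, parent a = Some c & par (tag_ a) = tag_ c /\ bnth c = bnth a.
Proof.
by move=> jN; have [c pc zc] := parentP IP x0 a jN; exists c; rewrite // /par /= pc.
Qed.

(** The exponential part of the master function, and what remains of it after
    removing the factors that have a pole at the point of evaluation. *)
Definition expo (lq : N.-tuple C) (t : tfam R lam) : C :=
  twpow (n%:Z - (part lam N.-1)%:Z) lq`_N.-1 ((\sum_a z a) / -1)
  * (\prod_(1 <= j < N)
       twpow ((part lam j)%:Z - (part lam j.-1)%:Z) (lq`_j.-1 - lq`_j)
             ((\sum_(a < psum lam j) t j a) / -1)).

Definition regular (h : C) (t : tfam R lam) : C :=
  \prod_(1 <= j < N) \prod_(a < psum lam j)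
    ((\prod_(b < psum lam j | b != a)
        ((t j a - t j b - h) * gpair h (t j a - t j b))^-1)
     * (\prod_(c < psum lam j.+1 | Some c != parent a) gpair h (t j a - t j.+1 c))).

Lemma Phi_split h lq (t : tfam R lam) : (forall a : 'I_n, t N a = z a) ->
  Phi z h lq (-1) t = expo lq t * regular h t *
    \prod_(v <- tvars lam) gpair h (tget t v - tget t (par v)).
Proof.
move=> tN; rewrite /Phi.
have -> : set_level t z = t.
  apply: tfam_ext => -[j a]; rewrite /tget /set_level /=.
  have [jN|jN] := eqVneq N j; last by rewrite dfwithout.
  by subst j; rewrite dfwithin.
rewrite -/(expo lq t) -mulrA; congr (_ * _).
rewrite big_tvars /regular -big_split /=; apply: eq_big_nat => j /andP[j1 jN].
rewrite -big_split /=; apply: eq_bigr => a _; rewrite -mulrA; congr (_ * _).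
  by apply: eq_bigr => b _; rewrite phiE.
have [c pc [-> _]] := par_some a jN.
rewrite (bigD1 c) //= mulrC phiE; congr (_ * _).
rewrite pc; apply: eq_big => [k|k _]; last by rewrite phiE.
by [].
Qed.

Lemma cont_tget (t : tfam R lam) (v u : V) (x : C) :
  {for x, continuous (fun x => tget (set_var t (tagged v) x) u)}.
Proof.
have [uv|uv] := eqVneq u v.
  by apply: cont_eq (@cont_id _ x) => y; rewrite tget_set_var uv eqxx.
by apply: cont_eq (@cont_cst _ _ (tget t u) x) => y; rewrite tget_set_var (negPf uv).
Qed.

Variable h : C.
Hypothesis hh : notint h.
Hypothesis hz : forall a b, a != b -> notint (z a - z b).
Hypothesis hzh : forall a b, a != b -> notint (z a - z b - h).

(** A radius for which all the differences met during the iterated residue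
    stay away from the poles. The factor 2 accounts for both variables
    moving. *)
Lemma separation : exists d : R, [/\ 0 < d, d < 2^-1, away d h,
   (forall a b, a != b -> away (2 * d) (z a - z b)) &
   (forall a b, a != b -> away (2 * d) (z a - z b - h))].
Proof.
pose J := {ab : 'I_n * 'I_n | ab.1 != ab.2}.
have [d1 d10 h1] := notint_away_fin (fun ab : J => hz (valP ab)).
have [d2 d20 h2] := notint_away_fin (fun ab : J => hzh (valP ab)).
have [d3 d30 h3] := notint_away hh.
exists (Num.min (Num.min (d1 / 2) (d2 / 2)) (Num.min d3 (3^-1))); split.
- by rewrite !lt_min; apply/andP; split; apply/andP; split; lra.
- by rewrite !gt_min; apply/orP; right; apply/orP; right; lra.
- by apply: away_le h3; rewrite !ge_min lexx /= orbT.
- move=> a b ab; apply: away_le (h1 (exist _ (a, b) ab)).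
  by rewrite mulrC -ler_pdivlMr // !ge_min lexx.
- move=> a b ab; apply: away_le (h2 (exist _ (a, b) ab)).
  by rewrite mulrC -ler_pdivlMr // !ge_min lexx /= orbT.
Qed.

Lemma diff_notint (r : (nvars lam).-tuple nat) d (t : tfam R lam) (u w : V) :
  0 < d ->
  (forall a b, a != b -> away (2 * d) (z a - z b)) ->
  (forall a b, a != b -> away (2 * d) (z a - z b - h)) ->
  (tag u <= N)%N -> (tag w <= N)%N -> bnth (tagged u) != bnth (tagged w) ->
  cabs (tget t u - tget (Sigma_shift I z 1 r) u) < d ->
  cabs (tget t w - tget (Sigma_shift I z 1 r) w) < d ->
  notint (tget t u - tget t w) /\ notint (tget t u - tget t w - h).
Proof.
move=> d0 a1 a2 uN wN uw.
set su := tget (Sigma_shift I z 1 r) u; set sw := tget (Sigma_shift I z 1 r) w => tu tw.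
have e : su - sw = z (bnth (tagged u)) - z (bnth (tagged w)) +
    ((shift_ r (tagged u))%:Z - (shift_ r (tagged w))%:Z)%:~R.
  by rewrite /su /sw /tget !Sigma_shiftE // intrB; ring.
have near2 : cabs ((tget t u - tget t w) - (su - sw)) < cabs (tget t u - su) + d.
  have -> : tget t u - tget t w - (su - sw) = (tget t u - su) - (tget t w - sw) by ring.
  by apply: le_lt_trans (ler_cabsB _ _) _; rewrite ltrD2l.
have pos : 0 < 2 * d - (cabs (tget t u - su) + d) by lra.
split; apply: away_notint pos _.
  apply: away_near near2; rewrite e; apply: away_shift; exact: a1.
apply: (@away_near _ _ (su - sw - h)); last first.
  by rewrite opprD addrACA subrr addr0.
by rewrite e addrAC; apply: away_shift; exact: a2.
Qed.

(** [iterated_residue] for the forest of parents. Every factor of the master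
    function other than those between a variable and its parent compares two
    different z, so it is continuous near Sigma_I + r by the genericity of z
    and h. *)
Lemma iter_residue_Phi lq (r : (nvars lam).-tuple nat) :
  let s := Sigma_shift I z 1 r in
  iter_residue (Phi z h lq (-1)) s =
  expo lq s * regular h s * cGamma (- h) ^+ nvars lam *
  \prod_(v <- tvars lam) pole_coef h (shift_ r (tagged v)) (shift_ r (tagged (par v))).
Proof.
move=> s; have [d [d0 d2 dh dz dzh]] := separation.
have zi1 (v : V) : v \in tvars lam ->
    bnth (tagged (par v)) = bnth (tagged v) /\ tag (par v) = (tag v).+1.
  case: v => j a; rewrite mem_tvars => /andP[_ jN].
  by have [c _ [-> zc]] := par_some a jN.
have kapE v : v \in tvars lam -> tget s v - tget s (par v) =
    (shift_ r (tagged v))%:R - (shift_ r (tagged (par v)))%:R.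
  move=> vv; have [e1 e2] := zi1 v vv; move: vv; rewrite mem_tvars => /andP[_ vN].
  rewrite /s /tget !Sigma_shiftE ?e2 // ?(ltnW vN) // e1; ring.
have yh v y : v \in tvars lam -> cabs (y - (tget s v - tget s (par v))) < d -> notint (y - h).
  move=> vv; rewrite (kapE v vv) => yk.
  set k := (shift_ r (tagged v))%:R - _ in yk.
  have kE : k = ((shift_ r (tagged v))%:Z - (shift_ r (tagged (par v)))%:Z)%:~R.
    by rewrite intrB.
  have : away (d - cabs (y - k)) (y - h).
    move=> l; have -> : y - h - l%:~R = - ((h - (k - l%:~R)) - (y - k)) by ring.
    rewrite cabsN; apply: le_trans (lerB_cabs _ _); rewrite lerD2r.
    rewrite kE -intrB; exact: dh.
  apply: away_notint; rewrite subr_gt0 //.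
rewrite /iter_residue -[foldr _ _ _ _]/(foldr (fun v F t =>
   residue (fun x => F (set_var t (tagged v) x)) (tget s v))
   (Phi z h lq (-1)) (tvars lam) s).
rewrite (@iterated_residue R N lam _ (fun t => expo lq t * regular h t) s (tvars lam)
   par (gpair h) (fun v => pole_num h (shift_ r (tagged v)) (shift_ r (tagged (par v)))) d
   (tvars_uniq lam) d0).
- rewrite -[RHS]mulrA; congr (_ * _).
  rewrite -(size_tvars lam) -count_predT -iter_mulr_1 -big_const_seq -big_split /=.
  by apply: eq_big_seq => v vv; rewrite (kapE v vv) pole_num_value.
- move=> v pre post E; have vv : v \in tvars lam by rewrite E mem_cat mem_head orbT.
  have [_ e2] := zi1 v vv; split.
    by apply/negP => /(tvars_order E); rewrite e2 ltnn.
  by apply/eqP => e; move: e2; rewrite e; lia.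
- move=> t toff _; apply: Phi_split => a.
  have := toff (tag_ a); rewrite mem_tvars /= ltnn andbF => /(_ isT).
  by rewrite /tget /= => ->; rewrite /s Sigma_shiftN.
- move=> t v vv toff tclose.
  have close u : (1 <= tag u <= N)%N -> cabs (tget t u - tget s u) < d.
    move=> uN; have [uv|uv] := boolP (u \in tvars lam); first exact: tclose.
    by rewrite (toff u uv) subrr cabs0.
  pose T x := set_var t (tagged v) x.
  have T0 : T (tget t v) = t.
    by apply: tfam_ext => u; rewrite tget_set_var; case: eqP => [->|].
  have cT j (a : 'I_(psum lam j)) x : {for x, continuous (fun x => T x j a)}.
    exact: (@cont_tget t v (tag_ a) x).
  have good j k (a : 'I_(psum lam j)) (b : 'I_(psum lam k)) :
      (1 <= j <= N)%N -> (1 <= k <= N)%N -> bnth a != bnth b ->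
      notint (t j a - t k b) /\ notint (t j a - t k b - h).
    move=> jN kN ab.
    apply: (@diff_notint r d t (tag_ a) (tag_ b) d0 dz dzh) => //=.
    + by case/andP: jN.
    + by case/andP: kN.
    + exact: (close (tag_ a)).
    + exact: (close (tag_ b)).
  apply: contM.
    apply: contM; first exact: cont_cst.
    apply: cont_prod => j _; apply: cont_cexp; apply: contM; last exact: cont_cst.
    by apply: contM; [apply: cont_sum => a _; exact: cT | exact: cont_cst].
  apply: cont_prod_in => j; rewrite mem_index_iota => /andP[j1 jN] _.
  apply: cont_prod => a _; apply: contM.
  + apply: cont_prod => b ba.
    have zab : bnth a != bnth b.
      by apply: contra ba => /eqP/(bnth_inj IP (ltnW jN)) ->.
    have jN' : (1 <= j <= N)%N by rewrite j1 ltnW.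
    have [n1 n2] := good j j a b jN' jN' zab.
    have cab : {for tget t v, continuous (fun x => T x j a - T x j b)}.
      by apply: contB; exact: cT.
    apply: contV.
      rewrite -/(T _) T0 mulf_neq0 ?gpair_neq0 //.
      by have := n2 0; rewrite mulr0z.
    apply: contM; first by apply: contB; [exact: cab | exact: cont_cst].
    apply: cont_comp cab _; rewrite -/(T _) T0; exact: gpair_cont.
  + apply: cont_prod => c ca.
    have [c' pc [_ zc]] := par_some a jN.
    have zac : bnth a != bnth c.
      apply: contra ca; rewrite pc -zc => /eqP/(bnth_inj IP jN) ->; exact: eqxx.
    have [n1 n2] : notint (t j a - t j.+1 c) /\ notint (t j a - t j.+1 c - h).
      by apply: good => //; rewrite ?j1 // ltnW.
    have cac : {for tget t v, continuous (fun x => T x j a - T x j.+1 c)}.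
      by apply: contB; exact: cT.
    by apply: cont_comp cac _; rewrite -/(T _) T0; exact: gpair_cont.
- move=> v y vv /andP[y0 yd].
  have hy := yh v y vv yd; rewrite (kapE v vv) in y0 yd.
  apply: gpair_cont => //; apply: near_kappa_notint y0.
  exact: lt_trans yd d2.
- move=> v y vv yd; have hy := yh v y vv yd; rewrite (kapE v vv) in yd.
  by apply: pole_num_cont => //; exact: lt_trans yd d2.
- move=> v y vv /andP[y0 yd]; have hy := yh v y vv yd; rewrite (kapE v vv) in y0 yd *.
  by apply: pole_numE => //; exact: lt_trans yd d2.
Qed.

End PhiResidue.

(** * Growth of the summands in the shift *)

Section GammaGrowth.
Variable R : realType.
Local Notation C := R[i].

(** The ratio of consecutive moduli is 1 + O(1/k), as [poly_growth]
    requires. *)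
Lemma ratio_growth (u p q : nat -> C) (B M : R) (A : nat) :
  0 <= B -> 0 <= M -> B * M <= A%:R ->
  (forall k, cabs (u k.+1) * cabs (q k) = cabs (p k) * cabs (u k)) ->
  (forall k, cabs (p k - q k) <= B) ->
  (forall k, 0 < cabs (q k)) -> (forall k, k.+1%:R <= M * cabs (q k)) ->
  forall k, cabs (u k) <= cabs (u 0%N) * k.+1%:R ^+ A.
Proof.
move=> B0 M0 BM hu hpq q0 hq.
apply: (@poly_growth R (fun k => cabs (u k))) => k; first exact: cabs_ge0.
have k0 : 0 < k.+1%:R :> R by rewrite ltr0n.
have -> : cabs (u k.+1) = cabs (p k) / cabs (q k) * cabs (u k).
  by rewrite mulrAC -hu mulfK // gt_eqF.
rewrite ler_wpM2r ?cabs_ge0 // ler_pdivrMr // mulrDl mul1r.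
have -> : p k = q k + (p k - q k) by ring.
apply: le_trans (ler_cabsD _ _) _; rewrite lerD2l.
apply: le_trans (hpq k) _; rewrite mulrAC ler_pdivlMr //.
apply: le_trans (ler_wpM2l B0 (hq k)) _; rewrite mulrA ler_wpM2r //; exact: ltW.
Qed.

Lemma linear_lower (k : nat) (y : C) (b d : R) : 0 < d -> 0 <= b ->
  d <= cabs y -> k%:R <= cabs y + b -> k.+1%:R <= (1 + (b + 1) / d) * cabs y.
Proof.
move=> d0 b0 dy ky; rewrite -natr1 mulrDl mul1r.
apply: le_trans (lerD ky (lexx 1)) _; rewrite -addrA lerD2l.
by rewrite mulrAC ler_pdivlMr // ler_wpM2l // addr_ge0.
Qed.

(** The inverse sequence satisfies the recurrence with a and b exchanged. *)
Lemma ratio_growth_int (f a b : int -> C) (B M : R) (A : nat) :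
  0 <= B -> 0 <= M -> B * M <= A%:R -> (forall k, f k != 0) ->
  (forall k, cabs (f (k + 1)) * cabs (b k) = cabs (a k) * cabs (f k)) ->
  (forall k, cabs (a k - b k) <= B) ->
  (forall k, `|k|.+1%:R <= M * cabs (a k)) -> (forall k, `|k|.+1%:R <= M * cabs (b k)) ->
  forall k, cabs (f k) <= cabs (f 0) * `|k|.+1%:R ^+ A /\
    cabs (f k)^-1 <= cabs (f 0)^-1 * `|k|.+1%:R ^+ A.
Proof.
move=> B0 M0 BM.
have pos y (k : nat) : k.+1%:R <= M * cabs y -> 0 < cabs y.
  by rewrite lt_def cabs_ge0 andbT; apply: contraTneq => ->; rewrite mulr0 -ltNge ltr0n.
have main g p q : (forall k : int, cabs (g (k + 1)) * cabs (q k) = cabs (p k) * cabs (g k)) ->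
    (forall k, cabs (p k - q k) <= B) -> (forall k : int, `|k|.+1%:R <= M * cabs (p k)) ->
    (forall k : int, `|k|.+1%:R <= M * cabs (q k)) ->
    forall k : int, cabs (g k) <= cabs (g 0) * `|k|.+1%:R ^+ A.
  move=> rel pq hp hq k; have [->|kN] : (k = `|k| \/ k = - `|k|%:Z)%N by lia.
    apply: (@ratio_growth (fun k => g k%:Z) (fun k => p k%:Z) (fun k => q k%:Z) B M A) => // l.
    - by rewrite -rel; congr (cabs (g _) * _); lia.
    - by apply: (pos _ `|l|%N); exact: hq.
    - exact: (hq l).
  (* for negative k the recurrence is read backwards, which exchanges p and q *)
  rewrite {1}kN; apply: (@ratio_growth (fun k => g (- k%:Z)) (fun k => q (- k.+1%:Z))
    (fun k => p (- k.+1%:Z)) B M A) => // l.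
  - have := rel (- l.+1%:Z); have -> : - l.+1%:Z + 1 = - l%:Z by lia.
    by move=> e; rewrite mulrC -e mulrC.
  - by rewrite cabsB.
  - by apply: (pos _ `|l.+1|%N); have := hp (- l.+1%:Z); rewrite abszN.
  - by have := hp (- l.+1%:Z); rewrite abszN; apply: le_trans; rewrite ler_nat.
move=> f0 rel ab ha hb k; split; first exact: main rel ab ha hb k.
apply: (main (fun k => (f k)^-1) b a) => // {}k; last by rewrite cabsB.
have n1 : cabs (f k) != 0 by rewrite cabs_eq0.
have n2 : cabs (f (k + 1)) != 0 by rewrite cabs_eq0.
by rewrite !cabsV [LHS]mulrC; apply/eqP; rewrite eqr_div // -rel mulrC.
Qed.

(** The recurrence [gpairS] has coefficients that differ by 1 + h, uniformly
    bounded near h0. *)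
Lemma gpair_growth (h0 x : C) : notint x -> notint (x - h0) ->
  exists c A, 0 <= c /\ \forall h \near h0, forall k : int,
    cabs (gpair h (x + k%:~R)) <= c * `|k|.+1%:R ^+ A /\
    cabs (gpair h (x + k%:~R))^-1 <= c * `|k|.+1%:R ^+ A.
Proof.
move=> nx nxh.
have [d1 d10 a1] := notint_away nx; have [d2 d20 a2] := notint_away nxh.
pose d := Num.min d1 (d2 / 2).
have d0 : 0 < d by rewrite lt_min d10 divr_gt0.
have dd1 : d <= d1 by rewrite ge_min lexx.
have dd2 : d <= d2 - d2 / 2 by rewrite ge_min; apply/orP; right; lra.
pose b := cabs x + cabs h0 + 1.
have b0 : 0 <= b by rewrite /b; have := cabs_ge0 x; have := cabs_ge0 h0; lra.
(* B bounds 1 + h; d is a lower bound for the moduli of x + k and x + k - h *)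
pose B := cabs h0 + 2; pose M := 1 + (b + 1) / d.
have B0 : 0 <= B by rewrite /B; have := cabs_ge0 h0; lra.
have M0 : 0 <= M by rewrite /M addr_ge0 // divr_ge0 ?(ltW d0) // addr_ge0.
pose A := Num.bound (B * M).
have AM : B * M <= A%:R by apply/ltW/archi_boundP/mulr_ge0.
pose c := cabs (gpair h0 x) + cabs (gpair h0 x)^-1 + 1.
have c1 : cabs (gpair h0 x) + 1 <= c by rewrite /c; have := cabs_ge0 (gpair h0 x)^-1; lra.
have c2 : cabs (gpair h0 x)^-1 + 1 <= c by rewrite /c; have := cabs_ge0 (gpair h0 x); lra.
have c0 : 0 <= c by have := cabs_ge0 (gpair h0 x); lra.
have gc := gpair_cont_h nx nxh.
have gn : gpair h0 x != 0 by exact: gpair_neq0.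
have gcV : {for h0, continuous (fun h => (gpair h x)^-1)}.
  by apply: contV; [exact: gn | exact: gc].
have nb1 := near_bounded gc; have nb2 := near_bounded gcV.
exists c, A; split=> //; near=> h.
have hn : cabs (h - h0) < Num.min 1 (d2 / 2).
  by near: h; apply: near_cabs; rewrite lt_min ltr01 divr_gt0.
have /andP[hn1 hn2] : (cabs (h - h0) < 1) && (cabs (h - h0) < d2 / 2) by rewrite -lt_min.
have hb : cabs h <= cabs h0 + 1.
  have -> : h = h0 + (h - h0) by ring.
  by apply: le_trans (ler_cabsD _ _) _; rewrite lerD2l ltW.
have axh : away d (x - h).
  apply: away_le dd2 _; apply: away_near a2 _.
  have -> : x - h - (x - h0) = - (h - h0) by ring.
  rewrite cabsN; exact: hn2.
have nxh' : notint (x - h) by exact: away_notint axh.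
have g1 : cabs (gpair h x) <= c by apply: le_trans c1; near: h; exact: nb1.
have g2 : cabs (gpair h x)^-1 <= c by apply: le_trans c2; near: h; exact: nb2.
have nk (k : int) : notint (x + k%:~R) /\ notint (x + k%:~R - h).
  by split; [|rewrite addrAC]; exact: notint_shift.
have low (k l : int) (e y : C) : k%:~R + e = y -> cabs e <= b -> d <= cabs y ->
    `|k|.+1%:R <= M * cabs y.
  move=> ye eb dy; apply: linear_lower => //.
  have -> : `|k|%:R = cabs (k%:~R : C) by rewrite cabs_int natr_absz.
  have -> : (k%:~R : C) = y - e by rewrite -ye addrK.
  by apply: le_trans (ler_cabsB _ _) _; rewrite lerD2l.
have bound := @ratio_growth_int (fun k => gpair h (x + k%:~R)) (fun k => x + k%:~R - h)
  (fun k => x + k%:~R + 1) B M A B0 M0 AM.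
move=> k; have [||||| k1 k2] := bound _ _ _ _ _ k.
- by move=> l; have [] := nk l; exact: gpair_neq0.
- move=> l; have [h1 h2] := nk l; have := gpairS h1 h2; rewrite intrD addrA -!cabsM.
  by move=> ->; rewrite mulNr cabsN.
- move=> l; have -> : x + l%:~R - h - (x + l%:~R + 1) = - (1 + h) by ring.
  by rewrite cabsN; apply: le_trans (ler_cabsD _ _) _; rewrite cabs1 /B; lra.
- move=> l; apply: (low l l (x - h)); first by ring.
    by apply: le_trans (ler_cabsB _ _) _; rewrite /b; lra.
  by have := axh (- l); rewrite intrN opprK addrAC.
- move=> l; apply: (low l l (x + 1)); first by ring.
    by apply: le_trans (ler_cabsD _ _) _; rewrite cabs1 /b; have := cabs_ge0 h0; lra.
  apply: le_trans dd1 _; have := a1 (- (l + 1)); rewrite intrN opprK intrD addrA.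
  exact.
rewrite addr0 in k1 k2; split.
  by apply: le_trans k1 _; rewrite ler_wpM2r // exprn_ge0.
by apply: le_trans k2 _; rewrite ler_wpM2r // exprn_ge0.
Unshelve. all: by end_near.
Qed.

End GammaGrowth.

Section Good.
Variables (R : realType) (n : nat) (h0 : R[i]).
Local Notation C := R[i].
Local Notation K := (n.-tuple nat).

(** The class containing all the factors of the summands: the growth provides a
    summable bound near h0, and the continuity is what dominated convergence
    asks for. *)
Definition good (f : C -> K -> C) : Prop :=
  (exists c D, 0 <= c /\ \forall h \near h0, forall r, cabs (f h r) <= c * weight R r ^+ D)
  /\ forall r, {for h0, continuous (fun h => f h r)}.

Lemma weight_ge0 (r : K) : 0 <= weight R r.
Proof. by apply: le_trans (weight_ge1 _ r). Qed.

Lemma weightX_mono (r : K) D E : (D <= E)%N -> weight R r ^+ D <= weight R r ^+ E.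
Proof. by move=> DE; rewrite ler_weXn2l // weight_ge1. Qed.

Lemma good_eq f g : (forall h r, f h r = g h r) -> good f -> good g.
Proof. by move=> e; have -> : f = g by apply/funext => h; apply/funext. Qed.

Lemma good_cst (c : C) : good (fun _ _ => c).
Proof.
split; last by move=> r; exact: cont_cst.
exists (cabs c), 0%N; split; first exact: cabs_ge0.
by near=> h => r; rewrite expr0 mulr1.
Unshelve. all: by end_near.
Qed.

Lemma good_h : good (fun h _ => h).
Proof.
split; last by move=> r; exact: cont_id.
exists (cabs h0 + 1), 0%N; split; first by rewrite addr_ge0 // cabs_ge0.
have hb := near_bounded (@cont_id R h0).
by near=> h => r; rewrite expr0 mulr1; near: h.
Unshelve. all: by end_near.
Qed.

Lemma good_nat (m : K -> nat) : (forall r, (m r).+1%:R <= weight R r) ->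
  good (fun _ r => (m r)%:R).
Proof.
move=> hm; split; last by move=> r; exact: cont_cst.
exists 1, 1%N; split=> //; near=> h => r.
by rewrite mul1r expr1 cabs_nat (le_trans _ (hm r)) // ler_nat.
Unshelve. all: by end_near.
Qed.

Lemma goodM f g : good f -> good g -> good (fun h r => f h r * g h r).
Proof.
move=> [[c [D [c0 hf]]] cf] [[e [E [e0 hg]]] cg]; split; last first.
  by move=> r; apply: contM; [exact: cf | exact: cg].
exists (c * e), (D + E)%N; split; first by rewrite mulr_ge0.
near=> h => r; rewrite cabsM exprD mulrACA.
have h1 : cabs (f h r) <= c * weight R r ^+ D by move: r; near: h.
have h2 : cabs (g h r) <= e * weight R r ^+ E by move: r {h1}; near: h.
by rewrite ler_pM ?cabs_ge0.
Unshelve. all: by end_near.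
Qed.

Lemma goodD f g : good f -> good g -> good (fun h r => f h r + g h r).
Proof.
move=> [[c [D [c0 hf]]] cf] [[e [E [e0 hg]]] cg]; split; last first.
  by move=> r; apply: contD; [exact: cf | exact: cg].
exists (c + e), (maxn D E); split; first by rewrite addr_ge0.
near=> h => r; rewrite mulrDl.
have h1 : cabs (f h r) <= c * weight R r ^+ D by move: r; near: h.
have h2 : cabs (g h r) <= e * weight R r ^+ E by move: r {h1}; near: h.
apply: le_trans (ler_cabsD _ _) _; apply: lerD.
  by apply: le_trans h1 _; rewrite ler_wpM2l // weightX_mono // leq_maxl.
by apply: le_trans h2 _; rewrite ler_wpM2l // weightX_mono // leq_maxr.
Unshelve. all: by end_near.
Qed.

Lemma goodB f g : good f -> good g -> good (fun h r => f h r - g h r).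
Proof.
move=> hf hg; apply: good_eq (goodD hf (goodM (good_cst (-1)) hg)) => h r.
by rewrite mulN1r.
Qed.

Lemma good_prod (J : eqType) (s : seq J) (P : pred J) (F : J -> C -> K -> C) :
  (forall j, j \in s -> P j -> good (F j)) ->
  good (fun h r => \prod_(j <- s | P j) F j h r).
Proof.
elim: s => [|j s IH] hF.
  by apply: good_eq (good_cst 1) => h r; rewrite big_nil.
have {}IH := IH (fun i si => hF i (mem_behead (s := j :: s) si)).
case Pj: (P j).
  apply: good_eq (goodM (hF j (mem_head _ _) Pj) IH) => h r.
  by rewrite big_cons Pj.
by apply: good_eq IH => h r; rewrite big_cons Pj.
Qed.

Lemma good_sum (J : eqType) (s : seq J) (P : pred J) (F : J -> C -> K -> C) :
  (forall j, j \in s -> P j -> good (F j)) ->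
  good (fun h r => \sum_(j <- s | P j) F j h r).
Proof.
elim: s => [|j s IH] hF.
  by apply: good_eq (good_cst 0) => h r; rewrite big_nil.
have {}IH := IH (fun i si => hF i (mem_behead (s := j :: s) si)).
case Pj: (P j).
  apply: good_eq (goodD (hF j (mem_head _ _) Pj) IH) => h r.
  by rewrite big_cons Pj.
by apply: good_eq IH => h r; rewrite big_cons Pj.
Qed.

Section Coordinates.
Variables m m' : K -> nat.
Hypothesis hm : forall r, (m r).+1%:R <= weight R r.
Hypothesis hm' : forall r, (m' r).+1%:R <= weight R r.
Let k r : int := (m r)%:Z - (m' r)%:Z.

Let k_le r : `|k r|.+1%:R <= weight R r ^+ 2.
Proof.
apply: (@le_trans _ _ ((m r).+1%:R * (m' r).+1%:R)); last by rewrite expr2 ler_pM.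
by rewrite -natrM ler_nat /k; nia.
Qed.

Variable x : C.

Lemma good_gpair : notint x -> notint (x - h0) ->
  good (fun h r => gpair h (x + ((m r)%:R - (m' r)%:R))) /\
  good (fun h r => (gpair h (x + ((m r)%:R - (m' r)%:R)))^-1).
Proof.
move=> nx nxh; have [c [A [c0 hg]]] := gpair_growth nx nxh.
have kE r : (m r)%:R - (m' r)%:R = (k r)%:~R :> C by rewrite intrB.
have nx' r : notint (x + (k r)%:~R) by exact: notint_shift.
have nxh' r : notint (x + (k r)%:~R - h0) by rewrite addrAC; exact: notint_shift.
have bnd r : c * `|k r|.+1%:R ^+ A <= c * weight R r ^+ (2 * A).
  by rewrite exprM ler_wpM2l // lerXn2r ?nnegrE ?exprn_ge0 ?weight_ge0.
split; split.
- exists c, (2 * A)%N; split=> //; near=> h => r; rewrite kE.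
  apply: le_trans (bnd r).
  suff H : forall k : int, cabs (gpair h (x + k%:~R)) <= c * `|k|.+1%:R ^+ A /\
    cabs (gpair h (x + k%:~R))^-1 <= c * `|k|.+1%:R ^+ A by have [h1 _] := H (k r).
  by near: h.
- by move=> r; rewrite kE; exact: gpair_cont_h.
- exists c, (2 * A)%N; split=> //; near=> h => r; rewrite kE.
  apply: le_trans (bnd r).
  suff H : forall k : int, cabs (gpair h (x + k%:~R)) <= c * `|k|.+1%:R ^+ A /\
    cabs (gpair h (x + k%:~R))^-1 <= c * `|k|.+1%:R ^+ A by have [_ h1] := H (k r).
  by near: h.
- move=> r; rewrite kE; apply: contV; first exact: gpair_neq0.
  exact: gpair_cont_h.
Unshelve. all: by end_near.
Qed.

Lemma good_inv : notint x -> good (fun h r => (x + ((m r)%:R - (m' r)%:R))^-1).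
Proof.
move=> nx; have [d d0 hd] := notint_away nx.
split; last by move=> r; exact: cont_cst.
exists d^-1, 0%N; split; first by rewrite invr_ge0 ltW.
near=> h => r; rewrite expr0 mulr1 cabsV lef_pV2 ?posrE //.
  by have := hd (- k r); rewrite intrN opprK intrB.
apply: lt_le_trans d0 _.
by have := hd (- k r); rewrite intrN opprK intrB.
Unshelve. all: by end_near.
Qed.

Lemma good_inv_h : notint (x - h0) ->
  good (fun h r => (x + ((m r)%:R - (m' r)%:R) - h)^-1).
Proof.
move=> nx; have [d d0 hd] := notint_away nx.
have kE r : (m r)%:R - (m' r)%:R = (k r)%:~R :> C by rewrite intrB.
have low r : d <= cabs (x + (k r)%:~R - h0).
  by have := hd (- k r); rewrite intrN opprK addrAC.
split; last first.
  move=> r; rewrite kE; apply: contV; last by apply: contB; [exact: cont_cst|exact: cont_id].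
  by rewrite -cabs_gt0; apply: lt_le_trans (low r).
have d2 : 0 < d / 2 by rewrite divr_gt0.
exists (d / 2)^-1, 0%N; split; first by rewrite invr_ge0 ltW.
near=> h => r.
have hh : cabs (h - h0) < d / 2 by near: h; exact: near_cabs.
have lowh : d / 2 <= cabs (x + (k r)%:~R - h).
  have -> : x + (k r)%:~R - h = (x + (k r)%:~R - h0) - (h - h0) by ring.
  by apply: le_trans (lerB_cabs _ _); have := low r; lra.
by rewrite kE expr0 mulr1 cabsV lef_pV2 ?posrE // (lt_le_trans d2).
Unshelve. all: by end_near.
Qed.

Lemma good_pole_coef : good (fun h r => pole_coef h (m r) (m' r)).
Proof.
pose A := (Num.bound (cabs h0 + 2)).
have hA : cabs h0 + 2 <= A%:R.
  by apply/ltW/archi_boundP; rewrite addr_ge0 // cabs_ge0.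
split; last first.
  move=> r; rewrite /pole_coef; case: (m' r <= m r)%N; last exact: cont_cst.
  apply: contM; first exact: cont_cst.
  rewrite /binc; apply: cont_prod => i _; apply: contM; last exact: cont_cst.
  by apply: contB; [exact: cont_cst | exact: cont_id].
exists 1, A; split=> //; near=> h => r; rewrite mul1r.
have h1 : cabs (1 + h) <= A%:R.
  have hb : cabs h <= cabs h0 + 1 by near: h; exact: (near_bounded (@cont_id R h0)).
  by apply: le_trans (ler_cabsD _ _) _; rewrite cabs1; lra.
rewrite /pole_coef; case: leqP => mm; last by rewrite cabs0 exprn_ge0 ?weight_ge0.
rewrite cabsM cabsN cabsX cabsN cabs1 expr1n mul1r.
apply: le_trans (binc_growth h1 _) _.
rewrite lerXn2r ?nnegrE ?weight_ge0 // (le_trans _ (hm r)) // ler_nat ltnS.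
by rewrite leq_subr.
Unshelve. all: by end_near.
Qed.

End Coordinates.
End Good.

Section GoodTerm.
Variables (R : realType) (N : nat) (lam : N.-tuple nat).
Local Notation C := R[i].
Local Notation n := (psum lam N).
Local Notation K := ((nvars lam).-tuple nat).
Variables (I : 'I_N -> {set 'I_n}) (IP : ordered_partition I) (x0 : 'I_n).
Variables (z : 'I_n -> C) (h0 : C).
Hypothesis hz : forall a b, a != b -> notint (z a - z b).
Hypothesis hzh : forall a b, a != b -> notint (z a - z b - h0).
Local Notation bnth := (bnth I x0).
Local Notation sig := (Sigma_shift I z 1).
Local Notation good := (good h0).

Lemma shift_weight (j : nat) (a : 'I_(psum lam j)) (r : K) :
  (shift_ r a).+1%:R <= weight R r.
Proof. exact: coord_le_weight. Qed.

Lemma Sigma_shiftB j k (a : 'I_(psum lam j)) (b : 'I_(psum lam k)) r :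
  (j <= N)%N -> (k <= N)%N ->
  sig r a - sig r b = (z (bnth a) - z (bnth b)) + ((shift_ r a)%:R - (shift_ r b)%:R).
Proof. by move=> jN kN; rewrite !(Sigma_shiftE IP x0) //; ring. Qed.

(** The inverse gamma factors are also controlled, since [gpair_growth]
    bounds them from below. *)
Lemma good_regular : good (fun h r => regular I x0 h (sig r)).
Proof.
apply: good_prod => j; rewrite mem_index_iota => /andP[j1 jN] _.
have jN' := ltnW jN.
apply: good_prod => a _ _; apply: goodM; apply: good_prod => b _ ab.
- have zab : bnth a != bnth b by apply: contra ab => /eqP/(bnth_inj IP jN') ->.
  have [_ g1] := good_gpair (shift_weight a) (shift_weight b) (hz zab) (hzh zab).
  have g2 := good_inv_h (fun r : K => shift_ r a) (fun r => shift_ r b) (hzh zab).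
  by apply: good_eq (goodM g2 g1) => h r; rewrite !Sigma_shiftB // [RHS]invfM //.
- have [c pc [_ zc]] := par_some IP x0 a jN.
  have zab : bnth a != bnth b.
    by apply: contra ab; rewrite pc -zc => /eqP/(bnth_inj IP jN) ->.
  have [g1 _] := good_gpair (shift_weight a) (shift_weight b) (hz zab) (hzh zab).
  by apply: good_eq g1 => h r; rewrite Sigma_shiftB //.
Qed.

Lemma good_pole_coefs : good (fun h r => \prod_(v <- tvars lam)
  pole_coef h (shift_ r (tagged v)) (shift_ r (tagged (par I x0 v)))).
Proof.
by apply: good_prod => v _ _; apply: good_pole_coef => r; exact: shift_weight.
Qed.

Lemma good_Qclass g : good (fun h (_ : K) => @Qclass R N lam h g).
Proof.
do 4 (apply: good_prod => ? _ _).
by apply: goodB; [exact: good_cst | exact: good_h].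
Qed.

(** The points produced by the symmetrization: each level below the top
    permutes the coordinates of Sigma_I + r. *)
Definition admissible (T : K -> tfam R lam) : Prop :=
  (forall j, (1 <= j < N)%N -> exists p : 'S_(psum lam j),
     forall r a, T r j a = sig r (p a)) /\
  (exists w : 'I_n -> C, forall r (a : 'I_n), T r N a = w a).

Lemma good_entry T j (a : 'I_(psum lam j)) : admissible T -> (1 <= j <= N)%N ->
  good (fun _ r => T r j a).
Proof.
move=> [T1 [w T2]] /andP[j1]; rewrite leq_eqVlt => /predU1P[jN|jN].
  by subst j; apply: good_eq (good_cst _ _ (w a)) => h r; rewrite T2.
have [|p hp] := T1 j; first by rewrite j1.
apply: good_eq (goodD (good_cst _ _ (z (bnth (p a)))) (good_nat _ (shift_weight (p a)))) => h r.
by rewrite hp (Sigma_shiftE IP x0) // ltnW.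
Qed.

Lemma good_What_term T : admissible T -> good (fun h r => What_term h (T r)).
Proof.
move=> aT; apply: good_prod => j; rewrite mem_index_iota => /andP[j1 jN] _.
have j1N : (1 <= j <= N)%N by rewrite j1 ltnW.
have gd a (c : 'I_(psum lam j.+1)) : good (fun _ r => T r j a - T r j.+1 c).
  by apply: goodB; apply: good_entry.
apply: good_prod => a _ _; apply: goodM; first apply: goodM.
- apply: good_prod => c _ _; apply: goodB; [exact: gd|exact: good_h].
- by apply: good_prod => c _ _; exact: gd.
- apply: good_prod => b _ ab.
  have [p hp] := aT.1 j (introT andP (conj j1 jN)).
  have zab : bnth (p a) != bnth (p b).
    apply: contraL ab => /eqP/(bnth_inj IP (ltnW jN))/perm_inj ->.
    by rewrite ltnn.
  have gi := good_inv h0 (fun r : K => shift_ r (p a)) (fun r => shift_ r (p b)) (hz zab).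
  apply: goodM.
    apply: goodB; last exact: good_h.
    by apply: goodB; apply: good_entry.
  by apply: good_eq gi => h r; rewrite !hp Sigma_shiftB // ltnW.
Qed.

Lemma set_levelE (t : tfam R lam) j (y : 'I_(psum lam j) -> C) : @set_level R N lam t j y j = y.
Proof. exact: dfwithin. Qed.

Lemma set_level_neq (t : tfam R lam) j (y : 'I_(psum lam j) -> C) k : k != j ->
  @set_level R N lam t j y k = t k.
Proof. by move=> kj; apply: dfwithout; rewrite eq_sym. Qed.

Lemma good_Sym (l : seq nat) T : all (fun j => j < N)%N l -> admissible T ->
  good (fun h r => foldr (fun j f => Sym_level j f) (What_term h) l (T r)).
Proof.
elim: l T => [|j l IH] T /= lN aT; first exact: good_What_term.
case/andP: lN => jN lN.
apply: good_sum => p _ _; apply: IH => //.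
case: aT => T1 [w T2]; split.
- move=> k kN; have [q hq] := T1 k kN.
  have [jk|jk] := eqVneq k j; last first.
    by exists q => r a; rewrite set_level_neq.
  subst k; exists (p * q)%g => r a.
  by rewrite set_levelE hq permM.
- exists w => r a; rewrite set_level_neq ?T2 //.
  by rewrite gtn_eqF.
Qed.

Lemma good_What g : good (fun h r => What h (sig r) g).
Proof.
apply: good_Sym; first by apply/allP => j; rewrite mem_iota; lia.
split.
- move=> j jN; exists 1%g => r a; rewrite set_level_neq ?perm1 //.
  by have /andP[_ h] := jN; rewrite ltn_eqF.
- by exists (concat_roots g) => r a; rewrite set_levelE.
Qed.

(** The summand of the hypergeometric sum, up to the exponential factor, the
    sign and the power of Gamma(-h). *)
Definition summand g (h : C) (r : K) : C :=
  regular I x0 h (sig r) *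
  (\prod_(v <- tvars lam) pole_coef h (shift_ r (tagged v)) (shift_ r (tagged (par I x0 v)))) *
  (Qclass h g * What h (sig r) g).

(** The bound needed for the convergence, and for its uniformity in h. *)
Lemma good_summand g : good (summand g).
Proof.
apply: goodM; last by apply: goodM; [exact: good_Qclass | exact: good_What].
by apply: goodM; [exact: good_regular | exact: good_pole_coefs].
Qed.

End GoodTerm.

(** * Fixed points and products over pairs of blocks *)

Section Partitions.
Variables (N : nat) (lam : N.-tuple nat).
Local Notation n := (psum lam N).

Lemma psum_le j k : (j <= k)%N -> (psum lam j <= psum lam k)%N.
Proof.
move=> jk; rewrite -(subnKC jk); elim: (k - j)%N => [|d IH]; first by rewrite addn0.
by rewrite addnS psumS (leq_trans IH) // leq_addr.
Qed.

(** The positions before the j-th partial sum are those of the first j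
    blocks. *)
Lemma psum_lt_block (b : 'I_n) j :
  (b < psum lam j)%N = (tagnat.sig1 (b : 'I_(\sum_(i < N) part lam i)) < j)%N.
Proof.
set b' := (b : 'I_(\sum_(i < N) part lam i)).
have h (k : 'I_N) : (\sum_(i < N | (i < k)%N) part lam i = psum lam k)%N.
  rewrite /psum (big_ord_widen N (part lam)) //; exact: ltnW.
have bE : (b = psum lam (tagnat.sig1 b') + tagnat.sig2 b' :> nat)%N.
  by rewrite -h -tagnat.rect.
apply/idP/idP => [bj|sj].
  rewrite ltnNge; apply/negP => /psum_le h1.
  have : (psum lam j <= b)%N by rewrite bE (leq_trans h1) // leq_addr.
  by rewrite leqNgt bj.
apply: leq_trans (psum_le sj); rewrite psumS [X in (X < _)%N]bE ltn_add2l.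
exact: ltn_ord.
Qed.

(** The block of x; the argument i0 is only a default value. *)
Definition block (I : 'I_N -> {set 'I_n}) (x : 'I_n) (i0 : 'I_N) : 'I_N :=
  odflt i0 [pick i | x \in I i].

Variables (I : 'I_N -> {set 'I_n}) (IP : ordered_partition I) (i0 : 'I_N).
Local Notation blk x := (block I x i0).

Lemma mem_block x : x \in I (blk x).
Proof.
rewrite /block; case: pickP => [i //|h].
have [_ cov _] := IP; have : x \in [set: 'I_n]%SET by rewrite inE.
by rewrite -cov => /bigcupP[i _ xi]; have := h i; rewrite xi.
Qed.

Lemma blockP x i : (x \in I i) = (blk x == i).
Proof.
apply/idP/eqP => [xi|<-]; last exact: mem_block.
exact: (block_unique IP (mem_block x) xi).
Qed.

Lemma blocks_uptoP x j : (x \in blocks_upto I j) = (blk x < j)%N.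
Proof.
rewrite mem_blocks_upto; apply/existsP/idP => [[i /andP[ij]]|xj].
  by rewrite blockP => /eqP ->.
by exists (blk x); rewrite xj mem_block.
Qed.

End Partitions.

(** Inclusions between sets of equal cardinality are equalities. *)
Lemma blocks_upto_inj (N : nat) (lam : N.-tuple nat)
    (I J : 'I_N -> {set 'I_(psum lam N)}) :
  ordered_partition I -> ordered_partition J ->
  (forall j, (j <= N)%N -> blocks_upto I j \subset blocks_upto J j) -> I = J.
Proof.
move=> IP JP sub.
have e j : (j <= N)%N -> blocks_upto I j = blocks_upto J j.
  by move=> jN; apply/eqP; rewrite eqEcard sub //= !card_blocks_upto.
apply/funext => i; apply/setP => x; rewrite !(blockP _ i) //.
have h j : (j <= N)%N -> (block I x i < j)%N = (block J x i < j)%N.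
  by move=> jN; rewrite -!blocks_uptoP // e.
rewrite -!val_eqE /=.
have h1 := h i (ltnW (ltn_ord i)); have h2 := h i.+1 (ltn_ord i).
by apply/eqP/eqP => k; lia.
Qed.

Section FixedPoint.
Variables (R : realType) (N : nat) (lam : N.-tuple nat).
Local Notation C := R[i].
Local Notation n := (psum lam N).
Variables (J : 'I_N -> {set 'I_n}) (JP : ordered_partition J).
Variables (z : 'I_n -> C) (zinj : injective z).
Variables (g : chern_roots R lam) (gJ : at_fixed_point z J g).

Lemma fixed_mem (i : 'I_N) (a : 'I_(part lam i)) : exists2 x, x \in J i & g a = z x.
Proof.
have : g a \in [seq z b | b <- enum (J i)].
  by rewrite -(perm_mem (gJ i)) map_f // mem_enum.
by case/mapP => x; rewrite mem_enum; exists x.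
Qed.

Lemma fixed_inj (i : 'I_N) : injective (@g i).
Proof.
have u : uniq [seq g a | a <- enum 'I_(part lam i)].
  by rewrite (perm_uniq (gJ i)) map_inj_uniq ?enum_uniq.
by move=> a b; have /dinjectiveP := u; apply.
Qed.

Lemma concat_mem (b : 'I_n) j : (j <= N)%N -> (b < psum lam j)%N ->
  exists2 x, x \in blocks_upto J j & concat_roots g b = z x.
Proof.
move=> jN bj; have [x xJ gx] := fixed_mem (tagnat.sig2 (b : 'I_(\sum_(i < N) part lam i))).
exists x => //; rewrite mem_blocks_upto; apply/existsP.
by exists (tagnat.sig1 (b : 'I_(\sum_(i < N) part lam i))); rewrite xJ andbT -psum_lt_block.
Qed.

Lemma concat_inj : injective (concat_roots g).
Proof.
move=> b c; rewrite /concat_roots => e.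
pose b' := (b : 'I_(\sum_(i < N) part lam i)); pose c' := (c : 'I_(\sum_(i < N) part lam i)).
have [x xJ gx] := fixed_mem (tagnat.sig2 b').
have [y yJ gy] := fixed_mem (tagnat.sig2 c').
have xy : x = y by apply: zinj; rewrite -gx -gy.
subst y; have e1 := block_unique JP xJ yJ.
apply: (@tagnat.sig_inj _ _ b' c'); rewrite !tagnat.sigE12.
move: (tagnat.sig2 b') (tagnat.sig2 c') e {gx gy}; rewrite -/b' -/c'.
move: (tagnat.sig1 b') (tagnat.sig1 c') e1 {xJ yJ} => i k ik; subst k.
by move=> a a' e; rewrite (fixed_inj e).
Qed.

Variable i0 : 'I_N.
Local Notation blk x := (block J x i0).

(** The product over pairs of Chern roots in the order of the blocks. *)
Definition pair_prod (F : C -> C -> C) : C :=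
  \prod_x \prod_(y | (blk x < blk y)%N) F (z x) (z y).

Lemma fixed_prod (F : C -> C) (i : 'I_N) :
  \prod_(a < part lam i) F (g a) = \prod_(x in J i) F (z x).
Proof.
have -> : \prod_(a < part lam i) F (g a) = \prod_(w <- [seq g a | a <- enum 'I_(part lam i)]) F w.
  by rewrite big_map big_enum.
by rewrite (perm_big _ (gJ i)) big_map big_enum.
Qed.

Lemma sets_pair_prod (F : C -> C -> C) :
  \prod_(i < N) \prod_(j < N | (i < j)%N) \prod_(x in J i) \prod_(y in J j) F (z x) (z y)
  = pair_prod F.
Proof.
rewrite /pair_prod.
transitivity (\prod_(i < N) \prod_(j < N) \prod_x \prod_y
   (if [&& (i < j)%N, blk x == i & blk y == j] then F (z x) (z y) else 1)).
  apply: eq_bigr => i _; rewrite big_mkcond; apply: eq_bigr => j _.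
  case: (i < j)%N => /=; last by rewrite big1 // => x _; rewrite big1.
  rewrite big_mkcond; apply: eq_bigr => x _; rewrite (blockP JP i0).
  case: (blk x == i) => /=; last by rewrite big1.
  by rewrite big_mkcond; apply: eq_bigr => y _; rewrite (blockP JP i0).
etransitivity; first by apply: eq_bigr => i _; exact: exchange_big.
rewrite exchange_big; apply: eq_bigr => x _ /=.
etransitivity; first by apply: eq_bigr => i _; exact: exchange_big.
rewrite exchange_big [RHS]big_mkcond /=.
apply: eq_bigr => y _.
rewrite (bigD1 (blk x)) //= [X in _ * X]big1; last first.
  by move=> i ix; rewrite big1 // => j _; rewrite [blk x == i]eq_sym (negPf ix) andbF.
rewrite mulr1 (bigD1 (blk y)) //= [X in _ * X]big1; last first.
  by move=> j jy; rewrite [blk y == j]eq_sym (negPf jy) !andbF.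
by rewrite mulr1 !eqxx !andbT.
Qed.

Lemma roots_pair_prod (F : C -> C -> C) :
  \prod_(i < N) \prod_(j < N | (i < j)%N)
    \prod_(a < part lam i) \prod_(b < part lam j) F (g a) (g b) = pair_prod F.
Proof.
rewrite -sets_pair_prod; apply: eq_bigr => i _; apply: eq_bigr => j _.
transitivity (\prod_(a < part lam i) \prod_(y in J j) F (g a) (z y)).
  by apply: eq_bigr => a _; exact: (fixed_prod (F (g a)) j).
exact: (fixed_prod (fun w => \prod_(y in J j) F w (z y)) i).
Qed.

Lemma pair_prodM F G : pair_prod F * pair_prod G = pair_prod (fun x y => F x y * G x y).
Proof. by rewrite -big_split; apply: eq_bigr => x _; rewrite -big_split. Qed.

Lemma eq_pair_prod F G : (forall x y, x != y -> F (z x) (z y) = G (z x) (z y)) ->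
  pair_prod F = pair_prod G.
Proof.
move=> h; apply: eq_bigr => x _; apply: eq_bigr => y xy; apply: h.
by apply: contraTneq xy => ->; rewrite ltnn.
Qed.

(** A pair x, y with x in an earlier block than y is met exactly at one
    level j, the one for which y lies in the block following the first j. *)
Lemma levels_pair_prod (F : C -> C -> C) :
  \prod_(1 <= j < N) \prod_(x in blocks_upto J j)
     \prod_(y in blocks_upto J j.+1 | y \notin blocks_upto J j) F (z x) (z y)
  = pair_prod F.
Proof.
rewrite /pair_prod.
transitivity (\prod_(j < N) \prod_x \prod_y
   (if (blk x < j)%N && (blk y == j) then F (z x) (z y) else 1)).
  rewrite -(big_mkord xpredT (fun j => \prod_x \prod_y
   (if (blk x < j)%N && (val (blk y) == j) then F (z x) (z y) else 1))).
  rewrite [RHS]big_ltn; last by exact: leq_ltn_trans (ltn_ord i0).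
  rewrite [X in X * _]big1 ?mul1r; last by move=> x _; rewrite big1.
  apply: eq_bigr => j _; rewrite big_mkcond; apply: eq_bigr => x _.
  rewrite (blocks_uptoP JP i0); case: (blk x < j)%N => /=; last by rewrite big1.
  rewrite big_mkcond; apply: eq_bigr => y _; rewrite !(blocks_uptoP JP i0).
  by rewrite -leqNgt ltnS -eqn_leq.
rewrite exchange_big; apply: eq_bigr => x _; rewrite exchange_big [RHS]big_mkcond.
apply: eq_bigr => y _; rewrite (bigD1 (blk y)) //= [X in _ * X]big1 ?mulr1.
  by rewrite eqxx andbT.
by move=> j jy; rewrite [_ == j]eq_sym (negPf jy) andbF.
Qed.

Lemma pair_prodN1 : pair_prod (fun _ _ => -1) = (-1) ^+ fldim lam.
Proof.
rewrite -roots_pair_prod /fldim expr_sum; apply: eq_bigr => i _.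
rewrite expr_sum; apply: eq_bigr => j _.
by rewrite !prodr_const !card_ord -exprM mulnC.
Qed.

End FixedPoint.

(** * The symmetrized weight at the unshifted point *)

Section Symmetrization.
Variables (R : realType) (N : nat) (lam : N.-tuple nat).
Local Notation n := (psum lam N).
Implicit Types t s : tfam R lam.

(** The points at which the terms of Sym_t are evaluated; the top level, which
    carries the Chern roots, is fixed. *)
Definition relabelled t t' : Prop :=
  (forall j, (1 <= j < N)%N -> exists p : 'S_(psum lam j), forall a, t' j a = t j (p a))
  /\ t' N = t N.

Lemma relabelled_refl t : relabelled t t.
Proof. by split=> // j _; exists 1%g => a; rewrite perm1. Qed.

Lemma relabelled_set t t' j (p : 'S_(psum lam j)) : (j < N)%N -> relabelled t t' ->
  relabelled t (set_level t' (fun a => t' j (p a))).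
Proof.
move=> jN [h hN]; split; last by rewrite set_level_neq // gtn_eqF.
move=> k kN; have [q hq] := h k kN.
have [kj|kj] := eqVneq k j; last by exists q => a; rewrite set_level_neq.
by subst k; exists (p * q)%g => a; rewrite set_levelE hq permM.
Qed.

Local Notation sym h l := (foldr (fun j f => Sym_level j f) (What_term h) l).

Lemma sym_eq0 h (l : seq nat) s t : all (fun j => j < N)%N l -> relabelled s t ->
  (forall t', relabelled s t' -> What_term h t' = 0) -> sym h l t = 0.
Proof.
move=> + + h0; elim: l t => [|j l IH] t /=; first by move=> _ /h0.
move=> /andP[jN lN] st; rewrite /Sym_level big1 // => p _.
by apply: IH => //; exact: relabelled_set.
Qed.

Definition replace (t0 : tfam R lam) (l : seq nat) t : tfam R lam :=
  fun j => if j \in l then t0 j else t j.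

(** The sum has at most one nonzero term when the levels of the points where
    the summand does not vanish are prescribed; the permutation of each
    level that produces them is unique. *)
Lemma sym_single h (l : seq nat) s t0 t :
  uniq l -> all (fun j => 1 <= j < N)%N l -> relabelled s t ->
  (forall j, (1 <= j < N)%N -> injective (s j)) ->
  relabelled s t0 ->
  (forall t', relabelled s t' -> What_term h t' != 0 ->
     forall j, (1 <= j < N)%N -> t' j = t0 j) ->
  sym h l t = What_term h (replace t0 l t).
Proof.
move=> ul lN st sinj st0 only.
have rep l' t' : all (fun j => 1 <= j < N)%N l' -> relabelled s t' -> relabelled s (replace t0 l' t').
  move=> /allP l'N [h1 h2]; split.
    by move=> j jN; rewrite /replace; case: ifP => _; [exact: st0.1 | exact: h1].
  by rewrite /replace; case: ifP => // /l'N; rewrite ltnn andbF.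
elim: l t ul lN st => [|j l IH] t /=.
  by move=> _ _ _; congr What_term; apply: functional_extensionality_dep.
move=> /andP[jl ul] /andP[jN lN] st; have /andP[j1 jN'] := jN.
have [p hp] := st.1 j jN; have [q hq] := st0.1 j jN.
pose p0 : 'S_(psum lam j) := (q * p^-1)%g.
have hp0 a : t j (p0 a) = t0 j a by rewrite hp /p0 permM permKV hq.
pose t_ (p : 'S_(psum lam j)) := set_level t (fun a => t j (p a)).
have st_ p' : relabelled s (t_ p') by exact: relabelled_set.
have -> : Sym_level j (sym h l) t = \sum_(p' : 'S_(psum lam j)) What_term h (replace t0 l (t_ p')).
  by apply: eq_bigr => p' _; apply: IH => //; exact: st_.
rewrite (bigD1 p0) //= big1 ?addr0.
  congr What_term; apply: functional_extensionality_dep => k; rewrite /replace inE.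
  have [kj|kj] := eqVneq k j.
    subst k; rewrite (negPf jl) /= /t_ set_levelE; apply/funext => a; exact: hp0.
  by rewrite /=; case: ifP => // _; rewrite /t_ set_level_neq.
move=> p' pp0; apply/eqP; apply: contraNT pp0 => /(only _ (rep _ _ lN (st_ p')) ) /(_ j jN).
rewrite /replace (negPf jl) /t_ set_levelE => e.
apply/eqP/permP => a; have := congr1 (fun f => f a) e; rewrite /= -hp0 !hp.
by move=> /(sinj j jN)/perm_inj.
Qed.

(** Going down from the top level, t_a is the entry c of the level above. The
    factors with d > a force c <= a, and c < a is excluded by induction on a:
    the entry c of the level of a would have the same value as t_a. *)
Lemma What_term_neq0 h t : (forall j, (1 <= j <= N)%N -> injective (t j)) ->
  (forall j, (1 <= j < N)%N -> forall a, exists c, t j a = t j.+1 c) ->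
  What_term h t != 0 ->
  forall j, (1 <= j <= N)%N -> forall (a : 'I_(psum lam j)) (b : 'I_n),
    a = b :> nat -> t j a = t N b.
Proof.
move=> tinj tsub.
move=> t0 j /andP[j1 jN]; rewrite -(subKn jN).
have : (N - j < N)%N by rewrite ltn_subrL j1 (leq_trans j1 jN).
move: (N - j)%N => e {j j1 jN}; elim: e => [|d IH] dN.
  by rewrite subn0 => a b ab; congr (t N); exact: val_inj.
set j := (N - d.+1)%N.
have jS : (N - d)%N = j.+1 by rewrite /j; lia.
have j1 : (1 <= j < N)%N by rewrite /j; lia.
have {}IH := IH (ltnW dN); rewrite jS in IH.
have tj1 (a : 'I_(psum lam j)) (e : 'I_(psum lam j.+1)) :
    (a < e)%N -> t j a != t j.+1 e.
  move=> ae; apply: contra t0 => /eqP tae.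
  rewrite /What_term (bigD1_seq j) ?iota_uniq ?mem_index_iota //=.
  rewrite (bigD1 a) //= (bigD1 (F := fun d => t j a - t j.+1 d) e) //= tae subrr.
  by rewrite !(mul0r, mulr0).
have pS : (psum lam j <= psum lam j.+1)%N by exact: psum_le.
have pN : (psum lam j.+1 <= n)%N by apply: psum_le; case/andP: j1.
move=> a; have [m] := ubnP (val a); elim: m a => // m IHm a am b ab.
have [c hc] := tsub j j1 a.
have ca : (c <= a)%N.
  by rewrite leqNgt; apply/negP => ac; have := tj1 a c ac; rewrite hc eqxx.
pose c' := widen_ord pN c.
have tc : t j.+1 c = t N c' by apply: IH.
move: ca; rewrite leq_eqVlt => /predU1P[ca|ca].
  by rewrite hc tc; congr (t N); apply: val_inj; rewrite /= ca ab.
have hca : (c < psum lam j)%N by exact: ltn_trans ca (ltn_ord a).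
have := IHm (Ordinal hca) (leq_trans ca am) c' (erefl _).
rewrite -tc -hc => /tinj e; have j1' : (1 <= j <= N)%N by move: j1; lia.
by have := congr1 val (e j1'); move=> /= ec; rewrite ec ltnn in ca.
Qed.

End Symmetrization.

Lemma big_bnth_cond (N : nat) (lam : N.-tuple nat) (I : 'I_N -> {set 'I_(psum lam N)})
    (IP : ordered_partition I) (x0 : 'I_(psum lam N)) (T : Type) (idx : T)
    (op : Monoid.com_law idx) j (P : pred 'I_(psum lam N)) (F : 'I_(psum lam N) -> T) :
  (j <= N)%N ->
  \big[op/idx]_(a < psum lam j | P (bnth I x0 a)) F (bnth I x0 a) =
  \big[op/idx]_(x in blocks_upto I j | P x) F x.
Proof.
move=> jN; rewrite big_mkcond (big_bnth IP x0 op (fun x => if P x then F x else idx)) //.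
by rewrite -big_mkcondr.
Qed.

Section WhatValue.
Variables (R : realType) (N : nat) (lam : N.-tuple nat).
Local Notation C := R[i].
Local Notation n := (psum lam N).
Variables (I J : 'I_N -> {set 'I_n}) (IP : ordered_partition I) (JP : ordered_partition J).
Variables (x0 : 'I_n) (z : 'I_n -> C) (zinj : injective z).
Variables (g : chern_roots R lam) (gJ : at_fixed_point z J g).
Variable s : tfam R lam.
Arguments s : clear implicits.
Local Notation bnth := (bnth I x0).
Hypothesis sE : forall j (a : 'I_(psum lam j)), (j <= N)%N -> s j a = z (bnth a).
Local Notation gam := (concat_roots g).
Let S : tfam R lam := set_level s gam.
Arguments S : clear implicits.

Let SN : S N = gam. Proof. exact: set_levelE. Qed.
Let Sj j : (j < N)%N -> S j = s j.
Proof. by move=> jN; rewrite /S set_level_neq // ltn_eqF. Qed.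

(** The Chern roots at a fixed point enumerate the coordinates of z. *)
Lemma concat_perm (K : 'I_N -> {set 'I_n}) : ordered_partition K -> at_fixed_point z K g ->
  exists p : 'S_n, forall b, gam b = z (p b).
Proof.
move=> KP gK.
have ex b : exists x, gam b = z x.
  by have [x _ e] := concat_mem gK (leqnn N) (ltn_ord b); exists x.
have [f hf] := choice ex.
have finj : injective f.
  by move=> a b e; apply: (concat_inj KP zinj gK); rewrite !hf e.
by exists (perm finj) => b; rewrite permE.
Qed.

Let level_points t j : relabelled S t -> (1 <= j <= N)%N ->
  exists p : 'S_(psum lam j), forall a, t j a = z (bnth (p a)).
Proof.
move=> [h1 h2] /andP[j1]; rewrite leq_eqVlt => /predU1P[jN|jN].
  subst j; have [p hp] := concat_perm JP gJ; exists p => a.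
  by rewrite h2 SN hp bnthN.
have [|p hp] := h1 j; first by rewrite j1.
by exists p => a; rewrite hp Sj // sE // ltnW.
Qed.

Let level_points_inj t j : relabelled S t -> (1 <= j <= N)%N -> injective (t j).
Proof.
move=> st j1; have [p hp] := level_points st j1 => a b; rewrite !hp => /zinj/(bnth_inj IP).
by case/andP: j1 => _ jN /(_ jN)/perm_inj.
Qed.

(** The hypotheses of [What_term_neq0] hold for all the relabellings of the
    point s. *)
Lemma nonzero_prefix h t : relabelled S t -> What_term h t != 0 ->
  forall j, (1 <= j <= N)%N -> forall (a : 'I_(psum lam j)) (b : 'I_n),
    a = b :> nat -> t j a = gam b.
Proof.
move=> st t0 j j1 a b ab; rewrite -SN -st.2.
apply: (What_term_neq0 _ _ t0) ab => //.
  by move=> k k1; exact: (level_points_inj st).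
move=> k /andP[k1 kN] c.
have [p hp] := level_points st (introT andP (conj k1 (ltnW kN))).
have [q hq] := @level_points t k.+1 st kN.
have [e he] := parent_exists IP x0 (p c) kN.
by exists (q^-1 e)%g; rewrite hp hq permKV he.
Qed.

(** A nonzero term would identify the first psum j Chern roots, which belong
    to the first j blocks of J, with the coordinates of level j, which
    belong to those of I. *)
Lemma What_other h : I <> J -> What h s g = 0.
Proof.
move=> IJ; apply: (sym_eq0 _ (relabelled_refl _)).
  by apply/allP => j; rewrite mem_iota; lia.
move=> t st; apply: contra_notP IJ => /eqP t0.
apply: (blocks_upto_inj IP JP) => j jN; apply/fintype.subsetP => x xI.
move: jN; rewrite leq_eqVlt => /predU1P[->|jN]; first by rewrite (blocks_upto_all JP) inE.
case: (posnP j) => [j0|j1].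
  by move: xI; rewrite j0 /blocks_upto big_pred0 ?inE.
have j1N : (1 <= j <= N)%N by rewrite j1 ltnW.
have [a0 ha] := bnth_surj IP x0 (ltnW jN) xI.
have [p hp] := level_points st j1N.
pose a := (p^-1 a0)%g.
have aN : (a < n)%N by apply: leq_trans (psum_le lam (ltnW jN)).
have := nonzero_prefix st t0 j1N (b := Ordinal aN) (erefl (val a)).
rewrite hp permKV ha.
have [y yJ ->] := concat_mem gJ (ltnW jN) (b := Ordinal aN) (ltn_ord a).
by move=> /zinj ->.
Qed.

Hypothesis IJ : I = J.

Let prefix : tfam R lam := fun j a =>
  if insub (val a) : option 'I_n is Some b then gam b else 0.

Arguments prefix : clear implicits.

Let prefixE j (a : 'I_(psum lam j)) (b : 'I_n) : a = b :> nat -> prefix j a = gam b.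
Proof.
move=> ab; rewrite /prefix; case: insubP => [u _ hu|]; last by rewrite /= ab ltn_ord.
by congr gam; apply: val_inj; rewrite hu /= ab.
Qed.

(** The only relabelling of the point s that contributes: every level lists
    the first Chern roots in order. *)
Let target : tfam R lam := set_level prefix gam.

Arguments target : clear implicits.

Let targetE j (a : 'I_(psum lam j)) (b : 'I_n) : a = b :> nat -> target j a = gam b.
Proof.
rewrite /target; have [jN|jN] := eqVneq j N.
  by subst j; rewrite set_levelE => /val_inj ->.
by rewrite set_level_neq //; exact: prefixE.
Qed.

Let target_relabelled : relabelled S target.
Proof.
split; last by rewrite SN /target set_levelE.
move=> j /andP[j1 jN].
have ex (a : 'I_(psum lam j)) : exists b : 'I_(psum lam j), target j a = z (bnth b).
  have aN : (a < n)%N by apply: leq_trans (psum_le lam (ltnW jN)).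
  have [x xJ e] := concat_mem gJ (ltnW jN) (b := Ordinal aN) (ltn_ord a).
  rewrite -IJ in xJ; have [b hb] := bnth_surj IP x0 (ltnW jN) xJ.
  by exists b; rewrite hb -e; exact: targetE.
have [f hf] := choice ex.
have finj : injective f.
  move=> a b e.
  have aN : (a < n)%N by apply: leq_trans (psum_le lam (ltnW jN)).
  have bN : (b < n)%N by apply: leq_trans (psum_le lam (ltnW jN)).
  have := hf b; rewrite -e -hf (@targetE _ a (Ordinal aN)) // (@targetE _ b (Ordinal bN)) //.
  by move=> /(concat_inj JP zinj gJ) /(congr1 val) /= ab; exact: val_inj.
by exists (perm finj) => a; rewrite hf permE Sj // sE // ltnW.
Qed.

Lemma What_single h : What h s g = What_term h target.
Proof.
rewrite /What /Sym_t (@sym_single R N lam h (iota 1 N.-1) S target S).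
- have e (j : nat) : (1 <= j <= N)%N -> @replace R N lam target (iota 1 N.-1) S j = target j.
    move=> /andP[j1 jN]; rewrite /replace mem_iota; case: ifP => // /negbT.
    rewrite j1 /= -ltnNge => jN'; have jE : j = N by lia.
    by subst j; rewrite SN /target set_levelE.
  apply: eq_big_nat => j /andP[j1 jN].
  by rewrite !e ?j1 // ltnW.
- exact: iota_uniq.
- by apply/allP => j; rewrite mem_iota; lia.
- exact: relabelled_refl.
- by move=> j /andP[j1 jN]; apply: (level_points_inj (relabelled_refl _)); rewrite j1 ltnW.
- exact: target_relabelled.
- move=> t st t0 j /andP[j1 jN]; apply/funext => a.
  have aN : (a < n)%N by apply: leq_trans (psum_le lam (ltnW jN)).
  rewrite (@targetE _ a (Ordinal aN)) //; apply: (nonzero_prefix st t0) => //.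
  by rewrite j1 ltnW.
Qed.

(** These factors of the level j occur in the numerator of the weight W and
    in the denominator of the master function. *)
Definition level_prod h j : C :=
  \prod_(x in blocks_upto I j) \prod_(y in blocks_upto I j | y != x) (z x - z y - h).

(** In the contributing term, the factors of the level j indexed by c < a
    and by b > a combine into the ordered pairs of the level, and the
    denominators cancel the factors t_a - t_b with b > a. The factors with d
    beyond the level j remain. *)
Lemma What_same h : What h s g =
  \prod_(1 <= j < N) (level_prod h j *
     \prod_(x in blocks_upto I j)
       \prod_(y in blocks_upto I j.+1 | y \notin blocks_upto I j) (z x - z y)).
Proof.
rewrite What_single; apply: eq_big_nat => j /andP[j1 jN].
have jN1 : (1 <= j <= N)%N by rewrite j1 ltnW.
have [p hp] := level_points target_relabelled jN1.
have [q hq] := @level_points target j.+1 target_relabelled jN.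
pose w (a : 'I_(psum lam j)) : 'I_(psum lam j.+1) := widen_ord (psum_le lam (leqnSn j)) a.
have tw (a : 'I_(psum lam j)) : target j.+1 (w a) = target j a.
  have aN : (a < n)%N by apply: leq_trans (psum_le lam (ltnW jN)).
  by rewrite (@targetE _ a (Ordinal aN)) // (@targetE _ (w a) (Ordinal aN)).
have q_outside (d : 'I_(psum lam j.+1)) : (psum lam j <= d)%N = (bnth (q d) \notin blocks_upto I j).
  rewrite leqNgt; congr (~~ _); apply/idP/idP => [dj|].
    have -> : d = w (Ordinal dj) by exact: val_inj.
    have -> : bnth (q (w (Ordinal dj))) = bnth (p (Ordinal dj)).
      by apply: zinj; rewrite -hq -hp tw.
    by apply: bnth_mem => //; exact: ltnW.
  move=> /(bnth_surj IP x0 (ltnW jN)) [b hb].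
  have : target j.+1 d = target j.+1 (w (p^-1 b)%g) by rewrite tw hp permKV hb hq.
  by move=> /(level_points_inj target_relabelled (j := j.+1) jN) ->; exact: (ltn_ord (p^-1 b)%g).
transitivity (\prod_(a < psum lam j)
   ((\prod_(b < psum lam j | b != a) (target j a - target j b - h)) *
     \prod_(d < psum lam j.+1 | (psum lam j <= d)%N) (target j a - target j.+1 d))).
  pose G (k : nat) : C := if insub k : option 'I_n is Some b then gam b else 0.
  have GE k (c : 'I_(psum lam k)) : (k <= N)%N -> target k c = G c.
    move=> kN; have cN : (c < n)%N by apply: leq_trans (psum_le lam kN).
    by rewrite (@targetE _ c (Ordinal cN)) // /G insubT.
  apply: eq_bigr => a _; have jN' := ltnW jN.
  have -> : \prod_(c < psum lam j.+1 | (c < a)%N) (target j a - target j.+1 c - h) =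
      \prod_(b < psum lam j | (b < a)%N) (target j a - target j b - h).
    rewrite (eq_bigr (fun c : 'I_(psum lam j.+1) => target j a - G c - h)); last first.
      by move=> c _; rewrite (GE _ c).
    rewrite [RHS](eq_bigr (fun c : 'I_(psum lam j) => target j a - G c - h)); last first.
      by move=> c _; rewrite (GE _ c).
    rewrite (big_ord_widen_cond _ (fun c => (c < a)%N) (fun c => target j a - G c - h)
      (psum_le lam (leqnSn j))).
    apply: eq_bigl => c; case: ltnP => //= ca; exact/esym/(ltn_trans ca).
  have -> : \prod_(d < psum lam j.+1 | (a < d)%N) (target j a - target j.+1 d) =
      (\prod_(b < psum lam j | (a < b)%N) (target j a - target j b)) *
      \prod_(d < psum lam j.+1 | (psum lam j <= d)%N) (target j a - target j.+1 d).
    rewrite (bigID (fun d : 'I_(psum lam j.+1) => (d < psum lam j)%N)) /=; congr (_ * _).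
      rewrite (eq_bigr (fun c : 'I_(psum lam j.+1) => target j a - G c)); last first.
        by move=> c _; rewrite (GE _ c).
      rewrite [RHS](eq_bigr (fun c : 'I_(psum lam j) => target j a - G c)); last first.
        by move=> c _; rewrite (GE _ c).
      by rewrite (big_ord_widen_cond _ (fun c => (a < c)%N) (fun c => target j a - G c)
        (psum_le lam (leqnSn j))).
    by apply: eq_bigl => d; rewrite -leqNgt; apply: andb_idl => /(leq_trans (ltn_ord a)).
  rewrite big_split /= prodfV.
  have nz : \prod_(b < psum lam j | (a < b)%N) (target j a - target j b) != 0.
    apply/prodf_neq0 => b ab; rewrite subr_eq0; apply: contraTneq ab.
    by move=> /(level_points_inj target_relabelled jN1) ->; rewrite ltnn.
  rewrite [X in _ = X * _](bigID (fun b : 'I_(psum lam j) => (b < a)%N)) /=.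
  rewrite (eq_bigl (fun b : 'I_(psum lam j) => (b < a)%N) (fun b => target j a - target j b - h)
    (P1 := fun b : 'I_(psum lam j) => (b != a) && (b < a)%N)); last first.
    by move=> b; rewrite -val_eqE /=; case: ltngtP.
  rewrite (eq_bigl (fun b : 'I_(psum lam j) => (a < b)%N) (fun b => target j a - target j b - h)
    (P1 := fun b : 'I_(psum lam j) => (b != a) && ~~ (b < a)%N)); last first.
    by move=> b; rewrite -val_eqE /=; case: ltngtP.
  by field.
pose H x := (\prod_(y in blocks_upto I j | y != x) (z x - z y - h)) *
  \prod_(y in blocks_upto I j.+1 | y \notin blocks_upto I j) (z x - z y).
transitivity (\prod_(a < psum lam j) H (bnth (p a))).
  apply: eq_bigr => a _; congr (_ * _).
    rewrite -(big_bnth_cond IP x0 _ (fun y => y != bnth (p a)) (fun y => z (bnth (p a)) - z y - h) (ltnW jN)).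
    rewrite [RHS](reindex_inj (@perm_inj _ p)); apply: eq_big => b; last by rewrite !hp.
    by rewrite (inj_eq (bnth_inj IP (ltnW jN))) (inj_eq (@perm_inj _ p)).
  rewrite -(big_bnth_cond IP x0 _ (fun y => y \notin blocks_upto I j) (fun y => z (bnth (p a)) - z y) jN).
  rewrite [RHS](reindex_inj (@perm_inj _ q)); apply: eq_big => b; last by rewrite hp hq.
  exact: q_outside.
rewrite -(reindex_inj (@perm_inj _ p) (P := xpredT) (F := fun a => H (bnth a))) /=.
by rewrite (big_bnth IP x0 _ H) ?(ltnW jN) // big_split.
Qed.

End WhatValue.

(** * The summand of the zero shift *)

Section LeadingCoefficient.
Variables (R : realType) (N : nat) (lam : N.-tuple nat).
Local Notation C := R[i].
Local Notation n := (psum lam N).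
Variables (I : 'I_N -> {set 'I_n}) (IP : ordered_partition I).
Variables (x0 : 'I_n) (i0 : 'I_N) (z : 'I_n -> C) (h : C).
Hypothesis hz : forall a b, a != b -> notint (z a - z b).
Hypothesis hzh : forall a b, a != b -> notint (z a - z b - h).
Local Notation bnth := (bnth I x0).

(** The factor phi(t_a - t_b) of the master function inside the level j
    cancels the one between a and the copy of b in the level j + 1. What
    remains pairs the variables of the level j with the new points of the
    level j + 1. *)
Lemma regular_point (s : tfam R lam) :
  (forall j (a : 'I_(psum lam j)), (j <= N)%N -> s j a = z (bnth a)) ->
  regular I x0 h s =
  (\prod_(1 <= j < N) level_prod I z h j)^-1 * pair_prod I z i0 (fun x y => gpair h (x - y)).
Proof.
move=> sE; rewrite -(levels_pair_prod IP) -prodfV -big_split.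
apply: eq_big_nat => j /andP[j1 jN]; have jN' := ltnW jN.
pose A x := \prod_(y in blocks_upto I j | y != x) (z x - z y - h).
pose B x := \prod_(y in blocks_upto I j | y != x) gpair h (z x - z y).
pose D x := \prod_(y in blocks_upto I j.+1 | y \notin blocks_upto I j) gpair h (z x - z y).
transitivity (\prod_(a < psum lam j) ((A (bnth a))^-1 * D (bnth a))); last first.
  by rewrite (big_bnth IP x0 _ (fun x => (A x)^-1 * D x)) // big_split /= prodfV.
apply: eq_bigr => a _.
have neq (b : 'I_(psum lam j)) : (b != a) = (bnth b != bnth a) by rewrite (inj_eq (bnth_inj IP jN')).
have -> : \prod_(b < psum lam j | b != a) ((s j a - s j b - h) * gpair h (s j a - s j b))^-1 =
    (A (bnth a))^-1 * (B (bnth a))^-1.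
  rewrite -invfM -big_split /= -prodfV.
  rewrite -(big_bnth_cond IP x0 _ (fun y => y != bnth a) (fun y =>
    ((z (bnth a) - z y - h) * gpair h (z (bnth a) - z y))^-1) jN').
  by apply: eq_big => b; rewrite ?neq // !sE.
have -> : \prod_(c < psum lam j.+1 | Some c != parent I x0 a) gpair h (s j a - s j.+1 c) =
    B (bnth a) * D (bnth a).
  have [c0 -> zc0] := parentP IP x0 a jN.
  transitivity (\prod_(y in blocks_upto I j.+1 | y != bnth a) gpair h (z (bnth a) - z y)).
    rewrite -(big_bnth_cond IP x0 _ (fun y => y != bnth a) (fun y => gpair h (z (bnth a) - z y)) jN).
    apply: eq_big => c; last by rewrite !sE.
    by rewrite -zc0 (inj_eq (bnth_inj IP jN)); apply/idP/idP; apply: contra => /eqP; [move=> -> | case=> ->].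
  have am : bnth a \in blocks_upto I j by exact: bnth_mem.
  rewrite (bigID (mem (blocks_upto I j))) /=; congr (_ * _); apply: eq_bigl => y.
    rewrite (blocks_uptoS I jN) inE.
    by case: (y \in blocks_upto I j); rewrite /= ?andbT ?andbF.
  rewrite -andbA; congr (_ && _); rewrite andbC; apply: andb_idr.
  by apply: contraNneq => ->.
have B0 : B (bnth a) != 0.
  apply/prodf_neq0 => y /andP[_]; rewrite eq_sym => ya.
  by apply: gpair_neq0; [exact: hz | exact: hzh].
by rewrite mulrA mulfVK.
Qed.

Lemma gamma_reflection (u : C) : notint u -> notint (u - h) ->
  -1 * (gpair h u * ((u - h) * u)) = cGamma (1 - u) * cGamma (1 + u - h).
Proof.
move=> h1 h2; rewrite /gpair.
have -> : 1 - u = - u + 1 by ring.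
have -> : 1 + u - h = (u - h) + 1 by ring.
rewrite (cGammaS (notint_nopole (notintN h1))) (cGammaS (notint_nopole h2)).
ring.
Qed.

Lemma Delta_same g : injective z -> at_fixed_point z I g -> Delta I z g = 1.
Proof.
move=> zinj gI; rewrite /Delta.
set u := (X in X / _); set v := (X in _ / X).
have -> : u = v.
  apply: eq_bigr => i _; apply: eq_bigr => j _.
  exact: (fixed_prod gI (fun w => \prod_(b in I j) (w - z b)) i).
rewrite divff // /v (sets_pair_prod IP z i0 (fun x y => x - y)).
apply/prodf_neq0 => x _; apply/prodf_neq0 => y xy; rewrite subr_eq0 (inj_eq zinj).
by apply: contraTneq xy => ->; rewrite ltnn.
Qed.

(** Some x lies in J_i and in I_j with i < j, since otherwise the initial
    unions of J would be contained in those of I; the numerator then has a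
    zero factor. *)
Lemma Delta_other J g : ordered_partition J -> at_fixed_point z J g -> I <> J ->
  Delta I z g = 0.
Proof.
move=> JP gJ IJ; apply: contra_notP (nesym IJ) => D0.
have {}D0 : \prod_(i < N) \prod_(j < N | (i < j)%N)
    \prod_(a < part lam i) \prod_(b in I j) (g i a - z b) != 0.
  by apply/eqP => e; apply: D0; rewrite /Delta e mul0r.
apply: (blocks_upto_inj JP IP) => k kN; apply/fintype.subsetP => x.
rewrite (blocks_uptoP JP i0) (blocks_uptoP IP i0); set i := block J x i0; set j := block I x i0.
move=> ik; rewrite ltnNge; apply/negP => kj; move: D0; apply/negP; rewrite negbK.
have ij : (i < j)%N by exact: leq_trans kj.
have : z x \in [seq g i a | a <- enum 'I_(part lam i)].
  by rewrite (perm_mem (gJ i)) map_f // mem_enum mem_block.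
case/mapP => a _ e; apply/prodf_eq0; exists i => //.
apply/prodf_eq0; exists j => //; apply/prodf_eq0; exists a => //.
by apply/prodf_eq0; exists x; rewrite ?mem_block // -e subrr.
Qed.

Definition zero_shift : (nvars lam).-tuple nat := nseq_tuple (nvars lam) 0%N.

Lemma shift_zero j (a : 'I_(psum lam j)) : shift_ zero_shift a = 0%N.
Proof. by rewrite /shift_ nth_nseq; case: ifP. Qed.

(** The contribution of r = 0, without exponentials. All the factors are
    products over the pairs of different blocks, once those inside the
    levels have cancelled. *)
Lemma summand_zero J g : ordered_partition J -> at_fixed_point z J g ->
  (-1) ^+ (nvars lam + fldim lam) * summand I x0 z g h zero_shift = gamma_class h g * Delta I z g.
Proof.
move=> JP gJ.
have zinj : injective z.
  move=> a b e; apply/eqP/negPn/negP => /hz/(_ 0); by rewrite e subrr eqxx.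
have sE j (a : 'I_(psum lam j)) : (j <= N)%N -> Sigma_shift I z 1 zero_shift a = z (bnth a).
  by move=> jN; rewrite (Sigma_shiftE IP x0) // shift_zero addr0.
have [IJ|IJ] := pselect (I = J); last first.
  by rewrite /summand (What_other IP JP zinj gJ sE) // (Delta_other JP gJ IJ) !mulr0.
subst J; rewrite (Delta_same zinj gJ) mulr1 /summand (What_same IP IP zinj gJ sE) //.
rewrite (regular_point sE) big_split /= (levels_pair_prod IP z i0 (fun x y => x - y)).
rewrite /Qclass (roots_pair_prod IP gJ i0 (fun x y => x - y - h)).
rewrite /gamma_class (roots_pair_prod IP gJ i0 (fun x y => cGamma (1 + y - x) * cGamma (1 + x - y - h))).
have -> : \prod_(v <- tvars lam)
    pole_coef h (shift_ zero_shift (tagged v)) (shift_ zero_shift (tagged (par I x0 v))) = (-1) ^+ nvars lam.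
  rewrite -size_tvars; elim: (tvars lam) => [|v l IH]; first by rewrite big_nil.
  by rewrite big_cons IH !shift_zero /pole_coef leqnn subnn binc0 expr0 exprS; ring.
have lp0 : \prod_(1 <= j < N) level_prod I z h j != 0.
  rewrite prodf_seq_neq0; apply/allP => j _; apply/implyP => _.
  apply/prodf_neq0 => x _; apply/prodf_neq0 => y /andP[_]; rewrite eq_sym => /hzh/(_ 0).
  by [].
set lp := \prod_(1 <= j < N) _ in lp0 *.
transitivity ((-1) ^+ fldim lam * (pair_prod I z i0 (fun x y => gpair h (x - y)) *
   (pair_prod I z i0 (fun x y => x - y - h) * pair_prod I z i0 (fun x y => x - y)))).
  rewrite exprD; set e := (-1) ^+ nvars lam.
  have ee : e * e = 1 by rewrite /e -exprD addnn -mul2n exprM sqrrN expr1n expr1n.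
  set f := (-1) ^+ _; transitivity (e * e * (lp / lp) * (f * (pair_prod I z i0 (fun x y => gpair h (x - y)) *
   (pair_prod I z i0 (fun x y => x - y - h) * pair_prod I z i0 (fun x y => x - y))))); first by ring.
  by rewrite ee divff // !mul1r.
rewrite -(pair_prodN1 IP gJ i0) !pair_prodM; apply: eq_pair_prod => x y xy.
have -> : 1 + z y - z x = 1 - (z x - z y) by ring.
have -> : 1 + z x - z y - h = 1 + (z x - z y) - h by ring.
by rewrite -gamma_reflection; [ | exact: hz | exact: hzh].
Qed.

End LeadingCoefficient.

(** * The exponential factors *)

(** Summation by parts. *)
Lemma abel_sum (V : comNzRingType) (S y : nat -> V) (N : nat) : S 0%N = 0 -> (0 < N)%N ->
  S N * y N.-1 + \sum_(1 <= j < N) S j * (y j.-1 - y j) = \sum_(i < N) (S i.+1 - S i) * y i.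
Proof.
move=> S0; case: N => // N _; elim: N => [|N IH].
  by rewrite big_geq // big_ord_recr big_ord0 /= S0 subr0 addr0 add0r.
rewrite big_ord_recr -IH big_nat_recr //=; ring.
Qed.

Section Exponentials.
Variables (R : realType) (N : nat) (lam : N.-tuple nat).
Local Notation C := R[i].
Local Notation n := (psum lam N).
Local Notation K := ((nvars lam).-tuple nat).
Variables (I : 'I_N -> {set 'I_n}) (IP : ordered_partition I) (x0 : 'I_n).
Variables (z : 'I_n -> C) (N_gt0 : (0 < N)%N).
Implicit Type lq : N.-tuple C.

(** The exponents of the ratios q_j / q_(j+1) contributed by the shift. *)
Definition deg (r : K) : {ffun 'I_N.-1 -> nat} :=
  [ffun i : 'I_N.-1 => (\sum_(a < psum lam i.+1) shift_ r a)%N].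

(** The contribution of the signs exp(pi i (lambda_(j+1) - lambda_j)); it
    has modulus 1. *)
Definition phase (r : K) : C :=
  \prod_(1 <= j < N) cexp (- ((\sum_(a < psum lam j) shift_ r a)%N%:R *
    (pi%:C * 'i * ((part lam j)%:Z - (part lam j.-1)%:Z)%:~R))).

Definition block_sum (i : 'I_N) : C := \sum_(x in I i) z x.

(** The part of the exponential of the Chern classes at x_I that does not
    involve q. *)
Definition chern_phase : C :=
  \prod_(i < N) cexp (block_sum i * (pi%:C * 'i * ((part lam i)%:Z - n%:Z)%:~R)).

Lemma chern_expE lq g : at_fixed_point z I g ->
  chern_exp lq g = chern_phase * leading_factor I z 1 lq.
Proof.
move=> gI; rewrite /chern_exp /chern_phase /leading_factor -big_split /=.
apply: eq_bigr => i _; rewrite /twpow -cexpD divr1 -mulrDr.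
have -> // : c1 i g = block_sum i.
rewrite /c1 /block_sum -[RHS]big_enum -[LHS]big_enum /= -(big_map z xpredT id) -(perm_big _ (gI i)) /=.
by rewrite big_map.
Qed.

Lemma nth_opp lq k : (map_tuple -%R lq : seq C)`_k = - lq`_k.
Proof.
have [kN|kN] := ltnP k N; first by rewrite (nth_map 0) ?size_tuple.
by rewrite !nth_default ?oppr0 // ?size_map size_tuple.
Qed.

(** The exponent is the sum over the levels of the differences of log q_j +
    pi i lambda_j, weighted by the sums of the coordinates; [abel_sum]
    converts it into a sum over the blocks. *)
Lemma expoE lq (r : K) : expo z (map_tuple -%R lq) (Sigma_shift I z 1 r) =
  chern_phase * leading_factor I z 1 lq * (phase r * mono lq (deg r)).
Proof.
pose S (j : nat) : C := \sum_(x in blocks_upto I j) z x.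
pose D (j : nat) : C := (\sum_(a < psum lam j) shift_ r a)%N%:R.
pose P (j : nat) : C := pi%:C * 'i * (part lam j)%:Z%:~R.
pose y (j : nat) : C := lq`_j + P j.
have sumS j : (j <= N)%N -> \sum_(a < psum lam j) Sigma_shift I z 1 r a = S j + D j.
  move=> jN; rewrite (eq_bigr (fun a => z (bnth I x0 a) + (shift_ r a)%:R)); last first.
    by move=> a _; rewrite (Sigma_shiftE IP x0).
  by rewrite big_split /= (big_bnth IP x0 _ z) // /D natr_sum.
have degE : mono lq (deg r) = cexp (\sum_(1 <= j < N) D j * (lq`_j.-1 - lq`_j)).
  rewrite cexp_sum big_add1 big_mkord /mono; apply: eq_bigr => i _.
  by rewrite ffunE /qpar -cexpB -cexpMn /D; congr cexp; rewrite mulr_natl.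
have phE : phase r = cexp (- \sum_(1 <= j < N) D j * (P j - P j.-1)).
  rewrite /phase -cexp_sum -sumrN; congr cexp; apply: eq_bigr => j _.
  by rewrite /P intrB; congr (- (_ * _)); ring.
have SE (i : 'I_N) : S i.+1 - S i = block_sum i.
  have iE : Ordinal (ltn_ord i) = i by exact: val_inj.
  rewrite /S (bigID (mem (blocks_upto I i)) (fun x => x \in blocks_upto I i.+1)) /=.
  rewrite (blocks_uptoS I (ltn_ord i)) iE.
  rewrite (eq_bigl (mem (blocks_upto I i))); last first.
    by move=> x /=; rewrite inE; case: (x \in blocks_upto I i); rewrite ?andbF.
  rewrite addrAC subrr add0r; apply: eq_bigl => x; rewrite inE.
  have [xB|xB] /= := boolP (x \in blocks_upto I i); last by rewrite andbT.
  apply/esym/negbTE/negP => xi; move: xB; rewrite mem_blocks_upto.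
  by case/existsP => k /andP[ki xk]; move: ki; rewrite (block_unique IP xk xi) ltnn.
have S0 : S 0%N = 0 by rewrite /S big_pred0 // => x; rewrite /blocks_upto big_pred0 ?inE.
have leadE : chern_phase * leading_factor I z 1 lq =
    cexp (\sum_(i < N) (S i.+1 - S i) * y i - S N * (pi%:C * 'i * n%:Z%:~R)).
  have -> : S N = \sum_(i < N) (S i.+1 - S i).
    by rewrite -(big_mkord xpredT (fun i => S i.+1 - S i)) telescope_sumr // S0 subr0.
  rewrite mulr_suml -sumrB cexp_sum /chern_phase /leading_factor -big_split /=.
  apply: eq_bigr => i _; rewrite -cexpD SE divr1; congr cexp.
  by rewrite -/(block_sum i) /y /P intrB; ring.
rewrite leadE degE phE -!cexpD /expo.
rewrite /twpow -cexp_sum -cexpD; congr cexp.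
rewrite nth_opp -abel_sum //.
have -> : \sum_a z a = S N.
  by rewrite /S (blocks_upto_all IP); apply: eq_bigl => a; rewrite inE.
rewrite [X in _ + X = _](eq_big_nat _ _ (F2 := fun j =>
  S j * (y j.-1 - y j) + (D j * (lq`_j.-1 - lq`_j) - D j * (P j - P j.-1)))); last first.
  move=> j /andP[j1 jN]; rewrite !nth_opp sumS ?(ltnW jN) // /y /P intrB; by field.
by rewrite !big_split /= sumrN /y /P intrB; field.
Qed.

Lemma cabs_phase (r : K) : cabs (phase r) = 1.
Proof.
rewrite /phase cabs_prod big1 // => j _; rewrite cabs_cexp.
set d := (\sum_(a < psum lam j) _)%N; set m := ((part lam j)%:Z - _).
have -> : - (d%:R * (pi%:C * 'i * m%:~R)) = (- (d%:R * pi * m%:~R))%:C * 'i :> C.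
  rewrite rmorphN !rmorphM /= rmorph_nat rmorph_int; ring.
by rewrite imE /= !(mulr0, mul0r, mulr1, subr0, oppr0, expR0).
Qed.

Lemma total_levels (r : K) k :
  (\sum_(1 <= j < k.+1) \sum_(a < psum lam j) shift_ r a =
   \sum_(0 <= i < \sum_(1 <= l < k.+1) psum lam l) nth 0 r i)%N.
Proof.
elim: k => [|k IH]; first by rewrite !big_geq // big_geq.
rewrite big_nat_recr //= IH.
have -> : (\sum_(1 <= l < k.+2) psum lam l = \sum_(1 <= l < k.+1) psum lam l + psum lam k.+1)%N.
  by rewrite big_nat_recr.
set t := (\sum_(1 <= l < k.+1) _)%N.
rewrite [RHS](@big_cat_nat _ _ _ t) ?leq_addr //=; congr (_ + _)%N.
have -> : index_iota t (t + psum lam k.+1) = map (addn t) (index_iota 0 (psum lam k.+1)).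
  by rewrite /index_iota addKn subn0 -iotaDl addn0.
by rewrite big_map big_mkord.
Qed.

(** Each coordinate of the shift occurs in exactly one exponent, so the
    degree of the monomial controls the size of the shift. *)
Lemma sum_deg (r : K) : (\sum_(i < N.-1) deg r i = total r)%N.
Proof.
rewrite (eq_bigr (fun i : 'I_N.-1 => (\sum_(a < psum lam i.+1) shift_ r a)%N)); last first.
  by move=> i _; rewrite ffunE.
rewrite -(big_mkord xpredT (fun i => (\sum_(a < psum lam i.+1) shift_ r a)%N)).
rewrite -(big_add1 _ _ 0 N xpredT (fun i => (\sum_(a < psum lam i) shift_ r a)%N)).
rewrite -{1}(prednK N_gt0) total_levels prednK // -/(nvars lam) big_mkord.
by apply: eq_bigr => i _; rewrite (tnth_nth 0%N).
Qed.

Lemma deg_eq0 (r : K) : deg r = zero_exp N <-> r = zero_shift lam.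
Proof.
split=> [e|->]; last first.
  by apply/ffunP => i; rewrite !ffunE big1 // => a _; rewrite shift_zero.
have : total r = 0%N by rewrite -sum_deg e big1 // => i _; rewrite ffunE.
move=> /eqP; rewrite /total sum_nat_eq0 => /forallP h.
apply: eq_from_tnth => i; have := h i; rewrite implyTb => /eqP ->.
by rewrite (tnth_nth 0%N) nth_nseq ltn_ord.
Qed.

Definition max_ratio lq : R :=
  \big[Num.max/0]_(i < N.-1) cabs (qpar lq i / qpar lq i.+1).

Lemma max_ratio_ge0 lq : 0 <= max_ratio lq.
Proof. by rewrite /max_ratio; apply: bigmax_ge_id. Qed.

Lemma max_ratio_lt1 lq : q_domain lq -> max_ratio lq < 1.
Proof.
move=> qd; apply/bigmax_ltP; split=> // i _.
by have := qd i; rewrite cabsE -[1]/((1 : R)%:C) ltcR.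
Qed.

Lemma cabs_mono lq (m : {ffun 'I_N.-1 -> nat}) :
  cabs (mono lq m) <= max_ratio lq ^+ (\sum_(i < N.-1) m i).
Proof.
rewrite /mono cabs_prod -prodrXr; apply: ler_prod => i _.
rewrite cabs_ge0 cabsX lerXn2r ?nnegrE ?cabs_ge0 ?max_ratio_ge0 //.
exact: (le_bigmax _ (fun i : 'I_N.-1 => cabs (qpar lq i / qpar lq i.+1))).
Qed.

Lemma growth_abs_sum lq (c : R) (D : nat) : 0 <= c -> q_domain lq ->
  exists B, abs_sum (fun r : K => c * weight R r ^+ D * cabs (mono lq (deg r))) B.
Proof.
move=> c0 qd; apply: (tuple_abs_sum (D := D) c0 (max_ratio_ge0 lq) (max_ratio_lt1 qd)).
move=> r; have w0 := weight_ge0 R r.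
rewrite !mulr_ge0 ?exprn_ge0 ?cabs_ge0 //= mulrA ler_wpM2l ?mulr_ge0 ?exprn_ge0 //.
by rewrite -sum_deg; exact: cabs_mono.
Qed.

End Exponentials.

(** * Convergence and continuation in h *)

Lemma zh_domain_notint (R : realType) (n : nat) (z : 'I_n -> R[i]) (h : R[i]) :
  zh_domain 1 z h -> (forall a b, a != b -> notint (z a - z b)) /\
    (forall a b, a != b -> notint (z a - z b - h)).
Proof.
move=> [_ hz]; split=> a b ab.
  by move=> k; have /andP[+ _] := hz a b ab k; rewrite mul1r.
have -> : z a - z b - h = - (z b - z a + h) by ring.
apply: notintN => k; rewrite eq_sym in ab.
by have /andP[_] := hz _ _ ab k; rewrite mul1r.
Qed.

Section Solutions.
Variables (R : realType) (N : nat) (lam : N.-tuple nat).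
Local Notation C := R[i].
Local Notation n := (psum lam N).
Local Notation K := ((nvars lam).-tuple nat).
Variables (I : 'I_N -> {set 'I_n}) (IP : ordered_partition I) (x0 : 'I_n).
Variables (z : 'I_n -> C) (N_gt0 : (0 < N)%N).
Hypothesis hz : forall a b, a != b -> notint (z a - z b).
Implicit Types (lq : N.-tuple C) (g : chern_roots R lam) (h : C).

(** The coefficients of the monomials, a well-defined function of h on the
    whole domain. *)
Definition coef g h (r : K) : C :=
  (-1) ^+ (nvars lam + fldim lam) * summand I x0 z g h r * phase R r.

Definition qseries g lq h : C := summability.sum (fun r => coef g h r * mono lq (deg r)).

(** The solution divided by its leading factor; unlike the defining formula
    it has no singularity at the negative integers. *)
Definition reduced_solution g lq h : C :=
  chern_phase I z * Omega_hat lam h lq 1 * qseries g lq h.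

Lemma coef_bound g h : (forall a b, a != b -> notint (z a - z b - h)) ->
  exists c D, 0 <= c /\ \forall h' \near h, forall r, cabs (coef g h' r) <= c * weight R r ^+ D.
Proof.
move=> hzh; have [[c [D [c0 hc]]] _] := good_summand IP x0 hz hzh g.
exists c, D; split=> //; near=> h' => r.
rewrite /coef; set v := summand _ _ _ _ _ _.
rewrite 2!cabsM cabs_phase cabsX cabsN cabs1 expr1n mul1r mulr1 {}/v.
by move: r; near: h'.
Unshelve. all: by end_near.
Qed.

Lemma qseries_abs g lq h : (forall a b, a != b -> notint (z a - z b - h)) -> q_domain lq ->
  (exists B, abs_sum (fun r : K => cabs (coef g h r * mono lq (deg r))) B) /\
  has_sum (fun r : K => coef g h r * mono lq (deg r)) (qseries g lq h).
Proof.
move=> hzh qd; have [c [D [c0 hc]]] := coef_bound g hzh.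
have {}hc := nbhs_singleton hc.
have [B hB] := growth_abs_sum lam N_gt0 D c0 qd.
have ab : abs_sum (fun r : K => cabs (coef g h r * mono lq (deg r))) B.
  move=> l ul; apply: le_trans (hB l ul); apply: ler_sum => r _.
  by rewrite cabsM ler_wpM2r ?cabs_ge0.
split; first by exists B.
by have [s hs] := abs_sum_has_sum ab; rewrite /qseries (has_sum_sum hs).
Qed.

(** The gamma factors of the residues cancel the normalization of the
    solution. *)
Lemma Psi_hat_formulaE g lq h : notint h -> (forall a b, a != b -> notint (z a - z b - h)) ->
  q_domain lq ->
  Psi_hat_formula I z h lq 1 g = leading_factor I z 1 lq * reduced_solution g lq h.
Proof.
move=> hh hzh qd; have [_ hs] := qseries_abs g hzh qd.
have G0 : cGamma (- h) != 0 by apply/cGamma_neq0/notint_nopole/notintN.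
rewrite /Psi_hat_formula expr1n invr1 mul1r mulr1.
pose k := (-1) ^+ (nvars lam + fldim lam) * (chern_phase I z * leading_factor I z 1 lq *
  cGamma (- h) ^+ nvars lam).
have e2 : (-1) ^+ (nvars lam + fldim lam) * (-1) ^+ (nvars lam + fldim lam) = 1 :> C.
  by rewrite -exprD addnn -mul2n exprM sqrrN expr1n expr1n.
have -> : (fun r : K => iter_residue (Phi z h (map_tuple -%R lq) (- 1)) (Sigma_shift I z 1 r)
    * Qclass h g * What h (Sigma_shift I z 1 r) g) =
    (fun r => k * (coef g h r * mono lq (deg r))).
  apply/funext => r; rewrite (iter_residue_Phi IP x0 N_gt0 hh hz hzh) (expoE IP x0) //.
  rewrite /coef /summand /k.
  set e := (-1) ^+ _ in e2 *; set T1 := regular _ _ _ _; set T2 := \prod_(_ <- _) _.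
  set T3 := What _ _ _; set T4 := Qclass _ _; set T5 := cGamma _ ^+ _.
  set T6 := chern_phase _ _; set T7 := leading_factor _ _ _ _; set T8 := phase _ _; set T9 := mono _ _.
  transitivity (e * e * (T6 * T7 * (T8 * T9) * T1 * T5 * T2 * T4 * T3)); last by ring.
  by rewrite e2 mul1r.
rewrite (has_sum_sum (has_sumZ k hs)) /reduced_solution /k.
have Gn : cGamma (- h) ^+ nvars lam != 0 by rewrite expf_neq0.
set e := (-1) ^+ _ in e2 *; set T5 := cGamma _ ^+ _ in Gn *.
set T6 := chern_phase _ _; set T7 := leading_factor _ _ _ _; set Om := Omega_hat _ _ _ _.
set S := qseries _ _ _.
transitivity (e * e * (T5^-1 * T5) * (T7 * (T6 * Om * S))); first by ring.
by rewrite e2 mulVf // !mul1r.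
Qed.

Lemma Omega_hat_cont lq h : {for h, continuous (fun h' => Omega_hat lam h' lq 1)}.
Proof.
apply: cont_prod => i _; apply: cont_prod => j _; apply: cont_cexp.
by do 3 (apply: contM; last exact: cont_cst); exact: cont_id.
Qed.

Lemma generic_near h : (forall a b, a != b -> notint (z a - z b - h)) ->
  \forall h' \near h, forall a b, a != b -> notint (z a - z b - h').
Proof.
move=> hzh; pose J := {ab : 'I_n * 'I_n | ab.1 != ab.2}.
have [d d0 hd] := notint_away_fin (fun ab : J => hzh _ _ (valP ab)).
have d20 : 0 < d / 2 by rewrite divr_gt0.
have hn := near_cabs h d20; near=> h' => a b ab.
have e : cabs (z a - z b - h' - (z a - z b - h)) < d / 2.
  have -> : z a - z b - h' - (z a - z b - h) = h - h' by ring.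
  by rewrite cabsB; near: h'.
apply: away_notint (away_near (hd (exist _ (a, b) ab)) e).
by rewrite subr_gt0 gtr_pMr // invf_lt1 // ltr1n.
Unshelve. all: by end_near.
Qed.

(** The bound [coef_bound] is uniform near h. *)
Lemma reduced_solution_cont g lq h : (forall a b, a != b -> notint (z a - z b - h)) -> q_domain lq ->
  {for h, continuous (reduced_solution g lq)}.
Proof.
move=> hzh qd; have [_ hs] := qseries_abs g hzh qd.
have [_ gc] := good_summand IP x0 hz hzh g.
have [c [D [c0 hc]]] := coef_bound g hzh.
have [B hB] := growth_abs_sum lam N_gt0 D c0 qd.
have cc r : {for h, continuous (fun h' => coef g h' r * mono lq (deg r))}.
  apply: contM; last exact: cont_cst.
  by apply: contM; [apply: contM; [exact: cont_cst | exact: gc] | exact: cont_cst].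
have cs : qseries g lq h' @[h' --> h] --> qseries g lq h.
  apply: (@dominated_has_sum R K C (nbhs h) _
    (fun h' r => coef g h' r * mono lq (deg r)) _ (qseries g lq) _ _ B hB _ _ _ _ hs).
  - by move=> r; rewrite !mulr_ge0 ?exprn_ge0 ?weight_ge0 ?cabs_ge0.
  - near=> h' => r; rewrite cabsM ler_wpM2r ?cabs_ge0 //.
    by move: r; near: h'.
  - exact: cc.
  - have hn := generic_near hzh; near=> h'.
    by apply: (qseries_abs g _ qd).2; near: h'.
  - by move=> r; rewrite cabsM ler_wpM2r ?cabs_ge0 //; exact: (nbhs_singleton hc).
apply: (contM (f := fun h' => chern_phase I z * Omega_hat lam h' lq 1) _ cs).
by apply: contM; [exact: cont_cst | exact: Omega_hat_cont].
Unshelve. all: by end_near.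
Qed.

(** At a negative integer h the limit is taken along generic values of h,
    where the formula agrees with a function that is continuous at h. *)
Lemma Psi_hatE g lq h : zh_domain 1 z h -> q_domain lq ->
  Psi_hat I z h lq 1 g = leading_factor I z 1 lq * reduced_solution g lq h.
Proof.
move=> zhP qd; have [h1 _] := zhP; have [_ hzh] := zh_domain_notint zhP.
rewrite /Psi_hat; case: asboolP => [[m hm]|hm]; last first.
  apply: Psi_hat_formulaE => // -[m|m].
    by have := h1 m; rewrite mul1r.
  by apply/eqP => e; apply: hm; exists m; rewrite mul1r e NegzE intrN.
have hE : h = (- (m.+1%:Z))%:~R by rewrite hm mul1r intrN.
have lim : leading_factor I z 1 lq * reduced_solution g lq h' @[h' --> h^'] -->
    leading_factor I z 1 lq * reduced_solution g lq h.
  apply/(continuous_withinNx (fun h' => leading_factor I z 1 lq * reduced_solution g lq h')).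
  by apply: contM; [exact: cont_cst | exact: reduced_solution_cont].
apply/cvg_lim => //; apply: cvg_trans lim; apply: near_eq_cvg.
have d0 : 0 < 2^-1 :> R by rewrite invr_gt0.
have hn := near_cabs h d0; have gn := generic_near hzh.
rewrite /dnbhs near_withinE; near=> h' => h'h.
apply/esym/Psi_hat_formulaE => //.
  by apply: (@notint_near_int _ (- m.+1%:Z)); rewrite -hE //; near: h'.
by near: h'.
Unshelve. all: by end_near.
Qed.
End Solutions.

(** * The leading term *)

Section LeadingTerm.
Variables (R : realType) (N : nat) (lam : N.-tuple nat).
Local Notation C := R[i].
Local Notation n := (psum lam N).
Variables (I : 'I_N -> {set 'I_n}) (IP : ordered_partition I) (x0 : 'I_n) (i0 : 'I_N).
Variables (z : 'I_n -> C) (h : C) (N_gt0 : (0 < N)%N) (zhP : zh_domain 1 z h).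

Let hz := (zh_domain_notint zhP).1.
Let hzh := (zh_domain_notint zhP).2.

Lemma reduced_solution_power_series g : power_series (fun lq => reduced_solution I x0 z g lq h)
  (chern_phase I z * coef I x0 z g h (zero_shift lam)).
Proof.
rewrite -[chern_phase I z]mulr1; apply: power_seriesM; first apply: power_seriesM.
- exact: power_series_cst.
- suff : power_series (fun lq => Omega_hat lam h lq 1)
    (\prod_(i < N) \prod_(j < N | (i < j)%N) 1) by under eq_bigr do rewrite big1_eq; rewrite big1_eq.
  apply: power_series_prod => i _; apply: power_series_prod => j ij.
  exact: power_series_binomial.
- apply: (power_series_family (p := @deg N lam)); first exact: deg_eq0.
  by move=> lq qd; exact: qseries_abs.
Qed.

Lemma coef_zero J g : ordered_partition J -> at_fixed_point z J g ->
  coef I x0 z g h (zero_shift lam) = gamma_class h g * Delta I z g.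
Proof.
move=> JP gJ; rewrite /coef (summand_zero IP x0 i0 hz hzh JP gJ).
have -> : phase R (zero_shift lam) = 1; last by rewrite mulr1.
rewrite /phase big1 // => j _.
rewrite (big1 _ _ _ (fun a _ => shift_zero a)) mul0r oppr0; exact: cexp0.
Qed.

(** Any representative of the leading class may be taken, since only its
    values at the fixed points enter. *)
Lemma Psi_hat_leading_term (L : N.-tuple C -> coh_class R lam) :
  (forall J g lq, ordered_partition J -> at_fixed_point z J g ->
    L lq g = leading_factor I z 1 lq *
      (chern_phase I z * (gamma_class h g * Delta I z g))) ->
  is_leading_term I z 1 (fun lq => Psi_hat I z h lq 1) L.
Proof.
move=> LE; have [c hc] := choice reduced_solution_power_series.
exists (fun m g => c g m) => lq qd; split=> [J JP g gJ|J JP g gJ].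
  exists (reduced_solution I x0 z g lq h); first by apply/has_sumP; exact: ((hc g).2 lq qd).2.
  exact: Psi_hatE.
by rewrite (LE J) // -(coef_zero JP gJ) -(hc g).1.
Qed.

End LeadingTerm.

Theorem theoremB1 (R : realType) (N : nat) (lam : N.-tuple nat)
    (N_gt0 : (0 < N)%N) (n_gt0 : (0 < psum lam N)%N)
    (z : 'I_(psum lam N) -> R[i]) (h : R[i]) (zhP : zh_domain 1 z h)
    (I : 'I_N -> {set 'I_(psum lam N)}) (IP : ordered_partition I) :
  is_leading_term I z 1 (fun lq => Psi_hat I z h lq 1)
    (fun lq g => gamma_class h g * chern_exp lq g * Delta I z g)
  /\ forall gI : chern_roots R lam, at_fixed_point z I gI ->
     is_leading_term I z 1 (fun lq => Psi_hat I z h lq 1)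
       (fun lq g => gamma_class h gI * chern_exp lq gI * Delta I z g).
Proof.
have x0 := Ordinal n_gt0; have i0 := Ordinal N_gt0.
have rearr (a b c d : R[i]) : a * (c * b) * d = b * (c * (a * d)) by ring.
split=> [|gI hI]; apply: (Psi_hat_leading_term IP x0 i0 N_gt0 zhP) => J g lq JP gJ.
  have [IJ|IJ] := pselect (I = J); last by rewrite (Delta_other IP i0 JP gJ IJ) !mulr0.
  by subst J; rewrite (chern_expE _ gJ) rearr.
have [IJ|IJ] := pselect (I = J); last by rewrite (Delta_other IP i0 JP gJ IJ) !mulr0.
subst J; rewrite (chern_expE _ hI) rearr; congr (_ * (_ * (_ * _))).
pose F x y := cGamma (1 + y - x) * cGamma (1 + x - y - h).
by rewrite /gamma_class (roots_pair_prod IP hI i0 F) (roots_pair_prod IP gJ i0 F).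
Qed.
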